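(* For every integer $n\ge 3$, the Bergman kernel $K_{\mathbb G_n}$ of the symmetrized polydisc $\mathbb G_n$ has zeros, i.e. there exist points $z,w\in\mathbb G_n$ with $K_{\mathbb G_n}(z,w)=0$.
   Context: Let $\mathbb D$ be the unit disc in $\mathbb C$. For $\lambda=(\lambda_1,\dots,\lambda_n)\in\mathbb C^n$ define $\pi_n=(\pi_{n,1},\dots,\pi_{n,n}):\mathbb C^n\to\mathbb C^n$ by $\pi_{n,k}(\lambda)=\sum_{1\le j_1<\dots<j_k\le n}\lambda_{j_1}\cdots\lambda_{j_k}$, $1\le k\le n$ (the elementary symmetric polynomials). The symmetrized polydisc is the domain $\mathbb G_n=\pi_n(\mathbb D^n)\subset\mathbb C^n$. $K_{\mathbb G_n}$ denotes its Bergman kernel, a function on $\mathbb G_n\times\mathbb G_n$. *)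

(* Defs.v *)
From HB Require Import structures.
From mathcomp Require Import all_boot all_order all_algebra.
From mathcomp Require Import all_classical all_reals all_analysis.
From mathcomp Require Import complex.
From mathcomp Require Import Rstruct Rstruct_topology.
Set Implicit Arguments. Unset Strict Implicit. Unset Printing Implicit Defensive.
Import Order.TTheory GRing.Theory Num.Theory.
Local Open Scope ring_scope.

Notation Rr := Rdefinitions.R.
(* the complex numbers *)
Notation C := (Rr[i]).

(* points of C^n are n-tuples of complex numbers *)
Notation Cn n := (n.-tuple C).

(* |z|^2 as a real number *)
Definition sqnorm (z : C) : Rr := (complex.Re z) ^+ 2 + (complex.Im z) ^+ 2.

(* ---------- the symmetrization map and the symmetrized polydisc ---------- *)

(* pi_{n,k}(lam) = sum_{1 <= j_1 < ... < j_k <= n} lam_{j_1} ... lam_{j_k} *)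
Definition esym_k (n k : nat) (lam : Cn n) : C :=
  \sum_(S : {set 'I_n} | #|S| == k) \prod_(j in S) tnth lam j.

(* pi_n = (pi_{n,1}, ..., pi_{n,n}) *)
Definition pi_n (n : nat) (lam : Cn n) : Cn n :=
  [tuple esym_k k.+1 lam | k < n].

(* the unit disc D and the polydisc D^n *)
Definition unit_disc : set C := [set z | `|z| < 1].

(* G_n = pi_n(D^n) *)
Definition Gn (n : nat) : set (Cn n) :=
  [set z | exists lam : Cn n, (forall j, unit_disc (tnth lam j)) /\ z = pi_n lam].

(* ---------- Lebesgue measure / integration on C^n = R^(2n) ---------- *)

(* integral over C = R^2 of a nonnegative-or-signed extended real function,
   with respect to 2-dimensional Lebesgue measure, as an iterated integral *)
Definition cint (g : C -> \bar Rr) : \bar Rr :=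
  (\int[@lebesgue_measure Rr]_x \int[@lebesgue_measure Rr]_y g (complex.Complex x y))%E.

(* integral over C^m with respect to 2m-dimensional Lebesgue measure,
   as an iterated integral over the complex coordinates (Fubini--Tonelli) *)
Fixpoint vint (m : nat) : (Cn m -> \bar Rr) -> \bar Rr :=
  match m return (Cn m -> \bar Rr) -> \bar Rr with
  | 0 => fun f => f [tuple]
  | m'.+1 => fun f => cint (fun z => vint (fun t : Cn m' => f (cons_tuple z t)))
  end.

(* restriction (extension by 0) of a real function to a set D *)
Definition restr (n : nat) (D : set (Cn n)) (g : Cn n -> Rr) : Cn n -> \bar Rr :=
  fun z => (if `[< D z >] then g z else 0)%:E.

(* ---------- holomorphic functions and the Bergman space ---------- *)

Definition addCn (n : nat) (z h : Cn n) : Cn n :=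
  [tuple tnth z j + tnth h j | j < n].

(* f is holomorphic (complex Frechet differentiable) at every point of D *)
Definition holomorphic_on (n : nat) (D : set (Cn n)) (f : Cn n -> C) : Prop :=
  forall z, D z -> exists a : Cn n, forall eps : Rr, 0 < eps ->
    exists2 delta : Rr, 0 < delta & forall h : Cn n,
      (forall j, `|tnth h j| < complex.Complex delta 0) -> D (addCn z h) ->
      `|f (addCn z h) - f z - \sum_j tnth a j * tnth h j|
        <= complex.Complex eps 0 * \sum_j `|tnth h j|.

(* the Bergman space A^2(D): holomorphic square integrable functions on D *)
Definition bergman_space (n : nat) (D : set (Cn n)) (f : Cn n -> C) : Prop :=
  holomorphic_on D f /\ (vint (restr D (fun z => sqnorm (f z))) < +oo)%E.

(* K is the Bergman kernel of D: for every w in D, K(.,w) lies in A^2(D)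
   and reproduces A^2(D):  f(w) = \int_D f(z) conj(K(z,w)) dV(z)
   (real and imaginary parts separately). *)
Definition is_bergman_kernel (n : nat) (D : set (Cn n))
    (K : Cn n -> Cn n -> C) : Prop :=
  forall w, D w ->
    bergman_space D (fun z => K z w) /\
    forall f, bergman_space D f ->
      vint (restr D (fun z => complex.Re (f z * (K z w)^*))) = (complex.Re (f w))%:E /\
      vint (restr D (fun z => complex.Im (f z * (K z w)^*))) = (complex.Im (f w))%:E.

(* Main.v *)
Require Import Defs.
From HB Require Import structures.
From mathcomp Require Import all_boot all_order all_algebra.
From mathcomp Require Import all_classical all_reals all_analysis.
From mathcomp Require Import complex.
From mathcomp Require Import Rstruct Rstruct_topology.
From mathcomp Require Import measurable_realfun borel_hierarchy.
From mathcomp Require Import perm cyclic separable cyclotomic.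
From mathcomp Require Import ring lra zify.
Set Implicit Arguments. Unset Strict Implicit. Unset Printing Implicit Defensive.
Import Order.TTheory GRing.Theory Num.Theory.
Import numFieldNormedType.Exports.
Local Open Scope ring_scope.
Local Open Scope classical_set_scope.

(** For a point t of the polydisc write V(t) for its Vandermonde product [vdm t]. The real Jacobian
    of [pi_n] is |V|^2, so f -> f(pi_n) V carries A^2(G_n), up to a constant factor in the norm,
    onto the alternating part of A^2(D^n). In terms of the kernel of the polydisc this means that
    K(pi x, pi y) is a constant times det[(1 - x_j conj(y_k))^-2] / (V(x) conj(V(y))). A zero of K
    is therefore a zero of this determinant at points x, y with pairwise distinct coordinates.

    Such points come from roots of unity. Let w be a primitive n-th root of 1, b^(2n) = -1/(n-1),
    y_k = a_k = b w^k and x_k = conj(a_k). All the column sums of the matrix (1 - y_k a_j)^-2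
    vanish, because the sum over k of (1 - u w^k)^-2 is n (1 + (n-1) u^n) / (1 - u^n)^2 and here u^n
    = -1/(n-1). The points lie in the open polydisc because 1/(n-1) < 1, which is where n >= 3
    enters ([det_kernel_zero]).

    The formula for K is used only through its consequences. Let f = K(., pi y), let b now be the
    point with coordinates -a_j = -conj(x_j), and let D(t) = det[(1 - t_k conj(x_j))^-2]. Up to sign
    D is V times a function [kap b] of pi_n(t); this function is given by an explicit determinant,
    is holomorphic and bounded on G_n, and vanishes at pi y ([det_kernel_kap]). The reproducing
    property of f, applied to [kap b], says that [kap b] and f are orthogonal. Pulled back by
    [integral_pi] this reads: the integral of f(pi_n) V conj(D) over the polydisc is 0. Expanding D
    over permutations and using the reproducing formula of the polydisc ([bergman_polydisc]), the
    same integral equals n! c0^n f(pi x) V(x). Hence f(pi x) = 0 ([kernel_zero]).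

    The analysis is built from the ground up. Holomorphic means complex differentiable at every
    point, with no continuity of the derivative, so Cauchy's theorem is proved by a subdivision
    argument in which B-spline bumps replace contours ([goursat]). It yields the reproducing formula
    on the disc ([bergman_disc]). The change of variables along [pi_n] avoids local inverses: the
    image of |p'|^2 dA under a polynomial p is shown to be a multiple of Lebesgue measure
    ([poly_pushforward]), and [pi_n] is treated by adding one root at a time ([step_integral]). *)

Notation leb := (@lebesgue_measure Rr).
Notation mR := (measurableTypeR Rr).

(** * Lebesgue measure on the complex plane and on complex n-space *)

Definition cpair (z : C) : mR * mR := (complex.Re z, complex.Im z).

(** The sigma-algebra is transported from the real plane, so that measurability of a complex
    function is that of its real and imaginary parts. *)
Definition cmeasurable : set (set C) := preimage_set_system setT cpair measurable.

Lemma cmeasurable0 : cmeasurable set0.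
Proof. by exists set0 => //; rewrite preimage_set0 setI0. Qed.

Lemma cmeasurableC A : cmeasurable A -> cmeasurable (~` A).
Proof.
move=> [B mB <-]; exists (~` B); first exact: measurableC.
by rewrite !setTI preimage_setC.
Qed.

Lemma cmeasurable_bigcup (F : (set C)^nat) : (forall i, cmeasurable (F i)) ->
  cmeasurable (\bigcup_i (F i)).
Proof.
move=> mF.
have /choice[G HG] : forall i, exists B, measurable B /\ cpair @^-1` B = F i.
  by move=> i; have [B mB <-] := mF i; exists B; rewrite setTI.
exists (\bigcup_i G i); first by apply: bigcupT_measurable => i; case: (HG i).
rewrite setTI preimage_bigcup; apply: eq_bigcupr => i _.
by case: (HG i) => _ <-.
Qed.

HB.instance Definition _ := isPointed.Build (complex Rr) 0.
HB.instance Definition _ := @isMeasurable.Build default_measure_display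
  (complex Rr) cmeasurable cmeasurable0 cmeasurableC cmeasurable_bigcup.

Lemma measurable_cpair : measurable_fun [set: C] cpair.
Proof. by move=> _ B mB; exists B. Qed.

Lemma measurable_Re : measurable_fun [set: C] (@complex.Re Rr : C -> mR).
Proof. exact: (measurableT_comp measurable_fst measurable_cpair). Qed.

Lemma measurable_Im : measurable_fun [set: C] (@complex.Im Rr : C -> mR).
Proof. exact: (measurableT_comp measurable_snd measurable_cpair). Qed.

Definition pairc (p : mR * mR) : C := complex.Complex p.1 p.2.

Lemma cpairK : cancel cpair pairc. Proof. by case. Qed.
Lemma paircK : cancel pairc cpair. Proof. by case. Qed.

Lemma measurable_pairc : measurable_fun [set: mR * mR] pairc.
Proof.
move=> _ B [A mA <-]; rewrite setTI setTI.
rewrite (_ : _ @^-1` _ = A)//; apply/seteqP.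
by split => [x|x] /=; rewrite ?paircK // => ?; rewrite /preimage /= paircK.
Qed.

Lemma measurable_fun_complex d (T : measurableType d) (f : T -> C) :
  measurable_fun setT (fun x => complex.Re (f x) : mR) ->
  measurable_fun setT (fun x => complex.Im (f x) : mR) -> measurable_fun setT f.
Proof.
move=> mr mi.
have -> : f = pairc \o (fun x => (complex.Re (f x) : mR, complex.Im (f x) : mR)).
  by apply/funext => x /=; case: (f x).
by apply: measurableT_comp; [exact: measurable_pairc | exact: measurable_fun_pair].
Qed.

(** Products of increasing exhaustions exhaust the product. The measures on C and C^n below are
    images of product measures and must be sigma-finite for Fubini to be iterated. *)
Lemma product_sigma_finite d1 d2 (T1 : measurableType d1) (T2 : measurableType d2)
  (m1 : {sigma_finite_measure set T1 -> \bar Rr})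
  (m2 : {sigma_finite_measure set T2 -> \bar Rr}) :
  sigma_finite setT (m1 \x m2)%E.
Proof.
have /sigma_finiteP[F [TF ndF Foo]] := sigma_finiteT m1.
have /sigma_finiteP[G [TG ndG Goo]] := sigma_finiteT m2.
exists (fun n => F n `*` G n).
  apply/esym; rewrite -subTset => -[x y] _.
  have [n _ Fx] : (\bigcup_i F i) x by rewrite -TF.
  have [k _ Gy] : (\bigcup_i G i) y by rewrite -TG.
  exists (maxn n k) => //; split => /=.
  - by move: x Fx; exact/subsetPset/ndF/leq_maxl.
  - by move: y Gy; exact/subsetPset/ndG/leq_maxr.
move=> k; have [? ?] := Foo k; have [? ?] := Goo k.
split; first exact: measurableX.
by rewrite product_measure1E// lte_mul_pinfty// ge0_fin_numE.
Qed.

(** Planar Lebesgue measure carried by C itself, so that a complex coordinate can be one factor of a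
    product measure. *)
Definition muC (A : set C) : \bar Rr := (leb \x leb)%E (pairc @^-1` A).

Lemma muC0 : muC set0 = 0%E. Proof. by rewrite /muC preimage_set0 measure0. Qed.

Lemma muC_ge0 A : (0 <= muC A)%E. Proof. exact: measure_ge0. Qed.

Lemma measurable_preimage_pairc A : measurable A -> measurable (pairc @^-1` A).
Proof. by move=> mA; rewrite -[X in measurable X]setTI; exact: measurable_pairc. Qed.

Lemma muC_sigma_additive : semi_sigma_additive muC.
Proof.
move=> F mF tF mUF; rewrite /muC preimage_bigcup.
apply: measure_semi_sigma_additive.
- by move=> n; exact: measurable_preimage_pairc.
- apply/trivIsetP => /= i j _ _ ij; rewrite -preimage_setI.
  by move/trivIsetP : tF => /(_ _ _ _ _ ij) ->//; rewrite preimage_set0.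
- by rewrite -preimage_bigcup; exact: measurable_preimage_pairc.
Qed.

HB.instance Definition _ := isMeasure.Build _ _ _ muC muC0 muC_ge0 muC_sigma_additive.

Lemma muC_sigma_finite : sigma_finite setT muC.
Proof.
have [F TF Foo] := product_sigma_finite leb leb.
exists (fun n => cpair @^-1` (F n)).
  by rewrite -preimage_bigcup -TF preimage_setT.
move=> k; have [mF Foo'] := Foo k; split.
  by rewrite -[X in measurable X]setTI; apply: measurable_cpair.
rewrite /muC (_ : pairc @^-1` _ = F k) //.
by apply/seteqP; split => -[].
Qed.

HB.instance Definition _ := Measure_isSigmaFinite.Build _ _ _ muC muC_sigma_finite.

Section cint_muC.
Local Open Scope ereal_scope.

Lemma cintE_ge0 (g : C -> \bar Rr) : measurable_fun setT g -> (forall z, 0 <= g z) ->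
  cint g = \int[muC]_z g z.
Proof.
move=> mg g0.
rewrite (_ : \int[muC]_z g z = \int[(leb \x leb)%E]_p g (pairc p)).
  rewrite (@fubini_tonelli1 _ _ _ _ _ leb leb (g \o pairc)) //.
    exact: measurableT_comp mg measurable_pairc.
  by move=> p; exact: g0.
by apply: (ge0_integral_pushforward measurable_pairc _ measurableT mg) => z _; exact: g0.
Qed.

Lemma integrable_muC (g : C -> \bar Rr) : muC.-integrable setT g <->
  (leb \x leb).-integrable setT (g \o pairc).
Proof.
have mgp h : measurable_fun [set: C] h -> 
    \int[muC]_z `|h z| = \int[leb \x leb]_p `|(h \o pairc) p|.
  move=> mh; apply: (ge0_integral_pushforward measurable_pairc _ measurableT) => //.
  exact: measurableT_comp.
split=> /integrableP[mg ig]; apply/integrableP; split.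
- exact: measurableT_comp mg measurable_pairc.
- by rewrite -mgp.
- have -> : g = (g \o pairc) \o cpair by apply/funext => z /=; rewrite cpairK.
  exact: measurableT_comp mg measurable_cpair.
- rewrite mgp //.
  have -> : g = (g \o pairc) \o cpair by apply/funext => z /=; rewrite cpairK.
  exact: measurableT_comp mg measurable_cpair.
Qed.

Lemma integral_muC (g : C -> \bar Rr) : muC.-integrable setT g ->
  \int[muC]_z g z = \int[leb \x leb]_p g (pairc p).
Proof.
move=> ig; apply: (integral_pushforward measurable_pairc _ _ measurableT).
  by case/integrableP : ig.
exact/integrable_muC.
Qed.

Lemma cintE (g : C -> \bar Rr) : muC.-integrable setT g ->
  cint g = \int[muC]_z g z.
Proof.
move=> ig; rewrite integral_muC // -[RHS]integral12_prod_meas1 //.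
exact/integrable_muC.
Qed.

End cint_muC.

Section muN_def.
Variable n : nat.

Definition consc (p : C * Cn n) : Cn n.+1 := cons_tuple p.1 p.2.
Definition unconsc (t : Cn n.+1) : C * Cn n := (thead t, behead_tuple t).

Lemma conscK : cancel consc unconsc.
Proof. by case=> z t; rewrite /unconsc /consc /= theadE; congr pair; apply: val_inj. Qed.

Lemma unconscK : cancel unconsc consc.
Proof. by move=> t; rewrite [RHS]tuple_eta; apply: val_inj. Qed.

Lemma measurable_consc : measurable_fun [set: C * Cn n] consc.
Proof.
exact: (@measurable_cons _ _ _ _ fst _ snd measurable_fst measurable_snd).
Qed.

Lemma measurable_unconsc : measurable_fun [set: Cn n.+1] unconsc.
Proof.
apply: measurable_fun_pair; first exact: measurable_tnth.
exact: measurable_behead.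
Qed.

Variable m : {sigma_finite_measure set (Cn n) -> \bar Rr}.

(** Adds one complex coordinate in front, in the same order as the recursion of [vint]. *)
Definition muS (A : set (Cn n.+1)) : \bar Rr := (muC \x m)%E (consc @^-1` A).

Lemma muS0 : muS set0 = 0%E. Proof. by rewrite /muS preimage_set0 measure0. Qed.

Lemma muS_ge0 A : (0 <= muS A)%E. Proof. exact: measure_ge0. Qed.

Lemma measurable_preimage_consc A : measurable A -> measurable (consc @^-1` A).
Proof. by move=> mA; rewrite -[X in measurable X]setTI; exact: measurable_consc. Qed.

Lemma muS_sigma_additive : semi_sigma_additive muS.
Proof.
move=> F mF tF mUF; rewrite /muS preimage_bigcup.
apply: measure_semi_sigma_additive.
- by move=> k; exact: measurable_preimage_consc.
- apply/trivIsetP => /= i j _ _ ij; rewrite -preimage_setI.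
  by move/trivIsetP : tF => /(_ _ _ _ _ ij) ->//; rewrite preimage_set0.
- by rewrite -preimage_bigcup; exact: measurable_preimage_consc.
Qed.

HB.instance Definition _ := isMeasure.Build _ _ _ muS muS0 muS_ge0 muS_sigma_additive.

Lemma muS_sigma_finite : sigma_finite setT muS.
Proof.
have [F TF Foo] := product_sigma_finite muC m.
exists (fun n => unconsc @^-1` (F n)).
  by rewrite -preimage_bigcup -TF preimage_setT.
move=> k; have [mF Foo'] := Foo k; split.
  by rewrite -[X in measurable X]setTI; apply: measurable_unconsc.
rewrite /muS (_ : consc @^-1` _ = F k) //.
by apply/seteqP; split => p; rewrite /preimage /= conscK.
Qed.

HB.instance Definition _ := Measure_isSigmaFinite.Build _ _ _ muS muS_sigma_finite.

Section muS_integral.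
Local Open Scope ereal_scope.

Lemma integral_muS_ge0 (g : Cn n.+1 -> \bar Rr) : measurable_fun setT g ->
  (forall t, 0 <= g t) ->
  \int[muS]_t g t = \int[muC]_z \int[m]_t g (cons_tuple z t).
Proof.
move=> mg g0.
transitivity (\int[muC \x m]_p g (consc p)); last first.
  rewrite (@fubini_tonelli1 _ _ _ _ _ muC m (g \o consc)) //.
    exact: measurableT_comp mg measurable_consc.
  by move=> p; exact: g0.
by apply: (ge0_integral_pushforward measurable_consc _ measurableT mg) => t _; exact: g0.
Qed.

Lemma integrable_muS (g : Cn n.+1 -> \bar Rr) : muS.-integrable setT g <->
  (muC \x m).-integrable setT (g \o consc).
Proof.
have mgp h : measurable_fun [set: Cn n.+1] h ->
    \int[muS]_z `|h z| = \int[muC \x m]_p `|(h \o consc) p|.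
  move=> mh; apply: (ge0_integral_pushforward measurable_consc _ measurableT) => //.
  exact: measurableT_comp.
have ge : g = (g \o consc) \o unconsc by apply/funext => z /=; rewrite unconscK.
split=> /integrableP[mg ig]; apply/integrableP; split.
- exact: measurableT_comp mg measurable_consc.
- by rewrite -mgp.
- by rewrite ge; exact: measurableT_comp mg measurable_unconsc.
- by rewrite mgp // ge; exact: measurableT_comp mg measurable_unconsc.
Qed.

Lemma integral_muS (g : Cn n.+1 -> \bar Rr) : muS.-integrable setT g ->
  \int[muS]_t g t = \int[muC]_z \int[m]_t g (cons_tuple z t).
Proof.
move=> ig; transitivity (\int[muC \x m]_p g (consc p)).
  apply: (integral_pushforward measurable_consc _ _ measurableT).
    by case/integrableP : ig.
  exact/integrable_muS.
rewrite -[LHS]integral12_prod_meas1 //; exact/integrable_muS.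
Qed.

Lemma integrable_muS_F (g : Cn n.+1 -> \bar Rr) : muS.-integrable setT g ->
  muC.-integrable setT (fun z => \int[m]_t g (cons_tuple z t)).
Proof. by move=> /integrable_muS/integrable_fubini_F. Qed.

Lemma ae_integrable_muS (g : Cn n.+1 -> \bar Rr) : muS.-integrable setT g ->
  {ae muC, forall z, m.-integrable setT (fun t => g (cons_tuple z t))}.
Proof. by move=> /integrable_muS/ae_integrable1. Qed.

Lemma measurable_muS_F (g : Cn n.+1 -> \bar Rr) : measurable_fun setT g ->
  (forall t, 0 <= g t) ->
  measurable_fun setT (fun z => \int[m]_t g (cons_tuple z t)).
Proof.
move=> mg g0; apply: (@measurable_fun_fubini_tonelli_F _ _ _ _ _ m (g \o consc)).
  exact: measurableT_comp mg measurable_consc.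
by move=> p; exact: g0.
Qed.

End muS_integral.
End muN_def.

(** C^0 is one point of mass 1, in agreement with [vint] at 0. *)
Definition tuple0_measure : {sigma_finite_measure set (Cn 0) -> \bar Rr} :=
  @dirac _ (Cn 0) [tuple] Rr.

Fixpoint muN n : {sigma_finite_measure set (Cn n) -> \bar Rr} :=
  match n with 0 => tuple0_measure | n'.+1 => muS (muN n') end.

(** * The iterated integral [vint] as an integral for the product measure *)

Section vintE.
Local Open Scope ereal_scope.

Lemma vintE_ge0 n (g : Cn n -> \bar Rr) : measurable_fun setT g ->
  (forall z, 0 <= g z) -> vint g = \int[muN n]_z g z.
Proof.
elim: n g => [|n IH] g mg g0 /=.
  by rewrite integral_dirac // diracT mul1e.
rewrite integral_muS_ge0 //.
have mz z : measurable_fun setT (fun t : Cn n => g (cons_tuple z t)).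
  apply: (measurableT_comp mg).
  exact: (measurableT_comp (@measurable_consc n) (pair1_measurable _)).
rewrite cintE_ge0.
- by apply: eq_integral => z _; rewrite IH.
- under eq_fun do rewrite IH //.
  exact: measurable_muS_F.
- by move=> z; rewrite IH //; exact: integral_ge0.
Qed.

End vintE.

Section vintE_signed.
Local Open Scope ereal_scope.

(** Valid for signed f without integrability: by Tonelli the integrals of both parts are measurable
    in x, and so is their extended-real difference. This makes [vint] measurable in its parameters
    even at the exceptional slices. *)
Lemma measurable_fun_integral d1 d2 (T1 : measurableType d1) (T2 : measurableType d2)
  (m : {sigma_finite_measure set T2 -> \bar Rr}) (f : T1 * T2 -> \bar Rr) :
  measurable_fun setT f -> measurable_fun setT (fun x => \int[m]_y f (x, y)).
Proof.
move=> mf; under eq_fun do rewrite integralE.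
apply: emeasurable_funB.
- have := @measurable_fun_fubini_tonelli_F _ _ _ _ _ m (f^\+)
    (measurable_funepos mf) (fun p => funepos_ge0 f p).
  congr measurable_fun; apply/funext => x; apply: eq_integral => y _.
  by rewrite !funeposE.
- have := @measurable_fun_fubini_tonelli_F _ _ _ _ _ m (f^\-)
    (measurable_funeneg mf) (fun p => funeneg_ge0 f p).
  congr measurable_fun; apply/funext => x; apply: eq_integral => y _.
  by rewrite !funenegE.
Qed.

Lemma measurable_cint d (T : measurableType d) (g : T * C -> \bar Rr) :
  measurable_fun setT g -> measurable_fun setT (fun p => cint (fun z => g (p, z))).
Proof.
move=> mg.
apply: (@measurable_fun_integral _ _ T mR leb
  (fun q => \int[leb]_y g (q.1, complex.Complex q.2 y))).
apply: (@measurable_fun_integral _ _ (T * mR)%type mR leb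
  (fun q => g (q.1.1, pairc (q.1.2, q.2)))).
apply: (measurableT_comp mg); apply: measurable_fun_pair => /=.
  exact: (measurableT_comp measurable_fst measurable_fst).
apply: (measurableT_comp measurable_pairc).
apply: measurable_fun_pair; last exact: measurable_snd.
exact: (measurableT_comp measurable_snd measurable_fst).
Qed.

Lemma measurable_vint n d (T : measurableType d) (g : T * Cn n -> \bar Rr) :
  measurable_fun setT g -> measurable_fun setT (fun p => vint (fun t => g (p, t))).
Proof.
elim: n d T g => [|n IH] d T g mg /=.
  by apply: (measurableT_comp mg); exact: pair2_measurable.
apply: (@measurable_cint _ T (fun q => vint (fun t => g (q.1, cons_tuple q.2 t)))).
apply: (IH _ (T * C)%type (fun q => g (q.1.1, cons_tuple q.1.2 q.2))).
apply: (measurableT_comp mg); apply: measurable_fun_pair => /=.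
  exact: (measurableT_comp measurable_fst measurable_fst).
apply: (measurableT_comp (@measurable_consc n)
  (g := fun q : T * C * Cn n => (q.1.2, q.2))).
apply: measurable_fun_pair; last exact: measurable_snd.
exact: (measurableT_comp measurable_snd measurable_fst).
Qed.

Lemma measurable_slice n (g : Cn n.+1 -> \bar Rr) z : measurable_fun setT g ->
  measurable_fun setT (fun t : Cn n => g (cons_tuple z t)).
Proof.
move=> mg; apply: (measurableT_comp mg).
exact: (measurableT_comp (@measurable_consc n) (pair1_measurable _)).
Qed.

Lemma ae_eq_integrable d (T : measurableType d) (m : {measure set T -> \bar Rr})
    (f g : T -> \bar Rr) : measurable_fun setT f -> m.-integrable setT g ->
  ae_eq m setT f g -> m.-integrable setT f.
Proof.
move=> mf /integrableP[mg ig] fg; apply/integrableP; split => //.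
rewrite (_ : \int[m]_x `|f x| = \int[m]_x `|g x|) //.
apply: ae_eq_integral => //; try exact: measurableT_comp.
by apply: filterS fg => x fgx /= _; rewrite fgx.
Qed.

(** By induction. Almost every slice is integrable, so there the inner [vint] is the true integral;
    on the remaining null set it takes uncontrolled but measurable values, which the outer integral
    ignores. *)
Lemma vintE n (g : Cn n -> \bar Rr) : (muN n).-integrable setT g ->
  vint g = \int[muN n]_z g z.
Proof.
elim: n g => [|n IH] g ig /=.
  have mg : measurable_fun setT g by case/integrableP : ig.
  by rewrite integral_dirac // diracT mul1e.
rewrite integral_muS //.
have mg : measurable_fun setT g by case/integrableP : ig.
have mv : measurable_fun setT (fun z => vint (fun t => g (cons_tuple z t))).
  apply: (measurable_vint (g := fun q : C * Cn n => g (consc q))).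
  exact: measurableT_comp mg (@measurable_consc n).
have ae : ae_eq muC setT (fun z => vint (fun t => g (cons_tuple z t)))
    (fun z => \int[muN n]_t g (cons_tuple z t)).
  by apply: filterS (ae_integrable_muS ig) => z iz _; rewrite IH.
have iF := integrable_muS_F ig.
rewrite cintE; last exact: ae_eq_integrable ae.
by apply: ae_eq_integral => //; case/integrableP : iF.
Qed.

End vintE_signed.

(** * The real-valued modulus and arithmetic of complex numbers *)

Notation Re := (@complex.Re Rr).
Notation Im := (@complex.Im Rr).
Notation nc := (@Normc.normc Rr).
Notation cj := (@conjc Rr).
Notation rc := (real_complex Rr).

Section modulus.
Implicit Types z w : C.

Lemma normE z : `|z| = rc (nc z). Proof. by case: z. Qed.

Lemma nc_ge0 z : 0 <= nc z. Proof. by case: z => a b; exact: sqrtr_ge0. Qed.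

Lemma ncM z w : nc (z * w) = nc z * nc w. Proof. exact: Normc.normcM. Qed.

Lemma nc0 : nc 0 = 0. Proof. exact: Normc.normc0. Qed.
Lemma nc1 : nc 1 = 1. Proof. exact: Normc.normc1. Qed.
Lemma ncN z : nc (- z) = nc z. Proof. exact: normcN. Qed.
Lemma ncV z : nc z^-1 = (nc z)^-1. Proof. exact: Normc.normcV. Qed.

Lemma nc_triangle z w : nc (z + w) <= nc z + nc w. Proof. exact: le_normcD. Qed.

Lemma ncB z w : nc (z - w) = nc (w - z). Proof. by rewrite -opprB ncN. Qed.

Lemma nc_triangleB z w : nc (z - w) <= nc z + nc w.
Proof. by rewrite -(ncN w); exact: nc_triangle. Qed.

Lemma nc_ge_sub z w : nc z - nc w <= nc (z + w).
Proof. by have := nc_triangleB (z + w) w; rewrite addrK; lra. Qed.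

Lemma nc_eq0 z : (nc z == 0) = (z == 0).
Proof. by apply/eqP/eqP => [/Normc.eq0_normc//|->]; rewrite nc0. Qed.

Lemma nc_gt0 z : (0 < nc z) = (z != 0).
Proof. by rewrite lt_def nc_eq0 nc_ge0 andbT. Qed.

Lemma ncX z n : nc (z ^+ n) = nc z ^+ n.
Proof. by elim: n => [|n IH]; rewrite ?expr0 ?nc1 // !exprS ncM IH. Qed.

Lemma nc_prod I (r : seq I) (P : pred I) (F : I -> C) :
  nc (\prod_(i <- r | P i) F i) = \prod_(i <- r | P i) nc (F i).
Proof. exact: (big_morph nc ncM nc1). Qed.

Lemma nc_sum I (r : seq I) (P : pred I) (F : I -> C) :
  nc (\sum_(i <- r | P i) F i) <= \sum_(i <- r | P i) nc (F i).
Proof.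
elim/big_ind2: _ => [|a b c d ab cd|i _]; rewrite ?nc0 //.
by apply: le_trans (nc_triangle _ _) _; exact: lerD.
Qed.

Lemma nc_cj z : nc (cj z) = nc z. Proof. by case: z => a b /=; rewrite sqrrN. Qed.

Lemma nc_rc (x : Rr) : nc (rc x) = `|x|.
Proof. by rewrite /= expr0n /= addr0 sqrtr_sqr. Qed.

Lemma sqnormE z : sqnorm z = nc z ^+ 2.
Proof. by case: z => a b; rewrite /sqnorm /= sqr_sqrtr // addr_ge0 // sqr_ge0. Qed.

Lemma sqnorm_ge0 z : 0 <= sqnorm z. Proof. by rewrite sqnormE sqr_ge0. Qed.

Lemma mul_cj z : z * cj z = rc (sqnorm z).
Proof. by case: z => a b; rewrite /sqnorm; congr complex.Complex => /=; ring. Qed.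

Lemma sqnormM z w : sqnorm (z * w) = sqnorm z * sqnorm w.
Proof. by rewrite !sqnormE ncM exprMn. Qed.

Lemma Re_le_nc z : `|Re z| <= nc z.
Proof.
case: z => a b /=; rewrite -sqrtr_sqr ler_sqrt ?lerDl ?sqr_ge0 //.
by rewrite addr_ge0 // sqr_ge0.
Qed.

Lemma Im_le_nc z : `|Im z| <= nc z.
Proof.
case: z => a b /=; rewrite -sqrtr_sqr ler_sqrt ?lerDr ?sqr_ge0 //.
by rewrite addr_ge0 // sqr_ge0.
Qed.

Lemma nc_le_ReIm z : nc z <= `|Re z| + `|Im z|.
Proof.
case: z => a b /=; have h : 0 <= `|a| + `|b| by rewrite addr_ge0.
rewrite -[leRHS]ger0_norm // -sqrtr_sqr ler_sqrt ?sqr_ge0 //.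
rewrite sqrrD !real_normK ?num_real // -subr_ge0.
rewrite (_ : _ - _ = `|a| * `|b| *+ 2); last by ring.
by rewrite mulrn_wge0 // mulr_ge0.
Qed.

Lemma ReD z w : Re (z + w) = Re z + Re w. Proof. by case: z; case: w. Qed.
Lemma ImD z w : Im (z + w) = Im z + Im w. Proof. by case: z; case: w. Qed.
Lemma ReN z : Re (- z) = - Re z. Proof. by case: z. Qed.
Lemma ImN z : Im (- z) = - Im z. Proof. by case: z. Qed.
Lemma ReB z w : Re (z - w) = Re z - Re w. Proof. by case: z; case: w. Qed.
Lemma ImB z w : Im (z - w) = Im z - Im w. Proof. by case: z; case: w. Qed.
Lemma ReM z w : Re (z * w) = Re z * Re w - Im z * Im w.
Proof. by case: z; case: w. Qed.
Lemma ImM z w : Im (z * w) = Re z * Im w + Im z * Re w.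
Proof. by case: z; case: w. Qed.
Lemma complexP z w : Re z = Re w -> Im z = Im w -> z = w.
Proof. by case: z; case: w => ? ? ? ? /= -> ->. Qed.

Lemma cjM z w : cj (z * w) = cj z * cj w. Proof. exact: rmorphM. Qed.
Lemma cjD z w : cj (z + w) = cj z + cj w. Proof. exact: rmorphD. Qed.
Lemma cjB z w : cj (z - w) = cj z - cj w. Proof. exact: rmorphB. Qed.
Lemma cjV z : cj (z^-1) = (cj z)^-1. Proof. exact: fmorphV. Qed.
Lemma cjX z n : cj (z ^+ n) = (cj z) ^+ n. Proof. exact: rmorphXn. Qed.

End modulus.

(** * Measurability of complex-valued functions *)

Section measurable_complex.
Context d (T : measurableType d).
Implicit Types f g : T -> C.

Lemma mRe f : measurable_fun setT f -> measurable_fun setT (fun x => Re (f x) : mR).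
Proof. exact: measurableT_comp measurable_Re. Qed.

Lemma mIm f : measurable_fun setT f -> measurable_fun setT (fun x => Im (f x) : mR).
Proof. exact: measurableT_comp measurable_Im. Qed.

Lemma measurableC_add f g : measurable_fun setT f -> measurable_fun setT g ->
  measurable_fun setT (fun x => f x + g x).
Proof.
move=> mf mg; apply: measurable_fun_complex.
- by under eq_fun do rewrite ReD; exact: (measurable_funD (mRe mf) (mRe mg)).
- by under eq_fun do rewrite ImD; exact: (measurable_funD (mIm mf) (mIm mg)).
Qed.

Lemma measurableC_opp f : measurable_fun setT f -> measurable_fun setT (fun x => - f x).
Proof.
move=> mf; apply: measurable_fun_complex.
- by under eq_fun do rewrite ReN; exact: (measurable_funN (mRe mf)).
- by under eq_fun do rewrite ImN; exact: (measurable_funN (mIm mf)).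
Qed.

Lemma measurableC_mul f g : measurable_fun setT f -> measurable_fun setT g ->
  measurable_fun setT (fun x => f x * g x).
Proof.
move=> mf mg; apply: measurable_fun_complex.
- under eq_fun do rewrite ReM.
  exact: (measurable_funB (measurable_funM (mRe mf) (mRe mg))
    (measurable_funM (mIm mf) (mIm mg))).
- under eq_fun do rewrite ImM.
  exact: (measurable_funD (measurable_funM (mRe mf) (mIm mg))
    (measurable_funM (mIm mf) (mRe mg))).
Qed.

Lemma measurableC_cj f : measurable_fun setT f -> measurable_fun setT (fun x => cj (f x)).
Proof.
move=> mf; apply: measurable_fun_complex.
- rewrite (_ : (fun x => _) = (fun x => Re (f x))); first exact: mRe.
  by apply/funext => x; case: (f x).
- rewrite (_ : (fun x => _) = (fun x => - Im (f x))).
    exact: (measurable_funN (mIm mf)).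
  by apply/funext => x; case: (f x).
Qed.

Lemma measurableC_rc (f : T -> mR) : measurable_fun setT f -> measurable_fun setT (rc \o f).
Proof. by move=> mf; apply: measurable_fun_complex => //=. Qed.

Lemma measurable_sqnorm f : measurable_fun setT f ->
  measurable_fun setT (fun x => sqnorm (f x) : mR).
Proof.
move=> mf; exact: (measurable_funD (measurable_funX 2 (mRe mf)) (measurable_funX 2 (mIm mf))).
Qed.

Lemma measurable_nc f : measurable_fun setT f ->
  measurable_fun setT (fun x => nc (f x) : mR).
Proof.
move=> mf; have -> : (fun x => nc (f x) : mR) = (fun x => Num.sqrt (sqnorm (f x))).
  by apply/funext => x; rewrite /sqnorm; case: (f x).
apply: (@measurableT_comp _ _ _ _ _ _ (@Num.sqrt Rr : mR -> mR)).
  exact: (continuous_measurable_fun (@sqrt_continuous Rr)).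
exact: measurable_sqnorm.
Qed.

Lemma measurableC_prod I (r : seq I) (F : I -> T -> C) :
  (forall i, measurable_fun setT (F i)) ->
  measurable_fun setT (fun x => \prod_(i <- r) F i x).
Proof.
move=> mF; elim: r => [|i r IH].
  by under eq_fun do rewrite big_nil; exact: measurable_cst.
by under eq_fun do rewrite big_cons; exact: measurableC_mul.
Qed.

Lemma measurableC_sum I (r : seq I) (P : pred I) (F : I -> T -> C) :
  (forall i, measurable_fun setT (F i)) ->
  measurable_fun setT (fun x => \sum_(i <- r | P i) F i x).
Proof.
move=> mF; elim: r => [|i r IH].
  by under eq_fun do rewrite big_nil; exact: measurable_cst.
under eq_fun do rewrite big_cons; case: (P i) => //; exact: measurableC_add.
Qed.

Lemma measurableC_if (A : set T) f : measurable A -> measurable_fun setT f ->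
  measurable_fun setT (fun x => if `[< A x >] then f x else 0).
Proof.
move=> mA mf; apply: measurable_fun_ifT => //.
apply: (measurable_fun_bool true); rewrite setTI.
rewrite (_ : _ @^-1` _ = A) //.
by apply/seteqP; split => x; rewrite /preimage /= => /asboolP.
Qed.

End measurable_complex.

(** * Complex-valued integrals and dominated convergence *)

Section complex_integral.
Context d (T : measurableType d) (m : {measure set T -> \bar Rr}).
Implicit Types (f : T -> C) (g : T -> Rr).

Definition cintegrable f :=
  m.-integrable setT (EFin \o (fun x => Re (f x))) /\
  m.-integrable setT (EFin \o (fun x => Im (f x))).

Definition CI f : C :=
  complex.Complex (\int[m]_x Re (f x))%R (\int[m]_x Im (f x))%R.

Lemma cintegrable_measurable f : cintegrable f -> measurable_fun setT f.
Proof.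
move=> [/integrableP[mr _] /integrableP[mi _]].
by apply: measurable_fun_complex; exact/measurable_EFinP.
Qed.

Lemma cintegrable_le f g : measurable_fun setT f ->
  m.-integrable setT (EFin \o g) -> (forall x, nc (f x) <= g x) -> cintegrable f.
Proof.
move=> mf ig fg; split; apply: le_integrable ig => //.
- by apply/measurable_EFinP; exact: mRe.
- move=> x _ /=; rewrite lee_fin (le_trans (Re_le_nc _)) // (le_trans (fg x)) //.
  exact: ler_norm.
- by apply/measurable_EFinP; exact: mIm.
- move=> x _ /=; rewrite lee_fin (le_trans (Im_le_nc _)) // (le_trans (fg x)) //.
  exact: ler_norm.
Qed.

Lemma cintegrable_nc f : cintegrable f -> m.-integrable setT (EFin \o (fun x => nc (f x))).
Proof.
move=> icf; have [ir ii] := icf; have mf := cintegrable_measurable icf.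
apply: (le_integrable measurableT _ _ (integrableD measurableT
  (integrable_abse ir) (integrable_abse ii))).
- by apply/measurable_EFinP; exact: measurable_nc.
- move=> x _ /=; rewrite lee_fin ger0_norm ?nc_ge0 // (le_trans (nc_le_ReIm _)) //.
  exact: ler_norm.
Qed.

Lemma eq_cintegrable f1 f2 : f1 =1 f2 -> cintegrable f1 -> cintegrable f2.
Proof. by move=> /funext ->. Qed.

Lemma eq_CI f1 f2 : f1 =1 f2 -> CI f1 = CI f2.
Proof. by move=> /funext ->. Qed.

Lemma cintegrableD f1 f2 : cintegrable f1 -> cintegrable f2 ->
  cintegrable (fun x => f1 x + f2 x).
Proof.
move=> [r1 i1] [r2 i2]; split.
- by apply: eq_integrable (integrableD measurableT r1 r2) => // x _ /=; rewrite ReD.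
- by apply: eq_integrable (integrableD measurableT i1 i2) => // x _ /=; rewrite ImD.
Qed.

Lemma CID f1 f2 : cintegrable f1 -> cintegrable f2 ->
  CI (fun x => f1 x + f2 x) = CI f1 + CI f2.
Proof.
move=> [r1 i1] [r2 i2]; apply: complexP; rewrite ?ReD ?ImD /=.
- by rewrite -RintegralD //; apply: eq_Rintegral => x _; rewrite ReD.
- by rewrite -RintegralD //; apply: eq_Rintegral => x _; rewrite ImD.
Qed.

Lemma cintegrableZ f (a : C) : cintegrable f -> cintegrable (fun x => a * f x).
Proof.
move=> icf.
have := integrableZl measurableT (nc a) (cintegrable_nc icf).
move=> /(@cintegrable_le (fun x => a * f x) (fun x => nc a * nc (f x))); apply.
- apply: measurableC_mul; first exact: measurable_cst.
  exact: cintegrable_measurable.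
- by move=> x; rewrite ncM.
Qed.

Lemma CIZ f (a : C) : cintegrable f -> CI (fun x => a * f x) = a * CI f.
Proof.
have intZ (b : Rr) (h : T -> Rr) : m.-integrable setT (EFin \o h) ->
  m.-integrable setT (EFin \o (fun x => b * h x)).
  by move=> ih; apply: eq_integrable (integrableZl measurableT b ih).
move=> [r i]; apply: complexP; rewrite ?ReM ?ImM /=.
- under eq_Rintegral do rewrite ReM.
  by rewrite RintegralB // ?RintegralZl //; exact: intZ.
- under eq_Rintegral do rewrite ImM.
  by rewrite RintegralD // ?RintegralZl //; exact: intZ.
Qed.

Lemma cintegrable0 : cintegrable (fun=> 0).
Proof. by split; exact: integrable0. Qed.

Lemma CI0 : CI (fun=> 0) = 0.
Proof. by apply: complexP => /=; rewrite Rintegral_cst // mul0r. Qed.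

Lemma cintegrableN f : cintegrable f -> cintegrable (fun x => - f x).
Proof. by move=> /(cintegrableZ (-1)); apply: eq_cintegrable => x; rewrite mulN1r. Qed.

Lemma CIN f : cintegrable f -> CI (fun x => - f x) = - CI f.
Proof.
by move=> icf; rewrite -mulN1r -CIZ //; apply: eq_CI => x; rewrite mulN1r.
Qed.

Lemma cintegrableB f1 f2 : cintegrable f1 -> cintegrable f2 ->
  cintegrable (fun x => f1 x - f2 x).
Proof. by move=> i1 i2; apply: cintegrableD => //; exact: cintegrableN. Qed.

Lemma CIB f1 f2 : cintegrable f1 -> cintegrable f2 ->
  CI (fun x => f1 x - f2 x) = CI f1 - CI f2.
Proof. by move=> i1 i2; rewrite CID ?CIN //; exact: cintegrableN. Qed.

Lemma cintegrable_sum I (r : seq I) (F : I -> T -> C) :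
  (forall i, cintegrable (F i)) -> cintegrable (fun x => \sum_(i <- r) F i x).
Proof.
move=> iF; elim: r => [|i r IH].
  by apply: eq_cintegrable cintegrable0 => x; rewrite big_nil.
by apply: eq_cintegrable (cintegrableD (iF i) IH) => x; rewrite big_cons.
Qed.

Lemma CI_sum I (r : seq I) (F : I -> T -> C) :
  (forall i, cintegrable (F i)) ->
  CI (fun x => \sum_(i <- r) F i x) = \sum_(i <- r) CI (F i).
Proof.
move=> iF; elim: r => [|i r IH].
  by rewrite big_nil (_ : (fun x => _) = fun=> 0) ?CI0 //; apply/funext => x; rewrite big_nil.
rewrite big_cons -IH -CID //; last exact: cintegrable_sum.
by apply: eq_CI => x; rewrite big_cons.
Qed.

Lemma CI_cj f : cintegrable f -> CI (fun x => cj (f x)) = cj (CI f).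
Proof.
move=> [r i]; apply: complexP => /=.
- by apply: eq_Rintegral => x _; case: (f x).
- rewrite -mulN1r -RintegralZl //; apply: eq_Rintegral => x _; rewrite mulN1r.
  by case: (f x).
Qed.

(** The factor 2 comes from bounding the real and imaginary parts separately; the estimates built on
    it absorb it into their constants. *)
Lemma CI_le f g : cintegrable f -> m.-integrable setT (EFin \o g) ->
  (forall x, nc (f x) <= g x) -> nc (CI f) <= 2 * \int[m]_x g x.
Proof.
move=> icf ig fg; apply: le_trans (nc_le_ReIm _) _ => /=.
rewrite mulr_natl mulr2n; have [r i] := icf; apply: lerD.
- apply: le_trans (le_normr_Rintegral measurableT r) _.
  apply: le_Rintegral => //; first exact: integrable_norm.
  by move=> x _; rewrite (le_trans (Re_le_nc _)).
- apply: le_trans (le_normr_Rintegral measurableT i) _.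
  apply: le_Rintegral => //; first exact: integrable_norm.
  by move=> x _; rewrite (le_trans (Im_le_nc _)).
Qed.

Lemma ae_eq_cintegrable f1 f2 : measurable_fun setT f1 -> cintegrable f2 ->
  ae_eq m setT f1 f2 -> cintegrable f1.
Proof.
move=> m1 [r2 i2] ae; split.
- apply: ae_eq_integrable r2 _; first by apply/measurable_EFinP; exact: mRe.
  by apply: filterS ae => x /= xE _; rewrite xE.
- apply: ae_eq_integrable i2 _; first by apply/measurable_EFinP; exact: mIm.
  by apply: filterS ae => x /= xE _; rewrite xE.
Qed.

Lemma ae_eq_CI f1 f2 : measurable_fun setT f1 -> measurable_fun setT f2 ->
  ae_eq m setT f1 f2 -> CI f1 = CI f2.
Proof.
move=> m1 m2 ae; apply: complexP => /=; congr fine; apply: ae_eq_integral => //.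
- by apply/measurable_EFinP; exact: mRe.
- by apply/measurable_EFinP; exact: mRe.
- by apply: filterS ae => x /= xE _; rewrite xE.
- by apply/measurable_EFinP; exact: mIm.
- by apply/measurable_EFinP; exact: mIm.
- by apply: filterS ae => x /= xE _; rewrite xE.
Qed.

Definition ccvg (u : nat -> C) (l : C) :=
  forall e : Rr, 0 < e -> exists N, forall n, (N <= n)%N -> nc (u n - l) <= e.

Lemma ccvg_unique u l l' : ccvg u l -> ccvg u l' -> l = l'.
Proof.
move=> ul ul'; apply/eqP; rewrite -subr_eq0 -nc_eq0 eq_le nc_ge0 andbT.
apply/ler_addgt0Pl => e e0; rewrite addr0.
have e2 : 0 < e / 2 by rewrite divr_gt0.
have [N HN] := ul _ e2; have [N' HN'] := ul' _ e2.
have := HN _ (leq_maxl N N'); have := HN' _ (leq_maxr N N').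
set k := maxn N N' => h1 h2.
have := nc_triangle (l - u k) (u k - l'); rewrite subrKA.
by rewrite (ncB l); lra.
Qed.

Lemma ccvg_cst l : ccvg (fun=> l) l.
Proof. by move=> e e0; exists 0%N => n _; rewrite subrr nc0 ltW. Qed.

Lemma ccvg_Re u l : ccvg u l -> (Re (u n))%:E @[n --> \oo] --> (Re l)%:E.
Proof.
move=> ul; apply: cvg_EFin; first by near=> n.
apply/cvgrPdist_le => /= e e0; have [N HN] := ul _ e0.
near=> n; rewrite -ReB (le_trans (Re_le_nc _)) // ncB; apply: HN.
by near: n; exists N.
Unshelve. all: by end_near. Qed.

Lemma ccvg_Im u l : ccvg u l -> (Im (u n))%:E @[n --> \oo] --> (Im l)%:E.
Proof.
move=> ul; apply: cvg_EFin; first by near=> n.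
apply/cvgrPdist_le => /= e e0; have [N HN] := ul _ e0.
near=> n; rewrite -ImB (le_trans (Im_le_nc _)) // ncB; apply: HN.
by near: n; exists N.
Unshelve. all: by end_near. Qed.

Lemma CI_dominated (F : nat -> T -> C) f g :
  (forall n, measurable_fun setT (F n)) -> measurable_fun setT f ->
  m.-integrable setT (EFin \o g) ->
  (forall n x, nc (F n x) <= g x) ->
  {ae m, forall x, ccvg (F^~ x) (f x)} ->
  cintegrable f /\ ccvg (fun n => CI (F n)) (CI f).
Proof.
move=> mF mf ig Fg Ff.
(* One statement about a real functional p dominated by the modulus, used at the end for [Re] and
   for [Im]. *)
have dom (p : C -> Rr) :
    (forall z, `|p z| <= nc z) -> measurable_fun setT (p : C -> mR) ->
    (forall u l, ccvg u l -> (p (u n))%:E @[n --> \oo] --> (p l)%:E) ->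
    m.-integrable setT (EFin \o (p \o f)) /\
    forall e, 0 < e -> exists N, forall n, (N <= n)%N ->
      `|\int[m]_x p (F n x) - \int[m]_x p (f x)|%R <= e.
  move=> pn mp pc.
  have mpF n : measurable_fun setT (EFin \o (p \o F n)).
    by apply/measurable_EFinP; exact: measurableT_comp mp (mF n).
  have mpf : measurable_fun setT (EFin \o (p \o f)).
    by apply/measurable_EFinP; exact: measurableT_comp mp mf.
  have [||i _ c] := dominated_convergence measurableT mpF mpf _ ig.
  - by apply: filterS Ff => x h _; exact: pc.
  - by apply/aeW => x n _ /=; rewrite lee_fin (le_trans (pn _)).
  have iF n : m.-integrable setT (EFin \o (p \o F n)).
    apply: le_integrable ig => // x _ /=; rewrite lee_fin (le_trans (pn _)) //.
    by rewrite (le_trans (Fg n x)) // ler_norm.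
  split => // e e0.
  have : (\int[m]_x (p (F n x))%:E)%E @[n --> \oo] --> ((\int[m]_x p (f x))%R)%:E.
    by rewrite /Rintegral fineK; [exact: c | exact: integrable_fin_num].
  move=> /fine_cvgP[_ /cvgrPdist_le /(_ _ e0)[N _ HN]]; exists N => n Nn.
  by rewrite distrC; exact: HN.
have [ir cr] := dom _ Re_le_nc measurable_Re ccvg_Re.
have [ii ci] := dom _ Im_le_nc measurable_Im ccvg_Im.
split => // e e0; have e2 : 0 < e / 2 by rewrite divr_gt0.
have [N HN] := cr _ e2; have [N' HN'] := ci _ e2.
exists (maxn N N') => n; rewrite geq_max => /andP[Nn N'n].
apply: le_trans (nc_le_ReIm _) _; rewrite ReB ImB /= (splitr e).
by apply: lerD; [exact: HN|exact: HN'].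
Unshelve. all: by end_near. Qed.

End complex_integral.

Section CI_product.
Variables (n : nat) (m : {sigma_finite_measure set (Cn n) -> \bar Rr}).

Lemma Rintegral_muS (g : Cn n.+1 -> Rr) :
  (muS m).-integrable setT (EFin \o g) ->
  [/\ muC.-integrable setT (EFin \o (fun z => \int[m]_t g (cons_tuple z t))%R),
      (\int[muS m]_t g t = \int[muC]_z \int[m]_t g (cons_tuple z t))%R &
      {ae muC, forall z, m.-integrable setT (EFin \o (fun t => g (cons_tuple z t)))}].
Proof.
move=> ig; have iF := integrable_muS_F ig.
have aeF := ae_integrable_muS ig.
have ae : ae_eq muC setT (EFin \o (fun z => \int[m]_t g (cons_tuple z t))%R)
   (fun z => \int[m]_t (EFin \o g) (cons_tuple z t))%E.
  apply: filterS aeF => z iz _ /=.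
  by rewrite /Rintegral fineK //; exact: integrable_fin_num.
have mF : measurable_fun setT (EFin \o (fun z => \int[m]_t g (cons_tuple z t))%R).
  apply/measurable_EFinP; apply: measurableT_comp => //.
  by case/integrableP : iF.
split => //.
- exact: ae_eq_integrable ae.
- rewrite /Rintegral integral_muS //; congr fine; apply/esym.
  apply: ae_eq_integral => //.
  by case/integrableP : iF.
Qed.

Lemma CI_muS (f : Cn n.+1 -> C) : cintegrable (muS m) f ->
  [/\ cintegrable muC (fun z => CI m (fun t => f (cons_tuple z t))),
      CI (muS m) f = CI muC (fun z => CI m (fun t => f (cons_tuple z t))) &
      {ae muC, forall z, cintegrable m (fun t => f (cons_tuple z t))}].
Proof.
move=> [/Rintegral_muS[r1 r2 r3] /Rintegral_muS[i1 i2 i3]]; split => //.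
- by apply: complexP.
- by apply: filterS2 r3 i3 => z rz iz; split.
Qed.

End CI_product.

(** Both orders of integration are recorded, because each partial derivative will be integrated
    first along its own variable. *)
Lemma Rintegral_muC (g : C -> Rr) : muC.-integrable setT (EFin \o g) ->
  [/\ (\int[muC]_z g z = \int[leb]_x \int[leb]_y g (complex.Complex x y))%R,
      (\int[muC]_z g z = \int[leb]_y \int[leb]_x g (complex.Complex x y))%R &
      (leb \x leb)%E.-integrable setT (EFin \o (g \o pairc))].
Proof.
move=> ig; have ip : (leb \x leb)%E.-integrable setT (EFin \o (g \o pairc)).
  by move/integrable_muC : ig.
split => //.
- rewrite /Rintegral integral_muC //; congr fine.
  rewrite -integral12_prod_meas1 //.
  have iF := integrable_fubini_F ip.
  have ae := ae_integrable1 ip.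
  apply: ae_eq_integral => //.
  + by case/integrableP : iF.
  + apply/measurable_EFinP; apply: measurableT_comp => //.
    by case/integrableP : iF.
  + apply: filterS ae => x ix _ /=.
    by rewrite /Rintegral fineK //; exact: integrable_fin_num.
- rewrite /Rintegral integral_muC //; congr fine.
  rewrite -integral21_prod_meas1 //.
  have mG := measurable_fubini_G ip.
  have ae := ae_integrable2 ip.
  apply: ae_eq_integral => //.
  + apply/measurable_EFinP; by apply: (measurableT_comp _ mG).
  + apply: filterS ae => x ix _ /=.
    by rewrite /Rintegral fineK //; exact: integrable_fin_num.
Qed.

(** * Measurability from a countable base; continuous functions *)

Section countable_basis.
Context d (T : measurableType d) (I : countType) (B : I -> set T).
Hypothesis mB : forall i, measurable (B i).

Lemma bigcup_count_measurable (P : set I) : measurable (\bigcup_(i in P) B i).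
Proof.
rewrite (_ : \bigcup_(i in P) _ = \bigcup_k
  (if unpickle k is Some i then if `[< P i >] then B i else set0 else set0)).
  apply: bigcupT_measurable => k; case: (unpickle k) => // i.
  by case: ifP.
apply/seteqP; split => [x [i Pi Bx]|x [k _]].
- by exists (pickle i) => //; rewrite pickleK; case: asboolP.
- by case: (unpickle k) => // i; case: asboolP => // Pi Bx; exists i.
Qed.

Lemma bigcap_count_measurable (P : set I) : measurable (\bigcap_(i in P) ~` B i).
Proof. by rewrite -setC_bigcup; apply: measurableC; exact: bigcup_count_measurable. Qed.

(** The part of D where F exceeds a is D cut with the union of those basic sets on which F stays
    above a, a countable union. *)
Lemma measurable_fun_basis (D : set T) (F : T -> mR) : measurable D ->
  (forall x e, D x -> 0 < e -> exists2 i, B i x &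
     forall y, D y -> B i y -> `|F y - F x| < e) ->
  measurable_fun D F.
Proof.
move=> mD HF; apply: (measurability _ (RGenOInfty.measurableE Rr)) => //.
move=> _ [_ [a ->] <-] /=.
rewrite (_ : _ `&` _ = D `&` \bigcup_(i in [set i | forall y, D y -> B i y -> a < F y]) B i).
  by apply: measurableI => //; exact: bigcup_count_measurable.
apply/seteqP; split => x /= [Dx].
- rewrite in_itv /= andbT => aF; split => //.
  have e0 : 0 < F x - a by rewrite subr_gt0.
  have [i Bx H] := HF x _ Dx e0; exists i => //= y Dy By.
  by have := H y Dy By; rewrite ltr_distl => /andP[+ _]; lra.
- by move=> [i /= H Bx]; split => //; rewrite in_itv /= andbT; exact: H.
Qed.

End countable_basis.

Definition ccont (F : C -> C) z := forall e : Rr, 0 < e -> exists2 de : Rr, 0 < de &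
  forall w, nc (w - z) < de -> nc (F w - F z) <= e.

(* rational squares form a countable base of the topology of C *)
Definition cbox (q : rat * rat * nat) : set C := [set z |
  (`|Re z - ratr q.1.1| < q.2.+1%:R^-1) && (`|Im z - ratr q.1.2| < q.2.+1%:R^-1)].

Lemma measurable_cbox q : measurable (cbox q).
Proof.
have mball (p : C -> mR) (a r : Rr) : measurable_fun setT p -> measurable [set z | `|p z - a| < r].
  move=> mp; rewrite (_ : [set z | _] = p @^-1` `]a - r, a + r[%classic).
    by rewrite -[X in measurable X]setTI; apply: mp => //; exact: measurable_itv.
  by apply/seteqP; split => z /=; rewrite in_itv /= ltr_distl.
rewrite (_ : cbox q = [set z | `|Re z - ratr q.1.1| < q.2.+1%:R^-1] `&`
   [set z | `|Im z - ratr q.1.2| < q.2.+1%:R^-1]).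
  by apply: measurableI; apply: mball; [exact: measurable_Re|exact: measurable_Im].
by apply/seteqP; split => z /= /andP.
Qed.

Lemma rat_near (a e : Rr) : 0 < e -> exists q : rat, `|a - ratr q| < e.
Proof.
move=> e0; have /rat_in_itvoo[q] : a - e < a + e by lra.
by rewrite in_itv /= => /andP[q1 q2]; exists q; rewrite ltr_distl; lra.
Qed.

Lemma inv_nat_small (e : Rr) : 0 < e -> exists k : nat, k.+1%:R^-1 < e.
Proof.
move=> e0; have [k _ Hk] := near_infty_natSinv_lt (PosNum e0).
by exists k; exact: (Hk k (leqnn k)).
Qed.

Lemma cbox_near z (e : Rr) : 0 < e -> exists2 q, cbox q z & forall w, cbox q w -> nc (w - z) < e.
Proof.
move=> e0; have e4 : 0 < e / 4 by rewrite divr_gt0.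
have [k Hk] := inv_nat_small e4; have k0 : 0 < k.+1%:R^-1 :> Rr by rewrite invr_gt0.
have [q Hq] := rat_near (Re z) k0; have [q' Hq'] := rat_near (Im z) k0.
exists (q, q', k); first by rewrite /cbox /= Hq Hq'.
move=> w /andP[]; rewrite [X in X -> _]/= => h1; rewrite [X in X -> _]/= => h2; apply: le_lt_trans (nc_le_ReIm _) _; rewrite ReB ImB.
have t1 : `|Re w - Re z| <= `|Re w - ratr q| + `|Re z - ratr q|.
  by rewrite (distrC (Re z)); exact: ler_distD.
have t2 : `|Im w - Im z| <= `|Im w - ratr q'| + `|Im z - ratr q'|.
  by rewrite (distrC (Im z)); exact: ler_distD.
by move: t1 t2 h1 h2 Hq Hq' Hk; move: (_%:R^-1 : Rr) => a; lra.
Qed.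

Lemma measurable_ccont F : (forall z, ccont F z) -> measurable_fun setT F.
Proof.
move=> cF; apply: measurable_fun_complex.
- apply: (measurable_fun_basis measurable_cbox) => // z e _ e0.
  have e2 : 0 < e / 2 by lra.
  have [de de0 H] := cF z _ e2.
  have [q qz qw] := cbox_near z de0; exists q => // w _ /qw/H h.
  by rewrite -ReB (le_lt_trans (Re_le_nc _)) //; lra.
- apply: (measurable_fun_basis measurable_cbox) => // z e _ e0.
  have e2 : 0 < e / 2 by lra.
  have [de de0 H] := cF z _ e2.
  have [q qz qw] := cbox_near z de0; exists q => // w _ /qw/H h.
  by rewrite -ImB (le_lt_trans (Im_le_nc _)) //; lra.
Qed.

Lemma nc_dist z w : `|nc z - nc w| <= nc (z - w).
Proof.
have t1 := nc_triangle (z - w) w; have t2 := nc_triangle (w - z) z.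
by rewrite subrK in t1; rewrite subrK ncB in t2; rewrite ler_norml; lra.
Qed.

(** The disc lies in the square [-M, M]^2, which is compact in the real plane. *)
Lemma ccont_bounded F (M : Rr) : (forall z, ccont F z) ->
  exists K : Rr, forall z, nc z <= M -> nc (F z) <= K.
Proof.
move=> cF.
pose G (p : Rr * Rr) : Rr := nc (F (pairc p)).
have cG : continuous G.
  move=> p; apply/(@cvgrPdist_le _ Rr^o) => e e0.
  have [de de0 H] := cF (pairc p) _ e0.
  have nb (a : Rr) : nbhs a [set x : Rr | `|a - x| < de / 2].
    by apply/(@nbhs_ballP _ Rr^o); exists (de / 2); [rewrite /= divr_gt0|].
  near=> q.
  have h : nc (F (pairc q) - F (pairc p)) <= e.
    apply: H; apply: le_lt_trans (nc_le_ReIm _) _; rewrite ReB ImB /=.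
    have h1 : `|p.1 - q.1| < de / 2 by near: q; (exists ([set x | `|p.1 - x| < de / 2], setT)); [split=> //=; exact: filterT|by move=> x []].
    have h2 : `|p.2 - q.2| < de / 2.
      near: q; exists (setT, [set x | `|p.2 - x| < de / 2]); last by move=> x [].
      by split => //=; exact: filterT.
    by rewrite (distrC q.1) (distrC q.2); clear -h1 h2; lra.
  by apply: le_trans h; rewrite distrC; exact: nc_dist.
have cK : compact (`[-M, M]%classic `*` `[-M, M]%classic : set (Rr * Rr)).
  by apply: compact_setX; exact: segment_compact.
have cGK := continuous_compact (continuous_subspaceT cG) cK.
have [K [_ HK]] := @compact_bounded Rr Rr^o _ cGK.
exists (K + 1) => z zM.
have := HK (K + 1); rewrite ltrDl ltr01 => /(_ isT) H.
have := H (nc (F z)); rewrite /= ger0_norm ?nc_ge0 //; apply.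
exists (cpair z); last by rewrite /G cpairK.
clear G cG cGK H HK; have := Re_le_nc z; have := Im_le_nc z; rewrite !ler_norml => h1 h2.
by split; rewrite /= in_itv /=; lra.
Unshelve. all: by end_near. Qed.

(** * Pointwise continuity calculus *)

Section continuity.
Implicit Types (F G : C -> C) (z w : C) (e : Rr).

Lemma ccont_cst (a : C) z : ccont (fun=> a) z.
Proof. by move=> e e0; exists 1 => // w _; rewrite subrr nc0 ltW. Qed.

Lemma ccont_id z : ccont id z.
Proof. by move=> e e0; exists e => // w /ltW. Qed.

Lemma ccont_cj z : ccont cj z.
Proof. by move=> e e0; exists e => // w h; rewrite -cjB nc_cj ltW. Qed.

Lemma ccont_add F G z : ccont F z -> ccont G z -> ccont (fun w => F w + G w) z.
Proof.
move=> cF cG e e0; have e2 : 0 < e / 2 by rewrite divr_gt0.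
have [d1 d10 H1] := cF _ e2; have [d2 d20 H2] := cG _ e2.
exists (Num.min d1 d2); first by rewrite lt_min d10.
move=> w; rewrite lt_min => /andP[w1 w2].
rewrite opprD addrACA (splitr e); apply: le_trans (nc_triangle _ _) _.
by apply: lerD; [exact: H1|exact: H2].
Qed.

Lemma ccont_local_bound F z : ccont F z -> exists2 de : Rr, 0 < de &
  forall w, nc (w - z) < de -> nc (F w) <= nc (F z) + 1.
Proof.
move=> cF; have [de de0 H] := cF 1 ltr01; exists de => // w /H.
have := nc_triangle (F w - F z) (F z); rewrite subrK; lra.
Qed.

Lemma ccont_mul F G z : ccont F z -> ccont G z -> ccont (fun w => F w * G w) z.
Proof.
move=> cF cG e e0; have [d0 d00 H0] := ccont_local_bound cF.
have e1 : 0 < e / 2 / (nc (F z) + 1) by rewrite !divr_gt0 // ltr_wpDl // nc_ge0.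
have e2 : 0 < e / 2 / (nc (G z) + 1) by rewrite !divr_gt0 // ltr_wpDl // nc_ge0.
have [d1 d10 H1] := cF _ e2; have [d2 d20 H2] := cG _ e1.
exists (Num.min d0 (Num.min d1 d2)); first by rewrite !lt_min d00 d10.
move=> w; rewrite !lt_min => /and3P[/H0 w0 /H1 w1 /H2 w2].
rewrite (_ : _ - _ = F w * (G w - G z) + (F w - F z) * G z); last by ring.
apply: le_trans (nc_triangle _ _) _; rewrite !ncM (splitr e); apply: lerD.
- have p0 : 0 < nc (F z) + 1 by rewrite ltr_wpDl // nc_ge0.
  apply: le_trans (ler_pM (nc_ge0 _) (nc_ge0 _) w0 w2) _.
  by rewrite mulrC divfK // gt_eqF.
- have p0 : 0 < nc (G z) + 1 by rewrite ltr_wpDl // nc_ge0.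
  have l1 : nc (G z) <= nc (G z) + 1 by lra.
  apply: le_trans (ler_pM (nc_ge0 _) (nc_ge0 _) w1 l1) _.
  by rewrite divfK // gt_eqF.
Qed.

Lemma ccont_opp F z : ccont F z -> ccont (fun w => - F w) z.
Proof.
by move=> cF e /cF[de de0 H]; exists de => // w /H; rewrite -opprD ncN.
Qed.

Lemma ccont_sub F G z : ccont F z -> ccont G z -> ccont (fun w => F w - G w) z.
Proof. by move=> cF cG; apply: ccont_add => //; exact: ccont_opp. Qed.

Lemma ccont_inv F z : F z != 0 -> ccont F z -> ccont (fun w => (F w)^-1) z.
Proof.
move=> Fz0 cF e e0; have n0 : 0 < nc (F z) by rewrite nc_gt0.
have h0 : 0 < nc (F z) / 2 by rewrite divr_gt0.
have k0 : 0 < e * (nc (F z) * (nc (F z) / 2)) by rewrite !mulr_gt0.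
have [d1 d10 H1] := cF _ h0; have [d2 d20 H2] := cF _ k0.
exists (Num.min d1 d2); first by rewrite lt_min d10.
move=> w; rewrite lt_min => /andP[/H1 w1 /H2 w2].
have Fw : nc (F z) / 2 <= nc (F w).
  have := nc_triangle (F z - F w) (F w); rewrite subrK ncB; lra.
have Fw0 : F w != 0 by rewrite -nc_gt0 (lt_le_trans h0).
rewrite (_ : _ - _ = - (F w - F z) * (F z * F w)^-1); last by field; rewrite Fw0 Fz0.
rewrite ncM ncN ncV ncM ler_pdivrMr; last by rewrite mulr_gt0 // nc_gt0.
by apply: le_trans w2 _; rewrite !ler_wpM2l // ltW.
Qed.

Lemma ccont_comp F G z : ccont F (G z) -> ccont G z -> ccont (fun w => F (G w)) z.
Proof.
move=> cF cG e /cF[d1 d10 H1]; have d12 : 0 < d1 / 2 by rewrite divr_gt0.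
have [d2 d20 H2] := cG _ d12; exists d2 => // w /H2 w2.
by apply: H1; apply: le_lt_trans w2 _; rewrite ltr_pdivrMr // ltr_pMr // ltr1n.
Qed.

Lemma ccont_near F G z de : 0 < de -> (forall w, nc (w - z) < de -> F w = G w) ->
  ccont F z -> ccont G z.
Proof.
move=> de0 FG cF e /cF[d1 d10 H1]; exists (Num.min d1 de); first by rewrite lt_min d10.
move=> w; rewrite lt_min => /andP[w1 w2].
by rewrite -!FG // ?subrr ?nc0 //; exact: H1.
Qed.

Lemma ccont_prod n (F : 'I_n -> C -> C) z :
  (forall i, ccont (F i) z) -> ccont (fun w => \prod_(i < n) F i w) z.
Proof.
elim: n F => [|n IH] F cF.
  by under eq_fun do rewrite big_ord0; exact: ccont_cst.
under eq_fun do rewrite big_ord_recl.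
by apply: ccont_mul => //; apply: (IH (fun i => F (lift ord0 i))).
Qed.

Lemma ccont_exp F n z : ccont F z -> ccont (fun w => F w ^+ n) z.
Proof.
move=> cF; elim: n => [|n IH]; first exact: ccont_cst.
by under eq_fun do rewrite exprS; exact: ccont_mul.
Qed.

End continuity.

(** * Little-o calculus and Wirtinger derivatives *)

Section small.
Implicit Types (r l b : C -> C) (e : Rr).

Definition csmall r := forall e : Rr, 0 < e -> exists2 de : Rr, 0 < de &
  forall h, nc h < de -> nc (r h) <= e * nc h.

Lemma csmall_add r1 r2 : csmall r1 -> csmall r2 -> csmall (fun h => r1 h + r2 h).
Proof.
move=> s1 s2 e e0; have e2 : 0 < e / 2 by rewrite divr_gt0.
have [d1 d10 H1] := s1 _ e2; have [d2 d20 H2] := s2 _ e2.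
exists (Num.min d1 d2); first by rewrite lt_min d10.
move=> h; rewrite lt_min => /andP[h1 h2].
apply: le_trans (nc_triangle _ _) _; rewrite [in leRHS](splitr e) mulrDl.
by apply: lerD; [exact: H1|exact: H2].
Qed.

(* [b h --> b 0], [l = O(|h|)], [r = o(|h|)] *)
Lemma csmall_mulr b r : ccont b 0 -> csmall r -> csmall (fun h => b h * r h).
Proof.
move=> cb sr e e0; have [d1 d10 H1] := ccont_local_bound cb.
have p0 : 0 < nc (b 0) + 1 by rewrite ltr_wpDl // nc_ge0.
have e1 : 0 < e / (nc (b 0) + 1) by rewrite divr_gt0.
have [d2 d20 H2] := sr _ e1.
exists (Num.min d1 d2); first by rewrite lt_min d10.
move=> h; rewrite lt_min => /andP[h1 h2]; rewrite ncM.
have b1 := H1 h; rewrite subr0 in b1.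
apply: le_trans (ler_pM (nc_ge0 _) (nc_ge0 _) (b1 h1) (H2 _ h2)) _.
by rewrite mulrA mulrCA divff ?mulr1 // gt_eqF.
Qed.

Lemma csmall_mull b l (K : Rr) : ccont b 0 -> b 0 = 0 -> (forall h, nc (l h) <= K * nc h) ->
  csmall (fun h => b h * l h).
Proof.
move=> cb b0 lK e e0.
have p0 : 0 < `|K| + 1 by rewrite ltr_wpDl.
have e1 : 0 < e / (`|K| + 1) by rewrite divr_gt0.
have [d1 d10 H1] := cb _ e1; exists d1 => // h h1; rewrite ncM.
have b1 := H1 h; rewrite b0 !subr0 in b1.
have lK' : nc (l h) <= (`|K| + 1) * nc h.
  apply: le_trans (lK h) _; rewrite ler_wpM2r ?nc_ge0 //.
  by apply: le_trans (ler_norm _) _; rewrite lerDl.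
apply: le_trans (ler_pM (nc_ge0 _) (nc_ge0 _) (b1 h1) lK') _.
by rewrite mulrA divfK // gt_eqF.
Qed.

Lemma csmall_near r1 r2 de : 0 < de -> (forall h, nc h < de -> r1 h = r2 h) ->
  csmall r1 -> csmall r2.
Proof.
move=> de0 FG cF e /cF[d1 d10 H1]; exists (Num.min d1 de); first by rewrite lt_min d10.
move=> w; rewrite lt_min => /andP[w1 w2].
by rewrite -!FG // ?subrr ?nc0 //; exact: H1.
Qed.

Lemma csmall0 : csmall (fun=> 0).
Proof. by move=> e e0; exists 1 => // h _; rewrite nc0 mulr_ge0 ?nc_ge0 // ltW. Qed.

End small.

Section wirtinger.
Implicit Types (f g : C -> C) (z : C).

(* A and B are the Wirtinger derivatives of f at z with respect to z and its conjugate. *)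
Definition Wd f (A B : C) z :=
  csmall (fun h => f (z + h) - f z - A * h - B * cj h).

Lemma eq_Wd f A B A' B' z : A = A' -> B = B' -> Wd f A B z -> Wd f A' B' z.
Proof. by move=> -> ->. Qed.

Lemma Wd_cst a z : Wd (fun=> a) 0 0 z.
Proof. by apply: (csmall_near ltr01 _ csmall0) => h _; ring. Qed.

Lemma Wd_id z : Wd id 1 0 z.
Proof. by apply: (csmall_near ltr01 _ csmall0) => h _; ring. Qed.

Lemma Wd_cj z : Wd cj 0 1 z.
Proof. by apply: (csmall_near ltr01 _ csmall0) => h _; rewrite cjD; ring. Qed.

Lemma linear_bound (A B h : C) : nc (A * h + B * cj h) <= (nc A + nc B) * nc h.
Proof. by apply: le_trans (nc_triangle _ _) _; rewrite !ncM nc_cj mulrDl. Qed.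

Lemma Wd_ccont f A B z : Wd f A B z -> ccont f z.
Proof.
move=> W e e0; have [d1 d10 H1] := W 1 ltr01.
set K := 1 + nc A + nc B.
have K0 : 0 < K by rewrite /K -addrA ltr_wpDr // addr_ge0 // nc_ge0.
exists (Num.min d1 (e / K)); first by rewrite lt_min d10 divr_gt0.
move=> w; rewrite lt_min => /andP[/H1 h1 h2]; move: h1.
rewrite [z + _]addrC subrK mul1r => h1.
rewrite (_ : f w - f z = (f w - f z - A * (w - z) - B * cj (w - z)) +
  (A * (w - z) + B * cj (w - z))); last by ring.
apply: le_trans (nc_triangle _ _) _.
apply: (@le_trans _ _ (K * nc (w - z))); last first.
  by rewrite mulrC -ler_pdivlMr // ltW.
have := linear_bound A B (w - z); rewrite /K !mulrDl mul1r; lra.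
Qed.

Lemma ccont_shift f z : ccont f z -> ccont (fun h => f (z + h)) 0.
Proof.
move=> cf; apply: (ccont_comp (F := f)); first by rewrite addr0.
by apply: ccont_add; [exact: ccont_cst|exact: ccont_id].
Qed.

Lemma Wd_add f g A B A' B' z : Wd f A B z -> Wd g A' B' z ->
  Wd (fun w => f w + g w) (A + A') (B + B') z.
Proof.
by move=> /csmall_add /[apply]; apply: (csmall_near ltr01) => h _; ring.
Qed.

Lemma Wd_mul f g A B A' B' z : Wd f A B z -> Wd g A' B' z ->
  Wd (fun w => f w * g w) (f z * A' + A * g z) (f z * B' + B * g z) z.
Proof.
move=> Wf Wg; have cf := Wd_ccont Wf.
have s1 := csmall_mulr (ccont_shift cf) Wg.
have s2 := csmall_mulr (ccont_cst (g z) 0) Wf.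
have s3 : csmall (fun h => (f (z + h) - f z) * (A' * h + B' * cj h)).
  apply: csmall_mull (fun h => linear_bound A' B' h).
    by apply: ccont_sub; [exact: ccont_shift|exact: ccont_cst].
  by rewrite addr0 subrr.
by apply: (csmall_near ltr01 _ (csmall_add (csmall_add s1 s2) s3)) => h _; ring.
Qed.

Lemma Wd_scale a f A B z : Wd f A B z -> Wd (fun w => a * f w) (a * A) (a * B) z.
Proof. by move=> /(Wd_mul (Wd_cst a z)); apply: eq_Wd; ring. Qed.

Lemma Wd_opp f A B z : Wd f A B z -> Wd (fun w => - f w) (- A) (- B) z.
Proof.
by move=> /(csmall_mulr (ccont_cst (-1) 0)); apply: (csmall_near ltr01) => h _; ring.
Qed.

Lemma Wd_sub f g A B A' B' z : Wd f A B z -> Wd g A' B' z ->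
  Wd (fun w => f w - g w) (A - A') (B - B') z.
Proof. by move=> Wf Wg; apply: Wd_add => //; exact: Wd_opp. Qed.

Lemma Wd_near f g A B z de : 0 < de -> (forall w, nc (w - z) < de -> f w = g w) ->
  Wd f A B z -> Wd g A B z.
Proof.
move=> de0 fg; apply: (csmall_near de0) => h hd.
by rewrite !fg ?subrr ?nc0 // [z + h]addrC addrK.
Qed.

Lemma Wd_inv f A B z : f z != 0 -> Wd f A B z ->
  Wd (fun w => (f w)^-1) (- A / f z ^+ 2) (- B / f z ^+ 2) z.
Proof.
move=> fz0 Wf; have cf := Wd_ccont Wf.
have ci := ccont_shift (ccont_inv fz0 cf).
have s1 := csmall_mulr (ccont_mul ci (ccont_cst (- (f z)^-1) 0)) Wf.
have s2 : csmall (fun h => ((f z ^+ 2)^-1 - (f (z + h))^-1 * (f z)^-1) * (A * h + B * cj h)).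
  apply: csmall_mull (fun h => linear_bound A B h).
    apply: ccont_sub; first exact: ccont_cst.
    by apply: ccont_mul => //; exact: ccont_cst.
  by rewrite addr0 expr2 invfM subrr.
have [d1 d10 H1] : exists2 de, 0 < de & forall h, nc h < de -> f (z + h) != 0.
  have n0 : 0 < nc (f z) / 2 by rewrite divr_gt0 // nc_gt0.
  have [de de0 H] := ccont_shift cf n0; exists de => // h hd.
  have := H h; rewrite subr0 addr0 => /(_ hd).
  apply: contraPneq => ->; rewrite sub0r ncN; apply/negP; rewrite -ltNge.
  by move: n0; lra.
apply: (csmall_near d10 _ (csmall_add s1 s2)) => h /H1 fh0.
by field; rewrite fh0 fz0.
Qed.

Lemma Wd_cjf f A B z : Wd f A B z -> Wd (fun w => cj (f w)) (cj B) (cj A) z.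
Proof.
move=> W e /W[de de0 H]; exists de => // h /H.
rewrite -(nc_cj (_ - _)) !cjB !cjM conjcK.
by rewrite (_ : _ - cj A * cj h - _ = cj (f (z + h)) - cj (f z) - cj B * h - cj A * cj h) //; ring.
Qed.

Lemma Wd_comp f g A B a b z : Wd f A B (g z) -> Wd g a b z ->
  Wd (fun w => f (g w)) (A * a + B * cj b) (A * b + B * cj a) z.
Proof.
move=> Wf Wg; have cg := Wd_ccont Wg.
have s1 := csmall_mulr (ccont_cst A 0) Wg.
have s2 := csmall_mulr (ccont_cst B 0) (Wd_cjf Wg).
have s3 : csmall (fun h => f (g (z + h)) - f (g z) - A * (g (z + h) - g z) - B * cj (g (z + h) - g z)).
  move=> e e0; set K := 1 + nc a + nc b.
  have K0 : 0 < K by rewrite /K -addrA ltr_wpDr // addr_ge0 // nc_ge0.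
  have [d1 d10 H1] := Wf _ (divr_gt0 e0 K0).
  have [d2 d20 H2] := Wg 1 ltr01.
  have d12 : 0 < d1 / 2 by rewrite divr_gt0.
  have [d3 d30 H3] := ccont_shift cg d12.
  exists (Num.min d2 d3); first by rewrite lt_min d20.
  move=> h; rewrite lt_min => /andP[h2 h3].
  have k3 := H3 h; rewrite subr0 addr0 in k3; have {}k3 := k3 h3.
  have k1 : nc (g (z + h) - g z) < d1 by move: k3 d10; lra.
  have := H1 _ k1; rewrite [g z + _]addrC subrK => k4.
  apply: le_trans k4 _; rewrite -mulrA ler_wpM2l ?(ltW e0) // mulrC ler_pdivrMr //.
  have k2 := H2 _ h2; rewrite mul1r in k2.
  rewrite (_ : g (z + h) - g z = (g (z + h) - g z - a * h - b * cj h) + (a * h + b * cj h)); last by ring.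
  apply: le_trans (nc_triangle _ _) _.
  by have := linear_bound a b h; rewrite /K mulrDr mulrDr; lra.
apply: (csmall_near ltr01 _ (csmall_add (csmall_add s1 s2) s3)) => h _.
by rewrite !cjB; ring.
Qed.

End wirtinger.

(** * Real derivatives, and Stokes' theorem for compactly supported functions *)

Definition rder (u : Rr -> Rr) (a x : Rr) := forall e : Rr, 0 < e ->
  exists2 de : Rr, 0 < de & forall t, `|t| < de -> `|u (x + t) - u x - a * t| <= e * `|t|.

Definition rcont (u : Rr -> Rr) (x : Rr) := forall e : Rr, 0 < e ->
  exists2 de : Rr, 0 < de & forall y, `|y - x| < de -> `|u y - u x| <= e.

Lemma rder_opp u a x : rder u a x -> rder (fun x => - u x) (- a) x.
Proof.
move=> du e /du[de de0 H]; exists de => // t /H.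
by rewrite -normrN (_ : - (_ - _) = - u (x + t) - - u x - - a * t) //; ring.
Qed.

Lemma rcont_continuous u x : rcont u x -> {for x, continuous (u : Rr^o -> Rr^o)}.
Proof.
move=> cu; apply/(@cvgrPdist_le _ Rr^o) => e e0; have [de de0 H] := cu e e0.
apply/(@nbhs_ballP _ Rr^o); exists de => //= y; rewrite /ball /= => yx.
by rewrite distrC; apply: H; rewrite distrC.
Qed.

Lemma rder_cvg (u : Rr^o -> Rr^o) (a x : Rr^o) : rder u a x ->
  h^-1 *: ((u \o shift x) (h *: (1 : Rr^o)) - u x) @[h --> (0 : Rr^o)^'] --> a.
Proof.
move=> du; apply/(@cvgrPdist_le _ Rr^o) => e e0; have [de de0 H] := du e e0.
apply/(@nbhs_ballP _ Rr^o); exists de => //= t; rewrite /ball /= sub0r normrN => td t0.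
have := H t td; rewrite /shift /= -ler_pdivrMr ?normr_gt0 // => {}H.
apply: le_trans H; rewrite -normf_div distrC.
rewrite [t *: _]mulr1 [t + x]addrC (_ : _ *: _ = t^-1 * (u (x + t) - u x)) //.
by rewrite le_eqVlt; apply/orP; left; apply/eqP; congr (`|_|); field.
Qed.

(** The fundamental theorem of calculus on an interval at whose ends u vanishes. *)
Lemma Rintegral_deriv0 (u u' : Rr -> Rr) (M : Rr) :
  (forall x, rder u (u' x) x) -> (forall x, rcont u' x) ->
  (forall x, M <= `|x| -> u x = 0 /\ u' x = 0) ->
  (\int[leb]_x u' x)%R = 0.
Proof.
move=> du cu u0.
have [a a0 aM] : exists2 a : Rr, 0 < a & M <= `|a|.
  exists (`|M| + 1); first by rewrite ltr_wpDl.
  rewrite ger0_norm ?addr_ge0 //; apply: le_trans (ler_norm _) _.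
  by rewrite lerDl.
have Na : - a < a by lra.
have cu' : continuous (u' : Rr^o -> Rr^o) by move=> x; exact: rcont_continuous.
have der x : derivable (u : Rr^o -> Rr^o) x 1 by apply: cvgP; exact: (rder_cvg (du x)).
have dcvg x : 'D_1 (u : Rr^o -> Rr^o) x = u' x.
  by apply: cvg_lim => //; exact: (rder_cvg (du x)).
have cuu : continuous (u : Rr^o -> Rr^o).
  by move=> x; apply: differentiable_continuous; apply/derivable1_diffP; exact: der.
have F := @continuous_FTC2 Rr u' u (- a) a Na.
rewrite /Rintegral (_ : (\int[leb]_x (u' x)%:E)%E = \int[leb]_(x in `[(- a)%R, a%R]) (u' x)%:E)%E.
  rewrite F //.
  - by rewrite (u0 a aM).1 (u0 (- a) _).1 ?normrN // subee.
  - exact: continuous_subspaceT.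
  - split=> [x _| |]; [exact: der|apply: cvg_at_right_filter|apply: cvg_at_left_filter];
      exact: cuu.
  - by move=> x _; rewrite derive1E; exact: dcvg.
rewrite [RHS]integral_mkcond; apply: eq_integral => x _.
rewrite /patch; case: ifPn => //; rewrite notin_setE /= in_itv /= => /negP.
rewrite negb_and -!ltNge => xa; rewrite (u0 x _).2 //.
rewrite (le_trans aM) // (ger0_norm (ltW a0)).
case/orP: xa => xa.
- by rewrite ltr0_norm; move: a0 xa; lra.
- by rewrite gtr0_norm; move: a0 xa; lra.
Qed.

Definition csq (M : Rr) : set C := [set z | (`|Re z| <= M) && (`|Im z| <= M)].

Lemma csq_preim M : pairc @^-1` (csq M) = `[-M, M]%classic `*` `[-M, M]%classic.
Proof.
apply/seteqP; split => -[x y] /=; rewrite /csq /= !in_itv /= !ler_norml.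
  by move=> /andP[].
by move=> [-> ->].
Qed.

Lemma measurable_csq M : measurable (csq M).
Proof.
rewrite (_ : csq M = cpair @^-1` (pairc @^-1` csq M)).
  rewrite csq_preim -[X in measurable X]setTI; apply: measurable_cpair => //.
  by apply: measurableX; exact: measurable_itv.
by apply/seteqP; split => -[].
Qed.

Lemma muC_csq M : (muC (csq M) < +oo)%E.
Proof.
rewrite /muC csq_preim product_measure1E; [|exact: measurable_itv..].
have h : (leb (`[(- M)%R, M%R]%classic : set mR) < +oo)%E.
  by rewrite lebesgue_measure_itv /=; case: ifP => _; rewrite ?ltry // -EFinB ltry.
by apply: lte_mul_pinfty => //; rewrite ge0_fin_numE.
Qed.

Lemma integrable_csq (M K : Rr) :
  muC.-integrable setT (EFin \o (fun z => K * \1_(csq M) z)).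
Proof.
have i1 : muC.-integrable setT (EFin \o (\1_(csq M) : C -> Rr)).
  apply/integrableP; split.
    by apply/measurable_EFinP; exact: measurable_indic (measurable_csq M).
  rewrite (_ : (\int[muC]_x _ = \int[muC]_x (\1_(csq M) x)%:E)%E).
    by rewrite integral_indic ?setIT; [exact: muC_csq|done|exact: measurable_csq].
  by apply: eq_integral => x _ /=; rewrite ger0_norm.
by apply: eq_integrable (integrableZl measurableT K i1).
Qed.

Lemma csq_nc M z : nc z <= M -> csq M z.
Proof.
by move=> h; rewrite /csq /= (le_trans (Re_le_nc _)) // (le_trans (Im_le_nc _)).
Qed.

Lemma cintegrable_cpt (F : C -> C) (M K : Rr) : measurable_fun setT F ->
  (forall z, nc (F z) <= K) ->
  (forall z, M <= nc z -> F z = 0) -> cintegrable muC F.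
Proof.
move=> mF FK F0; apply: (cintegrable_le mF (integrable_csq M `|K|)) => z.
have [h|h] := leP M (nc z); first by rewrite F0 // nc0 mulr_ge0.
rewrite indicE mem_set; last by apply: csq_nc; exact: ltW.
by rewrite mulr1 (le_trans (FK z)) // ler_norm.
Qed.

Lemma ccont_cpt_bounded (F : C -> C) (M : Rr) : (forall z, ccont F z) ->
  (forall z, M <= nc z -> F z = 0) -> exists K, forall z, nc (F z) <= K.
Proof.
move=> cF F0; have [K HK] := ccont_bounded M cF; exists `|K| => z.
have [h|h] := leP M (nc z); first by rewrite F0 // nc0.
by rewrite (le_trans (HK z (ltW h))) // ler_norm.
Qed.

Lemma cintegrable_ccont (F : C -> C) (M : Rr) : (forall z, ccont F z) ->
  (forall z, M <= nc z -> F z = 0) -> cintegrable muC F.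
Proof.
move=> cF F0; have [K HK] := ccont_cpt_bounded cF F0.
exact: (cintegrable_cpt (measurable_ccont cF) HK F0).
Qed.

(** C^1 functions supported in a disc, carried together with their derivatives A in z and B in
    conj(z). *)
Definition C1c (M : Rr) (f A B : C -> C) :=
  [/\ forall z, Wd f (A z) (B z) z, forall z, ccont A z, forall z, ccont B z
    & forall z, M <= nc z -> [/\ f z = 0, A z = 0 & B z = 0]].

Lemma Wd_rderx f A B x y : Wd f A B (complex.Complex x y) ->
  rder (fun x => Re (f (complex.Complex x y))) (Re (A + B)) x /\
  rder (fun x => Im (f (complex.Complex x y))) (Im (A + B)) x.
Proof.
move=> W; split => e /W[de de0 H]; exists de => // t td;
  (have := H (rc t); rewrite nc_rc => /(_ td); apply: le_trans;
   rewrite (_ : complex.Complex x y + rc t = complex.Complex (x + t) y);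
   [|by congr complex.Complex; rewrite addr0]).
- apply: le_trans (Re_le_nc _); rewrite le_eqVlt; apply/orP; left; apply/eqP.
  by congr (`|_|); rewrite !ReB !ReM ReD /=; ring.
- apply: le_trans (Im_le_nc _); rewrite le_eqVlt; apply/orP; left; apply/eqP.
  by congr (`|_|); rewrite !ImB !ImM ImD /=; ring.
Qed.

Lemma Wd_rdery f A B x y : Wd f A B (complex.Complex x y) ->
  rder (fun y => Re (f (complex.Complex x y))) (- Im (A - B)) y /\
  rder (fun y => Im (f (complex.Complex x y))) (Re (A - B)) y.
Proof.
have nci t : nc (complex.Complex 0 t) = `|t|.
  by rewrite /= expr0n /= add0r sqrtr_sqr.
move=> W; split => e /W[de de0 H]; exists de => // t td;
  (have := H (complex.Complex 0 t); rewrite nci => /(_ td); apply: le_trans;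
   rewrite (_ : complex.Complex x y + complex.Complex 0 t = complex.Complex x (y + t));
   [|by congr complex.Complex; rewrite addr0]).
- apply: le_trans (Re_le_nc _); rewrite le_eqVlt; apply/orP; left; apply/eqP.
  by congr (`|_|); rewrite !ReB !ReM ImB /=; ring.
- apply: le_trans (Im_le_nc _); rewrite le_eqVlt; apply/orP; left; apply/eqP.
  by congr (`|_|); rewrite !ImB !ImM ReB /=; ring.
Qed.

Lemma ccont_rcontx F x y : ccont F (complex.Complex x y) ->
  rcont (fun x => Re (F (complex.Complex x y))) x /\
  rcont (fun x => Im (F (complex.Complex x y))) x.
Proof.
move=> cF; split => e /cF[de de0 H]; exists de => // t td;
  (have := H (complex.Complex t y);
   rewrite (_ : complex.Complex t y - _ = rc (t - x)); [|by congr complex.Complex; rewrite subrr]);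
  rewrite nc_rc => /(_ td); apply: le_trans; rewrite -?ReB -?ImB; [exact: Re_le_nc|exact: Im_le_nc].
Qed.

Lemma ccont_rconty F x y : ccont F (complex.Complex x y) ->
  rcont (fun y => Re (F (complex.Complex x y))) y /\
  rcont (fun y => Im (F (complex.Complex x y))) y.
Proof.
have nci t : nc (complex.Complex 0 t) = `|t|.
  by rewrite /= expr0n /= add0r sqrtr_sqr.
move=> cF; split => e /cF[de de0 H]; exists de => // t td;
  (have := H (complex.Complex x t);
   rewrite (_ : complex.Complex x t - _ = complex.Complex 0 (t - y)); [|by congr complex.Complex; rewrite subrr]);
  rewrite nci => /(_ td); apply: le_trans; rewrite -?ReB -?ImB; [exact: Re_le_nc|exact: Im_le_nc].
Qed.

(** A + B is the x-derivative of f, and A - B is its y-derivative up to a factor i. Each integrates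
    to 0 along its own variable, hence over the plane by Fubini; A and B are the half-sum and the
    half-difference. *)
Lemma CI_dbar0 M f A B : C1c M f A B -> CI muC A = 0 /\ CI muC B = 0.
Proof.
move=> [W cA cB f0].
have f0' z : M <= nc z -> f z = 0 by move=> /f0[].
have iA : cintegrable muC A by apply: (cintegrable_ccont cA (M := M)) => z /f0[].
have iB : cintegrable muC B by apply: (cintegrable_ccont cB (M := M)) => z /f0[].
have nx x y : `|x| <= nc (complex.Complex x y) by exact: (Re_le_nc (complex.Complex x y)).
have ny x y : `|y| <= nc (complex.Complex x y) by exact: (Im_le_nc (complex.Complex x y)).
have sum0 : CI muC (fun z => A z + B z) = 0.
  have [/Rintegral_muC[_ r _] /Rintegral_muC[_ i _]] := cintegrableD iA iB.
  apply: complexP => /=; rewrite ?r ?i.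
  - rewrite (_ : (fun y => _) = cst 0) ?Rintegral_cst ?mul0r //; apply/funext => y.
    apply: (@Rintegral_deriv0 (fun x => Re (f (complex.Complex x y))) _ M).
    + by move=> x; have [] := Wd_rderx (W (complex.Complex x y)).
    + by move=> x; have [] := ccont_rcontx (ccont_add (cA (complex.Complex x y)) (cB _)).
    + move=> x Mx; have [-> -> ->] := f0 _ (le_trans Mx (nx x y)).
      by rewrite addr0.
  - rewrite (_ : (fun y => _) = cst 0) ?Rintegral_cst ?mul0r //; apply/funext => y.
    apply: (@Rintegral_deriv0 (fun x => Im (f (complex.Complex x y))) _ M).
    + by move=> x; have [] := Wd_rderx (W (complex.Complex x y)).
    + by move=> x; have [] := ccont_rcontx (ccont_add (cA (complex.Complex x y)) (cB _)).
    + move=> x Mx; have [-> -> ->] := f0 _ (le_trans Mx (nx x y)).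
      by rewrite addr0.
have diff0 : CI muC (fun z => A z - B z) = 0.
  have [/Rintegral_muC[r _ _] /Rintegral_muC[i _ _]] := cintegrableB iA iB.
  apply: complexP => /=; rewrite ?r ?i.
  - rewrite (_ : (fun y => _) = cst 0) ?Rintegral_cst ?mul0r //; apply/funext => x.
    apply: (@Rintegral_deriv0 (fun y => Im (f (complex.Complex x y))) _ M).
    + by move=> y; have [] := Wd_rdery (W (complex.Complex x y)).
    + by move=> y; have [] := ccont_rconty (ccont_sub (cA (complex.Complex x y)) (cB _)).
    + move=> y My; have [-> -> ->] := f0 _ (le_trans My (ny x y)).
      by rewrite subr0.
  - rewrite (_ : (fun y => _) = cst 0) ?Rintegral_cst ?mul0r //; apply/funext => x.
    apply: (@Rintegral_deriv0 (fun y => - Re (f (complex.Complex x y))) _ M).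
    + move=> y; have [h _] := Wd_rdery (W (complex.Complex x y)).
      by rewrite -[X in rder _ X](opprK); exact: rder_opp h.
    + by move=> y; have [] := ccont_rconty (ccont_sub (cA (complex.Complex x y)) (cB _)).
    + move=> y My; have [-> -> ->] := f0 _ (le_trans My (ny x y)).
      by rewrite subr0 oppr0.
rewrite CID // in sum0; rewrite CIB // in diff0.
have AB : CI muC A = CI muC B by apply/eqP; rewrite -subr_eq0 diff0.
have B0 : CI muC B = 0.
  move: sum0; rewrite AB -mulr2n => /eqP; rewrite mulrn_eq0 => /eqP //.
by rewrite AB.
Qed.

(** * Truncated powers and quadratic B-splines *)

Section real_derivative.
Implicit Types (u v : Rr -> Rr) (x a c : Rr).

Lemma rder_add u v a c x : rder u a x -> rder v c x -> rder (fun x => u x + v x) (a + c) x.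
Proof.
move=> du dv e e0; have e2 : 0 < e / 2 by rewrite divr_gt0.
have [d1 d10 H1] := du _ e2; have [d2 d20 H2] := dv _ e2.
exists (Num.min d1 d2); first by rewrite lt_min d10.
move=> t; rewrite lt_min => /andP[/H1 h1 /H2 h2].
rewrite (_ : _ - _ = (u (x + t) - u x - a * t) + (v (x + t) - v x - c * t)); last by ring.
by apply: le_trans (ler_normD _ _) _; lra.
Qed.

Lemma eq_rder u v a c x : u =1 v -> a = c -> rder u a x -> rder v c x.
Proof. by move=> /funext -> ->. Qed.

Lemma eq_rcont u v x : u =1 v -> rcont u x -> rcont v x.
Proof. by move=> /funext ->. Qed.

Lemma rder_scale k u a x : rder u a x -> rder (fun x => k * u x) (k * a) x.
Proof.
move=> du e e0; have k0 : 0 < `|k| + 1 by rewrite ltr_wpDl.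
have ek : 0 < e / (`|k| + 1) by rewrite divr_gt0.
have [d1 d10 H1] := du _ ek; exists d1 => // t /H1 h.
rewrite (_ : _ - _ = k * (u (x + t) - u x - a * t)); last by ring.
rewrite normrM; apply: le_trans (ler_wpM2l (normr_ge0 _) h) _.
rewrite mulrA ler_wpM2r // mulrCA ler_piMr // ?(ltW e0) //.
by rewrite ler_pdivrMr // mul1r lerDl.
Qed.

Lemma rder_affine k c u a x : rder u a (k * x + c) -> rder (fun x => u (k * x + c)) (k * a) x.
Proof.
move=> du e e0; have k0 : 0 < `|k| + 1 by rewrite ltr_wpDl.
have ek : 0 < e / (`|k| + 1) by rewrite divr_gt0.
have [d1 d10 H1] := du _ ek; exists (d1 / (`|k| + 1)); first by rewrite divr_gt0.
move=> t; rewrite ltr_pdivlMr // => ht.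
have kt : `|k * t| <= `|t| * (`|k| + 1).
  by rewrite normrM mulrC ler_wpM2l // lerDl.
have := H1 (k * t) (le_lt_trans kt ht).
rewrite (_ : k * (x + t) + c = k * x + c + k * t); last by ring.
rewrite (_ : a * (k * t) = k * a * t); last by ring.
move=> h; apply: le_trans h _.
apply: le_trans (ler_wpM2l (ltW ek) kt) _.
by rewrite mulrCA divfK ?gt_eqF // mulrC.
Qed.

Lemma rcont_affine k c u x : rcont u (k * x + c) -> rcont (fun x => u (k * x + c)) x.
Proof.
move=> cu e /cu[d1 d10 H1]; have k0 : 0 < `|k| + 1 by rewrite ltr_wpDl.
exists (d1 / (`|k| + 1)); first by rewrite divr_gt0.
move=> y; rewrite ltr_pdivlMr // => ht; apply: H1.
apply: le_lt_trans ht; rewrite (_ : _ - _ = k * (y - x)); last by ring.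
by rewrite normrM mulrC ler_wpM2l // lerDl.
Qed.

Lemma rcont_add u v x : rcont u x -> rcont v x -> rcont (fun x => u x + v x) x.
Proof.
move=> du dv e e0; have e2 : 0 < e / 2 by rewrite divr_gt0.
have [d1 d10 H1] := du _ e2; have [d2 d20 H2] := dv _ e2.
exists (Num.min d1 d2); first by rewrite lt_min d10.
move=> t; rewrite lt_min => /andP[/H1 h1 /H2 h2].
rewrite (_ : _ - _ = (u t - u x) + (v t - v x)); last by ring.
by apply: le_trans (ler_normD _ _) _; lra.
Qed.

Lemma rcont_scale k u x : rcont u x -> rcont (fun x => k * u x) x.
Proof.
move=> du e e0; have k0 : 0 < `|k| + 1 by rewrite ltr_wpDl.
have ek : 0 < e / (`|k| + 1) by rewrite divr_gt0.
have [d1 d10 H1] := du _ ek; exists d1 => // t /H1 h.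
rewrite -mulrBr normrM; apply: le_trans (ler_wpM2l (normr_ge0 _) h) _.
rewrite mulrCA ler_piMr // ?(ltW e0) //.
by rewrite ler_pdivrMr // mul1r lerDl.
Qed.

Definition pos x : Rr := Num.max x 0.
Definition sqp x : Rr := pos x ^+ 2.

Lemma pos_le0 x : x <= 0 -> pos x = 0. Proof. exact: max_r. Qed.
Lemma pos_ge0 x : 0 <= x -> pos x = x. Proof. exact: max_l. Qed.

Lemma rder_sqp x : rder sqp (2 * pos x) x.
Proof.
move=> e e0; exists e => // t te.
suff h : `|sqp (x + t) - sqp x - 2 * pos x * t| <= `|t| ^+ 2.
  by apply: le_trans h _; rewrite expr2 ler_wpM2r // ltW.
rewrite real_normK ?num_real // ler_norml /sqp.
have [x0|x0] := leP x 0; have [y0|y0] := leP (x + t) 0;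
  rewrite ?(pos_le0 x0) ?(pos_ge0 (ltW x0)) ?(pos_le0 y0) ?(pos_ge0 (ltW y0)).
- by rewrite !expr0n /=; nra.
- by rewrite !expr0n /=; nra.
- by rewrite !expr0n /=; nra.
- by nra.
Qed.

Lemma rcont_pos x : rcont pos x.
Proof.
move=> e e0; exists e => // y /ltW h; apply: le_trans h.
rewrite ler_norml; have := ler_norm (y - x); have := ler_norm (x - y); rewrite (distrC x).
have [x0|x0] := leP x 0; have [y0|y0] := leP y 0;
  by rewrite ?(pos_le0 x0) ?(pos_ge0 (ltW x0)) ?(pos_le0 y0) ?(pos_ge0 (ltW y0)); lra.
Qed.

Lemma sqp2 x : sqp (2 * x) = 4 * sqp x.
Proof.
rewrite /sqp; have [x0|x0] := leP x 0.
  by rewrite !pos_le0 ?expr0n ?mulr0 //; lra.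
by rewrite !pos_ge0; [ring|exact: ltW|lra].
Qed.

Lemma pos2 x : pos (2 * x) = 2 * pos x.
Proof.
have [x0|x0] := leP x 0; first by rewrite !pos_le0 ?mulr0 //; lra.
by rewrite !pos_ge0; [|exact: ltW|lra].
Qed.

End real_derivative.

Section bump.

(* the quadratic B-spline with knots 0, 1, 2, 3 and its derivative *)
Definition bsp (t : Rr) : Rr :=
  (sqp (1 * t + - 0%:R) - 3 * sqp (1 * t + - 1%:R) + 3 * sqp (1 * t + - 2%:R) - sqp (1 * t + - 3%:R)) / 2.
Definition dbsp (t : Rr) : Rr :=
  pos (1 * t + - 0%:R) - 3 * pos (1 * t + - 1%:R) + 3 * pos (1 * t + - 2%:R) - pos (1 * t + - 3%:R).

Lemma rder_bsp t : rder bsp (dbsp t) t.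
Proof.
have d c := rder_affine (rder_sqp (1 * t + c)).
apply: eq_rder (rder_scale (2^-1) (rder_add (rder_add (rder_add (d (- 0%:R)) (rder_scale (-3) (d (- 1%:R))))
  (rder_scale 3 (d (- 2%:R)))) (rder_scale (-1) (d (- 3%:R))))).
- by move=> x; rewrite /bsp; field.
- by rewrite /dbsp; field.
Qed.

Lemma rcont_dbsp t : rcont dbsp t.
Proof.
have d c := rcont_affine (@rcont_pos (1 * t + c)).
apply: eq_rcont (rcont_add (rcont_add (rcont_add (d (- 0%:R)) (rcont_scale (-3) (d (- 1%:R))))
  (rcont_scale 3 (d (- 2%:R)))) (rcont_scale (-1) (d (- 3%:R)))).
by move=> x; rewrite /dbsp; ring.
Qed.

(** Beyond 3 the truncations disappear, and what is left is a third difference of a quadratic,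
    respectively linear, polynomial. *)
Lemma bsp_out t : t <= 0 \/ 3 <= t -> bsp t = 0 /\ dbsp t = 0.
Proof.
rewrite /bsp /dbsp /sqp => -[t0|t3].
  by rewrite !pos_le0; [split; field|lra..].
by rewrite !pos_ge0; [split; [field|ring]|lra..].
Qed.

Lemma pos_bound (t c : Rr) : 0 <= t <= 3 -> 0 <= c <= 3 -> 0 <= pos (1 * t + - c) <= 3.
Proof.
move=> t3 c0; have [h|h] := leP (1 * t + - c) 0; first by rewrite pos_le0 //; apply/andP; split; lra.
by rewrite pos_ge0; [apply/andP; split; lra|exact: ltW].
Qed.

(** Crude: each truncated argument lies in [0, 3], so the spline is at most (1 + 3 + 3 + 1) * 9 / 2
    = 36 and its derivative at most 24. *)
Lemma bsp_bound t : `|bsp t| <= 36 /\ `|dbsp t| <= 36.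
Proof.
have [h|h] := leP t 0; first by have [-> ->] := bsp_out (or_introl h); rewrite normr0; split; lra.
have [h'|h'] := leP 3 t; first by have [-> ->] := bsp_out (or_intror h'); rewrite normr0; split; lra.
have t3 : 0 <= t <= 3 by lra.
have p0 : 0 <= pos (1 * t + - 0%:R) <= 3 by apply: pos_bound; rewrite ?mulr0n //; lra.
have p1 : 0 <= pos (1 * t + - 1%:R) <= 3 by apply: pos_bound => //; lra.
have p2 : 0 <= pos (1 * t + - 2%:R) <= 3 by apply: pos_bound => //; lra.
have p3 : 0 <= pos (1 * t + - 3%:R) <= 3 by apply: pos_bound => //; lra.
rewrite /bsp /dbsp /sqp; move: p0 p1 p2 p3.
move: (pos _) (pos _) (pos _) (pos _) => a b c d p0 p1 p2 p3.
have sq (x : Rr) : 0 <= x <= 3 -> 0 <= x ^+ 2 <= 9.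
  by move=> /andP[x0 x3]; rewrite sqr_ge0 /= (_ : 9 = 3 ^+ 2) ?ler_pXn2r ?nnegrE //; ring.
have := sq d p0; have := sq c p1; have := sq b p2; have := sq a p3.
by move=> *; rewrite !ler_norml; split; lra.
Qed.

(** The binomial coefficients of (1 + X)^3, weights of the two-scale relation. *)
Definition bwt (i : nat) : Rr := nth 0 [:: 1; 3; 3; 1] i.

Lemma pos_double (t c : Rr) : pos (1 * t + c) = pos (2 * t + 2 * c) / 2.
Proof. by rewrite mul1r -mulrDr pos2; field. Qed.

(** The two-scale relation of B-splines. Since (1 - X^2)^3 = (1 - X)^3 (1 + X)^3, a third difference
    of step 2 is the third difference of step 1 averaged with weights 1, 3, 3, 1; homogeneity of p
    supplies the factor [al]. *)
Lemma bsp_refine_aux (p : Rr -> Rr) (al : Rr) t :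
  (forall c, p (1 * t + c) = al * p (2 * t + 2 * c)) ->
  let b t := p (1 * t + - 0%:R) - 3 * p (1 * t + - 1%:R) + 3 * p (1 * t + - 2%:R) - p (1 * t + - 3%:R) in
  b t = al * \sum_(i < 4) bwt i * b (2 * t - i%:R).
Proof.
move=> pE /=; rewrite !big_ord_recl big_ord0 /bwt /bump /=.
pose q (k : nat) := p (2 * t - k%:R).
have Q (a c k : nat) : (a + c)%N = k -> p (1 * (2 * t - a%:R) + - c%:R) = q k.
  by move=> <-; rewrite /q natrD; congr p; ring.
have D (c k : nat) : (c + c)%N = k -> p (1 * t + - c%:R) = al * q k.
  by move=> <-; rewrite /q natrD pE; congr (_ * p _); ring.
rewrite (D 0 0 erefl) (D 1 2 erefl) (D 2 4 erefl) (D 3 6 erefl)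
  (Q 0 0 0 erefl) (Q 0 1 1 erefl) (Q 0 2 2 erefl) (Q 0 3 3 erefl) (Q 1 0 1 erefl) (Q 1 1 2 erefl) (Q 1 2 3 erefl) (Q 1 3 4 erefl) (Q 2 0 2 erefl) (Q 2 1 3 erefl) (Q 2 2 4 erefl) (Q 2 3 5 erefl) (Q 3 0 3 erefl) (Q 3 1 4 erefl) (Q 3 2 5 erefl) (Q 3 3 6 erefl).
ring.
Qed.

Lemma bsp_refine t : bsp t = 4^-1 * \sum_(i < 4) bwt i * bsp (2 * t - i%:R).
Proof.
have := @bsp_refine_aux sqp 4^-1 t.
rewrite /bsp => -> => [|c]; last by rewrite mul1r -mulrDr sqp2; field.
by rewrite -mulrA mulr_suml; congr (_ * _); apply: eq_bigr => i _; rewrite mulrA.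
Qed.

Lemma dbsp_refine t : dbsp t = 2^-1 * \sum_(i < 4) bwt i * dbsp (2 * t - i%:R).
Proof. by apply: bsp_refine_aux => c; rewrite mul1r -mulrDr pos2; field. Qed.

End bump.

Notation ii := (complex.Complex 0 1 : C).

Lemma rcM (a b : Rr) : rc (a * b) = rc a * rc b. Proof. exact: rmorphM. Qed.
Lemma rcD (a b : Rr) : rc (a + b) = rc a + rc b. Proof. exact: rmorphD. Qed.
Lemma rcB (a b : Rr) : rc (a - b) = rc a - rc b. Proof. exact: rmorphB. Qed.

Lemma Wd_re u a z : rder u a (Re z) -> Wd (fun z => rc (u (Re z))) (rc (a / 2)) (rc (a / 2)) z.
Proof.
move=> du e e0; have [de de0 H] := du e e0; exists de => // h hd.
have hR := le_lt_trans (Re_le_nc h) hd.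
rewrite (_ : _ - _ = rc (u (Re z + Re h) - u (Re z) - a * Re h)).
  rewrite nc_rc; apply: le_trans (H _ hR) _.
  by apply: ler_wpM2l; [exact: ltW|exact: Re_le_nc].
apply: complexP; rewrite ?ReB ?ImB ?ReM ?ImM ReD /=; last by case: h {hd hR} => ? ? /=; ring.
by case: h {hd hR} => ? ? /=; field.
Qed.

Lemma Wd_im u a z : rder u a (Im z) ->
  Wd (fun z => rc (u (Im z))) (- (ii * rc (a / 2))) (ii * rc (a / 2)) z.
Proof.
move=> du e e0; have [de de0 H] := du e e0; exists de => // h hd.
have hR := le_lt_trans (Im_le_nc h) hd.
rewrite (_ : _ - _ = rc (u (Im z + Im h) - u (Im z) - a * Im h)).
  rewrite nc_rc; apply: le_trans (H _ hR) _.
  by apply: ler_wpM2l; [exact: ltW|exact: Im_le_nc].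
apply: complexP; rewrite ?ReB ?ImB ?ReM ?ImM ImD /=; last by case: h {hd hR} => ? ? /=; ring.
by case: h {hd hR} => ? ? /=; field.
Qed.

Lemma ccont_re u z : rcont u (Re z) -> ccont (fun z => rc (u (Re z))) z.
Proof.
move=> cu e /cu[de de0 H]; exists de => // w hw.
by rewrite -rcB nc_rc; apply: H; rewrite -ReB; exact: le_lt_trans (Re_le_nc _) hw.
Qed.

Lemma ccont_im u z : rcont u (Im z) -> ccont (fun z => rc (u (Im z))) z.
Proof.
move=> cu e /cu[de de0 H]; exists de => // w hw.
by rewrite -rcB nc_rc; apply: H; rewrite -ImB; exact: le_lt_trans (Im_le_nc _) hw.
Qed.

Lemma rder_rcont u a x : rder u a x -> rcont u x.
Proof.
move=> du e e0; have [d1 d10 H1] := du 1 ltr01.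
have k0 : 0 < 1 + `|a| by rewrite ltr_pwDl.
exists (Num.min d1 (e / (1 + `|a|))); first by rewrite lt_min d10 divr_gt0.
move=> y; rewrite lt_min => /andP[/H1 h1 h2]; move: h1.
rewrite [x + _]addrC subrK mul1r => h1.
rewrite (_ : u y - u x = (u y - u x - a * (y - x)) + a * (y - x)); last by ring.
apply: le_trans (ler_normD _ _) _; rewrite normrM.
apply: (@le_trans _ _ ((1 + `|a|) * `|y - x|)); first by rewrite mulrDl mul1r lerD2r.
by rewrite mulrC -ler_pdivlMr // ltW.
Qed.

Section bump2.
Implicit Types (p s x : Rr).

Definition b1 p s x := bsp (s^-1 * x + - (p / s)).
Definition db1 p s x := s^-1 * dbsp (s^-1 * x + - (p / s)).

Lemma rder_b1 p s x : rder (b1 p s) (db1 p s x) x.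
Proof. by apply: rder_affine; exact: rder_bsp. Qed.

Lemma rcont_db1 p s x : rcont (db1 p s) x.
Proof. by apply: rcont_scale; apply: rcont_affine; exact: rcont_dbsp. Qed.

Lemma b1_refine p s x : s != 0 ->
  b1 p s x = \sum_(i < 4) bwt i / 4 * b1 (p + i%:R * (s / 2)) (s / 2) x.
Proof.
move=> s0; rewrite /b1 bsp_refine mulr_sumr; apply: eq_bigr => i _.
rewrite (_ : (s / 2)^-1 * x + - ((p + i%:R * (s / 2)) / (s / 2)) = 2 * (s^-1 * x + - (p / s)) - i%:R).
  by move: (bsp _) => d; field.
by field.
Qed.

Lemma db1_refine p s x : s != 0 ->
  db1 p s x = \sum_(i < 4) bwt i / 4 * db1 (p + i%:R * (s / 2)) (s / 2) x.
Proof.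
move=> s0; rewrite /db1 dbsp_refine !mulr_sumr; apply: eq_bigr => i _.
rewrite (_ : (s / 2)^-1 * x + - ((p + i%:R * (s / 2)) / (s / 2)) = 2 * (s^-1 * x + - (p / s)) - i%:R).
  by move: (dbsp _) => d; field.
by field.
Qed.

Lemma b1_out p s x : 0 < s -> x <= p \/ p + 3 * s <= x -> b1 p s x = 0 /\ db1 p s x = 0.
Proof.
move=> s0 h; have h' : s^-1 * x + - (p / s) <= 0 \/ 3 <= s^-1 * x + - (p / s).
  rewrite -mulrC -mulrBl; case: h => h; [left|right].
    by rewrite pmulr_lle0 ?invr_gt0 // subr_le0.
  by rewrite ler_pdivlMr // lerBrDr addrC.
by rewrite /db1 /b1; have [-> ->] := bsp_out h'; rewrite mulr0.
Qed.

Lemma b1_bound p s x : 0 < s -> `|b1 p s x| <= 36 /\ `|db1 p s x| <= 36 / s.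
Proof.
move=> s0; have [h1 h2] := bsp_bound (s^-1 * x + - (p / s)); split => //.
have si : 0 <= s^-1 by rewrite invr_ge0 ltW.
by rewrite /db1 normrM (ger0_norm si) mulrC; apply: ler_wpM2r.
Qed.

(* [be], [abe], [dbe]: a tensor product bump and its two Wirtinger derivatives *)
Definition be p1 p2 s (z : C) : C := rc (b1 p1 s (Re z)) * rc (b1 p2 s (Im z)).
Definition abe p1 p2 s (z : C) : C :=
  rc (b1 p1 s (Re z)) * - (ii * rc (db1 p2 s (Im z) / 2)) +
  rc (db1 p1 s (Re z) / 2) * rc (b1 p2 s (Im z)).
Definition dbe p1 p2 s (z : C) : C :=
  rc (b1 p1 s (Re z)) * (ii * rc (db1 p2 s (Im z) / 2)) +
  rc (db1 p1 s (Re z) / 2) * rc (b1 p2 s (Im z)).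

Lemma Wd_be p1 p2 s z : Wd (be p1 p2 s) (abe p1 p2 s z) (dbe p1 p2 s z) z.
Proof.
exact: (Wd_mul (Wd_re (rder_b1 p1 s (Re z))) (Wd_im (rder_b1 p2 s (Im z)))).
Qed.

Lemma ccont_be p1 p2 s z :
  [/\ ccont (be p1 p2 s) z, ccont (abe p1 p2 s) z & ccont (dbe p1 p2 s) z].
Proof.
have cb := rder_rcont (rder_b1 _ _ _).
have cb1 := ccont_re (cb p1 s (Re z)); have cb2 := ccont_im (cb p2 s (Im z)).
have hf p q x : rcont (fun x => db1 p q x / 2) x.
  by apply: eq_rcont (rcont_scale 2^-1 (@rcont_db1 p q x)) => y; rewrite mulrC.
have cd1 := ccont_re (hf p1 s (Re z)); have cd2 := ccont_im (hf p2 s (Im z)).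
have cid2 := ccont_mul (ccont_cst ii z) cd2.
split; first exact: ccont_mul.
- by apply: ccont_add; apply: ccont_mul => //; exact: ccont_opp.
- by apply: ccont_add; apply: ccont_mul.
Qed.

(** Weights with which a planar bump of scale s splits into its 16 overlapping children of scale
    s/2. *)
Definition cw (q : 'I_4 * 'I_4) : C := rc (bwt q.1 / 4 * (bwt q.2 / 4)).

Lemma rc_sum_prod (f g F G : 'I_4 -> Rr) :
  rc (\sum_i f i * F i) * rc (\sum_j g j * G j) =
  \sum_(q : 'I_4 * 'I_4) rc (f q.1 * g q.2) * (rc (F q.1) * rc (G q.2)).
Proof.
rewrite -rcM big_distrlr /= pair_big /= rmorph_sum /=; apply: eq_bigr => q _.
by rewrite -!rcM; congr (rc _); ring.
Qed.

Lemma be_refine p1 p2 s z : s != 0 -> be p1 p2 s z =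
  \sum_q cw q * be (p1 + q.1%:R * (s / 2)) (p2 + q.2%:R * (s / 2)) (s / 2) z.
Proof. by move=> s0; rewrite /be 2?b1_refine // rc_sum_prod. Qed.

Lemma dbe_refine p1 p2 s z : s != 0 -> dbe p1 p2 s z =
  \sum_q cw q * dbe (p1 + q.1%:R * (s / 2)) (p2 + q.2%:R * (s / 2)) (s / 2) z.
Proof.
move=> s0; rewrite /dbe mulrCA.
have half (f F : 'I_4 -> Rr) : (\sum_i f i * F i) / 2 = \sum_i f i * (F i / 2).
  by rewrite mulr_suml; apply: eq_bigr => i _; rewrite mulrA.
rewrite !(b1_refine _ _ s0) !(db1_refine _ _ s0) !half !rc_sum_prod.
rewrite mulr_sumr -big_split /=; apply: eq_bigr => q _.
by rewrite /cw; ring.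
Qed.

Definition sqr_ p1 p2 s : set C :=
  [set z | [&& p1 <= Re z, Re z <= p1 + 3 * s, p2 <= Im z & Im z <= p2 + 3 * s]].

Lemma be_out p1 p2 s z : 0 < s -> ~ sqr_ p1 p2 s z ->
  be p1 p2 s z = 0 /\ dbe p1 p2 s z = 0.
Proof.
move=> s0 nz; rewrite /be /dbe.
have [h|h] : (Re z <= p1 \/ p1 + 3 * s <= Re z) \/ (Im z <= p2 \/ p2 + 3 * s <= Im z).
  apply: contra_notP nz => /not_orP[/not_orP[/negP h1 /negP h2] /not_orP[/negP h3 /negP h4]].
  by rewrite /sqr_ /=; rewrite -!ltNge in h1 h2 h3 h4; rewrite !ltW.
- by have [-> ->] := b1_out s0 h; rewrite !mul0r addr0.
- by have [-> ->] := b1_out s0 h; rewrite !mul0r !mulr0 addr0.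
Qed.

Lemma be_bound p1 p2 s z : 0 < s ->
  nc (be p1 p2 s z) <= 1296 /\ nc (dbe p1 p2 s z) <= 1296 / s.
Proof.
move=> s0; have [h1 h2] := b1_bound p1 (Re z) s0; have [h3 h4] := b1_bound p2 (Im z) s0.
have nii : nc ii = 1 by rewrite /= expr0n expr1n /= add0r sqrtr1.
have hh (x : Rr) : `|x| <= 36 / s -> `|x / 2| <= 18 / s.
  by move=> hx; rewrite normf_div (ger0_norm (ler0n _ 2)) ler_pdivrMr // (_ : 18 / s * 2 = 36 / s) //; field; rewrite gt_eqF.
split.
  rewrite ncM !nc_rc (_ : 1296 = 36 * 36); last by ring.
  exact: ler_pM.
apply: le_trans (nc_triangle _ _) _; rewrite !ncM nii mul1r !nc_rc.
rewrite (_ : 1296 / s = 36 * (18 / s) + (18 / s) * 36); last by field; rewrite gt_eqF.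
by apply: lerD; apply: ler_pM => //; exact: hh.
Qed.

Lemma measurable_sqr p1 p2 s : measurable (sqr_ p1 p2 s).
Proof.
have h (q : C -> mR) a b : measurable_fun setT q -> measurable [set z | (a <= q z) && (q z <= b)].
  move=> mq; rewrite (_ : [set z | _] = q @^-1` `[a, b]%classic).
    by rewrite -[X in measurable X]setTI; apply: mq => //; exact: measurable_itv.
  by apply/seteqP; split => z; rewrite /= in_itv.
rewrite (_ : sqr_ p1 p2 s = [set z | (p1 <= Re z) && (Re z <= p1 + 3 * s)] `&`
   [set z | (p2 <= Im z) && (Im z <= p2 + 3 * s)]).
  by apply: measurableI; apply: h; [exact: measurable_Re|exact: measurable_Im].
by apply/seteqP; split => z; rewrite /sqr_ /=; [move=> /and4P[-> -> -> ->]|case=> /andP[-> ->] /andP[-> ->]].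
Qed.

Lemma muC_sqr p1 p2 s : 0 <= s -> muC (sqr_ p1 p2 s) = (9 * s ^+ 2)%:E.
Proof.
move=> s0; rewrite /muC (_ : _ @^-1` _ = `[p1, p1 + 3 * s]%classic `*` `[p2, p2 + 3 * s]%classic); last first.
  apply/seteqP; split => -[x y] /=; rewrite /sqr_ /= !in_itv /=.
    by move=> /and4P[-> -> -> ->].
  by move=> [/andP[-> ->] /andP[-> ->]].
rewrite product_measure1E; [|exact: measurable_itv..].
have h (a : Rr) : leb (`[a, a + 3 * s]%classic : set mR) = (3 * s)%:E.
  rewrite lebesgue_measure_itv /= lte_fin; case: ltP => c; first by congr EFin; ring.
  by congr EFin; move: c s0; lra.
transitivity ((3 * s)%:E * (3 * s)%:E)%E; first by congr (_ * _)%E; exact: h.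
by rewrite -EFinM; congr EFin; ring.
Qed.

End bump2.

(** * Goursat's theorem by subdivision of bumps *)

Lemma nested_limit (a c : nat -> Rr) : (forall j, a j <= a j.+1) ->
  (forall j, a j.+1 + c j.+1 <= a j + c j) -> (forall j, 0 <= c j) ->
  exists l, forall k, a k <= l <= a k + c k.
Proof.
move=> ai ci c0.
have am j k : (j <= k)%N -> a j <= a k.
  by move=> /subnK <-; elim: (k - j)%N => // i IH; apply: le_trans IH (ai _).
have cm j k : (j <= k)%N -> a k + c k <= a j + c j.
  by move=> /subnK <-; elim: (k - j)%N => // i IH; apply: le_trans (ci _) IH.
have ac j k : a j <= a k + c k.
  have [jk|/ltnW kj] := leqP j k.
    by apply: le_trans (am _ _ jk) _; rewrite lerDl.
  by apply: le_trans (cm _ _ kj); rewrite lerDl.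
have hs (k : nat) : has_ubound (range a) by exists (a k + c k) => _ [j _ <-].
have ns : nonempty (range a) by exists (a 0%N), 0%N.
exists (sup (range a)) => k; apply/andP; split.
  by apply: ub_le_sup; [exact: (hs k)|exists k].
by apply: ge_sup => // _ [j _ <-].
Qed.

Lemma halving_small (s e : Rr) : 0 < s -> 0 < e -> exists k, s / 2 ^+ k < e.
Proof.
move=> s0 e0; have [k Hk] := inv_nat_small (divr_gt0 e0 s0); exists k.
rewrite mulrC -ltr_pdivlMr //; apply: le_lt_trans Hk.
rewrite lef_pV2 ?posrE ?exprn_gt0 ?ltr0n // -natrX ler_nat.
exact: ltn_expl.
Qed.

Section goursat.
Variables (g phi A B : C -> C) (rho K : Rr).
Hypotheses (rho1 : rho < 1) (phiC : C1c rho phi A B).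
Hypothesis phiK : forall z, nc (phi z) <= K /\ nc (B z) <= K.
Hypotheses (ig : cintegrable muC g) (dg : forall z, nc z < 1 -> exists c, Wd g c 0 z).

(** The conj(z)-derivative of [phi] times the bump. *)
Let D (p1 p2 s : Rr) z := B z * be p1 p2 s z + phi z * dbe p1 p2 s z.

Let phi_out z : rho <= nc z -> phi z = 0 /\ B z = 0.
Proof. by move: z; case: phiC => _ _ _ h z /h[]. Qed.

Let cphi z : ccont phi z. Proof. by case: phiC => W _ _ _; exact: Wd_ccont (W z). Qed.

Let K0 : 0 <= K. Proof. by have [h _] := phiK 0; rewrite (le_trans (nc_ge0 _) h). Qed.

Let cD (p1 p2 s : Rr) z : ccont (D p1 p2 s) z.
Proof.
case: phiC => _ _ cB _; have [c1 c2 c3] := ccont_be p1 p2 s z.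
by apply: ccont_add; apply: ccont_mul => //.
Qed.

Let D_bound (p1 p2 s : Rr) z : 0 < s -> nc (D p1 p2 s z) <= K * 1296 + K * (1296 / s).
Proof.
move=> s0; have [h1 h2] := be_bound p1 p2 z s0; have [h3 h4] := phiK z.
apply: le_trans (nc_triangle _ _) _; rewrite (ncM (B z)) (ncM (phi z)).
by apply: lerD; apply: ler_pM => //; exact: nc_ge0.
Qed.

Let D_out (p1 p2 s : Rr) z : 0 < s -> ~ sqr_ p1 p2 s z -> D p1 p2 s z = 0.
Proof. by move=> s0 h; have [e1 e2] := be_out s0 h; rewrite /D e1 e2 !mulr0 addr0. Qed.

Let iD (p1 p2 s : Rr) : 0 < s -> cintegrable muC (fun z => g z * D p1 p2 s z).
Proof.
move=> s0; have iK := integrableZl measurableT (K * 1296 + K * (1296 / s)) (cintegrable_nc ig).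
apply: (@cintegrable_le _ _ _ _ (fun z => (K * 1296 + K * (1296 / s)) * nc (g z))).
- apply: measurableC_mul; first exact: cintegrable_measurable ig.
  exact: measurable_ccont.
- exact: iK.
- by move=> z; rewrite ncM mulrC ler_wpM2r ?nc_ge0 //; exact: D_bound.
Qed.

(** Plays the role of the contour integral of g around a square of side 3s in the classical
    proof. *)
Let T (p1 p2 s : Rr) := CI muC (fun z => g z * D p1 p2 s z).

(** An affine function a + c z has zero conj(z)-derivative, so (a + c z) D is itself a
    conj(z)-derivative of a compactly supported C^1 function and integrates to 0. *)
Let affine_D (p1 p2 s : Rr) a c : C1c rho (fun z => (a + c * z) * (phi z * be p1 p2 s z))
  (fun z => (a + c * z) * (phi z * abe p1 p2 s z + A z * be p1 p2 s z) + c * (phi z * be p1 p2 s z))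
  (fun z => (a + c * z) * D p1 p2 s z).
Proof.
case: phiC => W cA cB h; split=> z.
- have Wa : Wd (fun z => a + c * z) c 0 z.
    by apply: eq_Wd (Wd_add (Wd_cst a z) (Wd_scale c (Wd_id z))); ring.
  apply: eq_Wd (Wd_mul Wa (Wd_mul (W z) (Wd_be p1 p2 s z))) => //.
  by rewrite /D; ring.
- have [c1 c2 c3] := ccont_be p1 p2 s z.
  have ca : ccont (fun z => a + c * z) z.
    by apply: ccont_add; [exact: ccont_cst|apply: ccont_mul; [exact: ccont_cst|exact: ccont_id]].
  apply: ccont_add; apply: ccont_mul => //.
  + by apply: ccont_add; exact: ccont_mul.
  + exact: ccont_cst.
  + exact: ccont_mul.
- apply: ccont_mul => //.
  by apply: ccont_add; [exact: ccont_cst|apply: ccont_mul; [exact: ccont_cst|exact: ccont_id]].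
- by rewrite /D => /h[-> -> ->]; split; ring.
Qed.

(** Affine functions do not contribute to T, so g may be replaced by its first-order error at any
    point. *)
Let T_sub (p1 p2 s : Rr) a c : 0 < s ->
  [/\ cintegrable muC (fun z => (g z - (a + c * z)) * D p1 p2 s z) &
  T p1 p2 s = CI muC (fun z => (g z - (a + c * z)) * D p1 p2 s z)].
Proof.
move=> s0; have C1 := affine_D p1 p2 s a c.
have [_ z0] := CI_dbar0 C1.
have ia : cintegrable muC (fun z => (a + c * z) * D p1 p2 s z).
  by case: C1 => _ _ cc h; apply: (cintegrable_ccont cc (M := rho)) => z /h[].
have e z : (g z - (a + c * z)) * D p1 p2 s z = g z * D p1 p2 s z - (a + c * z) * D p1 p2 s z by ring.
split; first by apply: eq_cintegrable (cintegrableB (iD p1 p2 s0) ia) => z; rewrite e.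
rewrite (eq_CI _ e) CIB //; last exact: iD.
by rewrite z0 subr0.
Qed.

Let sum_cw : \sum_q nc (cw q) = 4.
Proof.
have w0 i : 0 <= bwt i / 4.
  by apply: divr_ge0 => //; rewrite /bwt; case: i => [|[|[|[|i]]]] //=; rewrite nth_nil.
transitivity (\sum_(q : 'I_4 * 'I_4) (bwt q.1 / 4 * (bwt q.2 / 4))).
  by apply: eq_bigr => q _; rewrite /cw nc_rc ger0_norm // mulr_ge0.
have -> : \sum_(q : 'I_4 * 'I_4) (bwt q.1 / 4 * (bwt q.2 / 4)) =
  (\sum_(i < 4) bwt i / 4) * (\sum_(j < 4) bwt j / 4).
  by rewrite big_distrlr /= pair_big.
by rewrite !big_ord_recl big_ord0 /bwt /bump /=; field.
Qed.

(** T is the combination of its 16 children with weights [cw], whose moduli add up to 4; if every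
    child were below |T|/4 then |T| < |T|. As s^2 also drops by the factor 4, the ratio |T|/s^2 does
    not decrease. *)
Let T_child (p1 p2 s : Rr) : 0 < s -> exists q : 'I_4 * 'I_4,
  nc (T p1 p2 s) / 4 <= nc (T (p1 + q.1%:R * (s / 2)) (p2 + q.2%:R * (s / 2)) (s / 2)).
Proof.
move=> s0; have s20 : 0 < s / 2 by rewrite divr_gt0.
have sn0 : s != 0 by rewrite gt_eqF.
apply: contrapT => /forallNP H.
have {}H (q : 'I_4 * 'I_4) : nc (T (p1 + q.1%:R * (s / 2)) (p2 + q.2%:R * (s / 2)) (s / 2)) < nc (T p1 p2 s) / 4.
  by rewrite ltNge; apply/negP; exact: (H q).
have TE : T p1 p2 s = \sum_(q : 'I_4 * 'I_4) cw q * T (p1 + q.1%:R * (s / 2)) (p2 + q.2%:R * (s / 2)) (s / 2).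
  transitivity (CI muC (fun z => \sum_(q : 'I_4 * 'I_4) cw q * (g z * D (p1 + q.1%:R * (s / 2)) (p2 + q.2%:R * (s / 2)) (s / 2) z))).
    apply: eq_CI => z; rewrite /D (be_refine _ _ _ sn0) (dbe_refine _ _ _ sn0).
    rewrite !mulr_sumr -big_split /= mulr_sumr; apply: eq_bigr => q _.
    by move: (be _ _ _ _) (dbe _ _ _ _) (cw q) => x y c; ring.
  rewrite CI_sum => [|q]; last by apply: cintegrableZ; exact: iD.
  by apply: eq_bigr => q _; rewrite CIZ //; exact: iD.
have : nc (T p1 p2 s) < nc (T p1 p2 s).
  rewrite [X in nc X < _]TE; apply: (le_lt_trans (@nc_sum _ _ _ _)).
  rewrite [ltRHS](_ : _ = \sum_(q : 'I_4 * 'I_4) nc (cw q) * (nc (T p1 p2 s) / 4)).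
    apply: ltr_sum => [|q _].
      by apply/hasP; exists (ord0, ord0); rewrite ?mem_index_enum.
    rewrite ncM ltr_pM2l // /cw nc_rc normr_gt0.
    have w0 (i : 'I_4) : bwt i != 0.
      by case: i => [[|[|[|[|i]]]] hi] //=; rewrite /bwt /= ?oner_eq0 ?pnatr_eq0.
    by rewrite !mulf_neq0 // invr_eq0 pnatr_eq0.
  by rewrite -mulr_suml sum_cw; field.
by rewrite ltxx.
Qed.

(** If T were nonzero, choosing good children would give nested squares with |T| at least e times
    the squared scale. Near their limit point, differentiability of g makes T smaller than that. *)
Lemma goursat_bump (p1 p2 s : Rr) : 0 < s -> T p1 p2 s = 0.
Proof.
move=> s0; apply/eqP; apply: contrapT => /negP T0.
(* The scale-invariant size of T, preserved along the chosen children. *)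
pose e := nc (T p1 p2 s) / s ^+ 2.
have e0 : 0 < e by rewrite /e divr_gt0 ?nc_gt0 // exprn_gt0.
pose sc k := s / 2 ^+ k.
have sc0 k : 0 < sc k by rewrite /sc divr_gt0 // exprn_gt0.
have scS k : sc k.+1 = sc k / 2 by rewrite /sc exprS invfM; ring.
pose P k (p : Rr * Rr) := e * sc k ^+ 2 <= nc (T p.1 p.2 (sc k)).
have /choice[f Hf] : forall kp : nat * (Rr * Rr), exists p' : Rr * Rr, P kp.1 kp.2 ->
    [/\ P kp.1.+1 p', kp.2.1 <= p'.1 <= kp.2.1 + 3 * sc kp.1.+1
      & kp.2.2 <= p'.2 <= kp.2.2 + 3 * sc kp.1.+1].
  move=> [k p]; have [[i j] /= Hq] := T_child p.1 p.2 (sc0 k).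
  exists (p.1 + i%:R * (sc k / 2), p.2 + j%:R * (sc k / 2)) => /= Pk.
  have h (i0 : 'I_4) x : x <= x + i0%:R * (sc k / 2) <= x + 3 * (sc k / 2).
    have sk : 0 <= sc k / 2 by rewrite divr_ge0 // ltW.
    by rewrite lerDl mulr_ge0 //= lerD2l ler_wpM2r // ler_nat -ltnS.
  rewrite scS /P /= scS; split; [|exact: h|exact: h].
  apply: le_trans Hq; rewrite ler_pdivlMr //; apply: le_trans Pk.
  by rewrite le_eqVlt; apply/orP; left; apply/eqP; field.
pose st := fix st k := if k is k'.+1 then f (k', st k') else (p1, p2).
have Pst k : P k (st k).
  elim: k => [|k IH]; first by rewrite /P /= /sc expr0 divr1 /e divfK // gt_eqF // exprn_gt0.
  by have [] := Hf (k, st k) IH.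
have St k := Hf (k, st k) (Pst k).
have [l1 Hl1] : exists l, forall k, (st k).1 <= l <= (st k).1 + 3 * sc k.
  apply: nested_limit => k; have [_ /andP[h1 h2] _] := St k => //.
  - by move: h2; rewrite /= scS; lra.
  - by rewrite mulr_ge0 // ltW.
have [l2 Hl2] : exists l, forall k, (st k).2 <= l <= (st k).2 + 3 * sc k.
  apply: nested_limit => k; have [_ _ /andP[h1 h2]] := St k => //.
  - by move: h2; rewrite /= scS; lra.
  - by rewrite mulr_ge0 // ltW.
pose z0 := complex.Complex l1 l2.
(* The squares have side 3 [sc k]; the modulus is bounded by the sum of the two coordinate
   differences. *)
have near k z : sqr_ (st k).1 (st k).2 (sc k) z -> nc (z - z0) <= 6 * sc k.
  rewrite /sqr_ /= => /and4P[h1 h2 h3 h4].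
  apply: le_trans (nc_le_ReIm _) _; rewrite ReB ImB /=.
  have /andP[u1 u2] := Hl1 k; have /andP[u3 u4] := Hl2 k.
  rewrite (_ : 6 * sc k = 3 * sc k + 3 * sc k); last by ring.
  by apply: lerD; rewrite ler_norml; move: h1 h2 h3 h4 u1 u2 u3 u4; 
    move: (st k).1 (st k).2 (sc k) (Re z) (Im z) => *; lra.
(* If the limit point is outside the disc, a small square misses the support of [phi] and T is 0
   there. The choice below gives 6 [sc k] < 1 - [rho]. *)
have [z01|z01] := leP 1 (nc z0).
  have r1 : 0 < (1 - rho) / 6 by rewrite divr_gt0 // subr_gt0.
  have [k Hk] := halving_small s0 r1.
  have : T (st k).1 (st k).2 (sc k) = 0.
    rewrite /T -[RHS](CI0 muC); apply: eq_CI => z.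
    have [h|h] := pselect (sqr_ (st k).1 (st k).2 (sc k) z); last first.
      by rewrite D_out ?mulr0.
    rewrite /D; have [-> ->] : phi z = 0 /\ B z = 0; last by rewrite !mul0r addr0 mulr0.
    apply: phi_out; have := near _ _ h; have := nc_dist z z0.
    by rewrite ler_norml => /andP[+ _]; rewrite -/(sc k) in Hk; move: Hk z01; 
      move: (nc z) (nc z0) (nc (z - z0)) (sc k) => *; lra.
  move=> Tk0; have := Pst k; rewrite /P Tk0 nc0 leNgt => /negP; apply.
  by rewrite mulr_gt0 // exprn_gt0.
have [c Wc] := dg z01.
(* 2 from [CI_le], 6 from the distance to the limit point, 2592 = 2 * 1296 from the bound on D, 9
   from the area of the square. *)
have [N NE] : exists N : Rr, N = 2 * 6 * 2592 * 9 by eexists.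
have NN : 0 <= N by rewrite NE; exact: mulr_ge0 (mulr_ge0 (mulr_ge0 (ler0n _ 2) (ler0n _ 6)) (ler0n _ 2592)) (ler0n _ 9).
have N0 : 0 < N * K + 1 by rewrite ltr_wpDl // mulr_ge0.
pose eta := e / (N * K + 1).
have eta0 : 0 < eta by rewrite /eta divr_gt0.
have [de de0 Hde] := Wc _ eta0.
(* The bound by [de / 6] puts the square inside the disc of differentiability; the bound by 1 lets
   1296 be absorbed in 1296 / [sc k]. *)
have m0 : 0 < Num.min (de / 6) 1 by rewrite lt_min divr_gt0 //= ltr01.
have [k] := halving_small s0 m0; rewrite lt_min => /andP[k1 /ltW k2].
rewrite -/(sc k) in k1 k2.
have [iT TE] := T_sub (st k).1 (st k).2 (g z0 - c * z0) c (sc0 k).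
have [Z ZE] : exists Z : Rr, Z = 2592 * K / sc k by eexists.
have D2 z : nc (D (st k).1 (st k).2 (sc k) z) <= Z.
  apply: le_trans (D_bound _ _ z (sc0 k)) _.
  rewrite ZE (_ : 2592 * K / sc k = K * (1296 / sc k) + K * (1296 / sc k)); last by field; rewrite gt_eqF.
  apply: lerD; last exact: lexx.
  apply: (ler_wpM2l K0); rewrite (ler_pdivlMr _ _ (sc0 k)).
  exact: (ler_piMr (ler0n _ 1296) k2).
have bnd z : nc ((g z - (g z0 - c * z0 + c * z)) * D (st k).1 (st k).2 (sc k) z) <=
    (eta * (6 * sc k) * Z) * \1_(sqr_ (st k).1 (st k).2 (sc k)) z.
  rewrite indicE; have [h|h] := pselect (sqr_ (st k).1 (st k).2 (sc k) z); last first.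
    by rewrite D_out // mulr0 nc0 memNset // mulr0.
  rewrite mem_set // mulr1 ncM; have nz := near _ _ h.
  apply: ler_pM; rewrite ?nc_ge0 //.
  have := Hde (z - z0); rewrite [z0 + _]addrC subrK mul0r subr0.
  move=> H; rewrite (_ : g z - _ = g z - g z0 - c * (z - z0)); last by ring.
  apply: le_trans (H _) _.
    by apply: le_lt_trans nz _; move: k1; move: (sc k) => *; lra.
  by rewrite ler_wpM2l // ltW.
have mS := measurable_sqr (st k).1 (st k).2 (sc k).
have mu_S := muC_sqr (st k).1 (st k).2 (ltW (sc0 k)).
have iS : muC.-integrable setT (EFin \o (\1_(sqr_ (st k).1 (st k).2 (sc k)) : C -> Rr)).
  apply/integrableP; split; first by apply/measurable_EFinP; exact: measurable_indic mS.
  rewrite (_ : (\int[muC]_x _ = \int[muC]_x (\1_(sqr_ (st k).1 (st k).2 (sc k)) x)%:E)%E).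
    by rewrite integral_indic // setIT [X in (X < _)%E]mu_S ltry.
  by apply: eq_integral => x _ /=; rewrite ger0_norm.
have intS : (\int[muC]_z \1_(sqr_ (st k).1 (st k).2 (sc k)) z)%R = 9 * sc k ^+ 2.
  by rewrite /Rintegral integral_indic // setIT [X in fine X]mu_S.
set cst1 := eta * (6 * sc k) * Z in bnd.
have iS2 : muC.-integrable setT (EFin \o (fun z => cst1 * \1_(sqr_ (st k).1 (st k).2 (sc k)) z)).
  by apply: eq_integrable (integrableZl measurableT cst1 iS).
have := CI_le iT iS2 bnd; rewrite -TE RintegralZl // intS => Tle.
have := le_trans (Pst k) Tle; rewrite leNgt => /negP; apply.
rewrite /cst1 ZE (_ : 2 * _ = N * K * eta * sc k ^+ 2); last by rewrite NE; field; rewrite gt_eqF.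
rewrite ltr_pM2r ?exprn_gt0 // /eta mulrA ltr_pdivrMr // mulrC ltr_pM2l //.
by rewrite ltrDl.
Qed.

End goursat.

Lemma bsp_gt0 t : 1 <= t <= 2 -> 0 < bsp t.
Proof.
move=> /andP[t1 t2]; rewrite /bsp /sqp (@pos_ge0 (1 * t + - 0%:R)); last by lra.
rewrite (@pos_ge0 (1 * t + - 1%:R)); last by lra.
rewrite (@pos_le0 (1 * t + - 2%:R)); last by lra.
rewrite (@pos_le0 (1 * t + - 3%:R)); last by lra.
by nra.
Qed.

(** For |x| <= 1 the rescaled argument (x + 3)/2 lies in [1, 2], where the spline is positive: this
    bump has no zero on the closed unit disc. *)
Lemma be_neq0 z : nc z <= 1 -> be (-3) (-3) 2 z != 0.
Proof.
move=> z1; have h (x : Rr) : `|x| <= 1 -> b1 (-3) 2 x != 0.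
  by rewrite ler_norml => /andP[h1 h2]; apply: lt0r_neq0; apply: bsp_gt0; lra.
have rc0 (x : Rr) : x != 0 -> rc x != 0 by rewrite -nc_eq0 nc_rc normr_eq0.
rewrite /be mulf_neq0 // rc0 // h //.
  exact: le_trans (Re_le_nc z) z1.
exact: le_trans (Im_le_nc z) z1.
Qed.

(** Regularity has to be checked only on a disc slightly larger than the support, since near any
    other point f vanishes identically. This allows divisions legitimate only inside the unit
    disc. *)
Lemma C1c_local (M rho : Rr) (f A B : C -> C) : rho < M ->
  (forall z, nc z < M -> [/\ Wd f (A z) (B z) z, ccont A z & ccont B z]) ->
  (forall z, rho <= nc z -> [/\ f z = 0, A z = 0 & B z = 0]) ->
  C1c rho f A B.
Proof.
move=> rM H f0.
have far z : M <= nc z -> forall w, nc (w - z) < M - rho -> rho <= nc w.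
  move=> Mz w wz; have := nc_dist w z; rewrite ler_norml => /andP[h _].
  by move: wz Mz h; move: (nc w) (nc z) (nc (w - z)) => *; lra.
have d0 : 0 < M - rho by rewrite subr_gt0.
split => // z; have [Mz|zM] := leP M (nc z); try by case: (H z zM).
- have [_ -> ->] := f0 z (le_trans (ltW rM) Mz).
  by apply: (Wd_near d0 _ (Wd_cst 0 z)) => w /(far z Mz)/f0[].
- by apply: (ccont_near d0 _ (ccont_cst 0 z)) => w /(far z Mz)/f0[].
- by apply: (ccont_near d0 _ (ccont_cst 0 z)) => w /(far z Mz)/f0[].
Qed.

(** Cauchy's theorem in weak form: g is orthogonal to conj(z)-derivatives of test functions on the
    disc. It follows from the bump version by dividing [phi] by one large bump without zeros on the
    disc. *)
Theorem goursat (g phi A B : C -> C) (rho : Rr) : rho < 1 -> C1c rho phi A B ->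
  cintegrable muC g -> (forall z, nc z < 1 -> exists c, Wd g c 0 z) ->
  CI muC (fun z => g z * B z) = 0.
Proof.
move=> rho1 phiC ig dg; have [W cA cB f0] := phiC.
pose b := be (-3) (-3) 2; pose ab := abe (-3) (-3) 2; pose db := dbe (-3) (-3) 2.
pose psi z := phi z * (b z)^-1.
pose psA z := phi z * (- ab z / b z ^+ 2) + A z * (b z)^-1.
pose psB z := phi z * (- db z / b z ^+ 2) + B z * (b z)^-1.
have psC : C1c rho psi psA psB.
  apply: (C1c_local rho1) => z hz; last first.
    by rewrite /psi /psA /psB; have [-> -> ->] := f0 z hz; split; rewrite ?mul0r ?addr0.
  have bz := be_neq0 (ltW hz); have [c1 c2 c3] := ccont_be (-3) (-3) 2 z.
  have ci := ccont_inv bz c1.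
  have ci2 : ccont (fun z => (b z ^+ 2)^-1) z.
    by apply: ccont_inv; [rewrite expf_neq0|exact: ccont_exp].
  have cp := Wd_ccont (W z).
  split.
  - exact: Wd_mul (W z) (Wd_inv bz (Wd_be _ _ _ z)).
  - by apply: ccont_add; apply: ccont_mul => //; apply: ccont_mul => //; exact: ccont_opp.
  - by apply: ccont_add; apply: ccont_mul => //; apply: ccont_mul => //; exact: ccont_opp.
have [_ _ cpB pout] := psC; have cps z : ccont psi z by case: psC => Wp _ _ _; exact: Wd_ccont (Wp z).
have [K1 HK1] : exists K, forall z, nc (psi z) <= K.
  by apply: (ccont_cpt_bounded cps (M := rho)) => z /pout[].
have [K2 HK2] : exists K, forall z, nc (psB z) <= K.
  by apply: (ccont_cpt_bounded cpB (M := rho)) => z /pout[].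
have psK z : nc (psi z) <= Num.max K1 K2 /\ nc (psB z) <= Num.max K1 K2.
  by rewrite !le_max HK1 HK2 orbT.
rewrite -(goursat_bump rho1 psC psK ig dg (-3) (-3) (s := 2)) //.
apply: eq_CI => z; congr (_ * _); rewrite -/b -/db /psB /psi.
have [z1|z1] := ltP (nc z) 1.
  by have bz := be_neq0 (ltW z1); rewrite -/b in bz; field.
by have [-> _ ->] := f0 z (le_trans (ltW rho1) z1); rewrite !(mul0r, addr0).
Qed.

(** * Image of a measure with a density *)

Section density_pushforward.
Local Open Scope ereal_scope.
Import HBNNSimple.
Context d1 d2 (T : measurableType d1) (U : measurableType d2).
Variables (mu : {measure set T -> \bar Rr}) (w : T -> Rr) (phi : T -> U).
Hypotheses (mw : measurable_fun setT (EFin \o w)) (w0 : forall t, (0 <= w t)%R).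
Hypothesis mphi : measurable_fun setT phi.

Definition dpush (A : set U) : \bar Rr := \int[mu]_(t in phi @^-1` A) (w t)%:E.

Let mpre A : measurable A -> measurable (phi @^-1` A).
Proof. by move=> mA; rewrite -[X in measurable X]setTI; exact: mphi. Qed.

Let dpush0 : dpush set0 = 0.
Proof. by rewrite /dpush preimage_set0 integral_set0. Qed.

Let dpush_ge0 A : 0 <= dpush A. Proof. by apply: integral_ge0 => t _; rewrite lee_fin. Qed.

Let dpush_sigma_additive : semi_sigma_additive dpush.
Proof.
move=> F mF tF mUF; rewrite /dpush preimage_bigcup.
have w0' t : 0 <= (EFin \o w) t by rewrite lee_fin.
have mF' n : measurable (phi @^-1` (F n)) by exact: mpre.
have tF' : trivIset setT (fun n => phi @^-1` F n).
  apply/trivIsetP => /= i j _ _ ij; rewrite -preimage_setI.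
  by move/trivIsetP : tF => /(_ _ _ _ _ ij) ->//; rewrite preimage_set0.
have mUF' : measurable (\bigcup_n (phi @^-1` (F n))).
  by rewrite -preimage_bigcup; exact: mpre.
have := @semi_sigma_additive_nng_induced _ _ _ mu _ mw w0' _ mF' tF' mUF'.
exact.
Qed.

HB.instance Definition _ := isMeasure.Build _ _ _ dpush
  dpush0 dpush_ge0 dpush_sigma_additive.

Definition dpush_measure : {measure set U -> \bar Rr} := dpush.

Lemma integral_dpush_indic A : measurable A ->
  dpush A = \int[mu]_t ((\1_A (phi t))%:E * (w t)%:E).
Proof.
move=> mA; rewrite /dpush integral_mkcond; apply: eq_integral => t _.
rewrite /patch indicE; have [h|h] := pselect (A (phi t)).
  by rewrite !mem_set // mul1e.
by rewrite !memNset // mul0e.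
Qed.

(** Holds for indicators by definition, for simple functions by linearity, and in general by
    monotone convergence. *)
Lemma integral_dpush (F : U -> \bar Rr) : measurable_fun setT F ->
  (forall u, 0 <= F u) ->
  \int[dpush]_u F u = \int[mu]_t (F (phi t) * (w t)%:E).
Proof.
move=> mF F0; pose f_ := nnsfun_approx measurableT mF.
have cf u : (fun n => (f_ n u)%:E) @ \oo --> F u by apply: cvg_nnsfun_approx.
have nd u m n : (m <= n)%N -> (f_ m u)%:E <= (f_ n u)%:E.
  by move=> mn; rewrite lee_fin; exact/lefP/nd_nnsfun_approx.
transitivity (limn (fun n => \int[dpush]_u (f_ n u)%:E)).
  rewrite -monotone_convergence//.
  - by apply: eq_integral => u _; apply/esym/cvg_lim => //; exact: cf.
  - by move=> n; exact/measurable_EFinP/measurable_funP.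
  - by move=> n u _; rewrite lee_fin.
  - by move=> u _ m n; exact: nd.
have mfw n : measurable_fun setT (fun t => (f_ n (phi t))%:E * (w t)%:E).
  apply: emeasurable_funM => //; apply/measurable_EFinP.
  by apply: measurableT_comp => //; exact: measurable_funP.
rewrite [X in limn X](_ : _ = (fun n => \int[mu]_t ((f_ n (phi t))%:E * (w t)%:E))).
  rewrite -monotone_convergence//.
  - apply: eq_integral => t _; apply/cvg_lim => //.
    by apply: cvgeZr => //; exact: cf.
  - by move=> n t _; rewrite mule_ge0 // lee_fin.
  - by move=> t _ m n mn; rewrite lee_wpmul2r ?lee_fin //; exact: nd.
apply/funext => n; set h := f_ n.
have mh k : measurable (h @^-1` [set k]) by [].
have fr : finite_set (range h) by exact: fimfunP.
have mind k : measurable_fun setT (fun t => (\1_(h @^-1` [set k]) (phi t))%:E * (w t)%:E).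
  apply: emeasurable_funM => //; apply/measurable_EFinP.
  by apply: (measurableT_comp (measurable_indic _)).
transitivity (\sum_(k \in range h) (k%:E * dpush (h @^-1` [set k]))).
  rewrite (eq_integral (fun u => \sum_(k \in range h) (k%:E * (\1_(h @^-1` [set k]) u)%:E))).
    rewrite ge0_integral_fsum //.
    - apply: eq_fsbigr => k /[!inE] -[u _ <-].
      rewrite ge0_integralZl ?lee_fin //; last first.
        by apply/measurable_EFinP; exact: measurable_indic.
      by rewrite integral_indic // setIT.
    - move=> k; apply: measurable_funeM; apply/measurable_EFinP; exact: measurable_indic.
    - move=> k u _; exact: nnfun_muleindic_ge0.
  move=> u _; rewrite fimfunE -fsumEFin //.
rewrite [RHS](eq_integral (fun t => \sum_(k \in range h) (k%:E * ((\1_(h @^-1` [set k]) (phi t))%:E * (w t)%:E)))).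
  rewrite ge0_integral_fsum //.
  - apply: eq_fsbigr => k /[!inE] -[u _ <-].
    rewrite integral_dpush_indic // -ge0_integralZl ?lee_fin //.
    by move=> t _; rewrite mule_ge0 ?lee_fin.
  - by move=> k; apply: measurable_funeM.
  - move=> k t _; rewrite muleA; apply: mule_ge0; last by rewrite lee_fin.
    exact: nnfun_muleindic_ge0.
move=> t _; rewrite [in LHS]fimfunE -fsumEFin // ge0_mule_fsuml.
  by apply: eq_fsbigr => k _; rewrite EFinM muleA.
move=> k; exact: nnfun_muleindic_ge0.
Qed.

End density_pushforward.

(** * Planar Lebesgue measure is determined by half-open boxes *)

Section box_uniqueness.

Definition cboxo (a b c d : Rr) : set C :=
  [set z | (a < Re z <= b) && (c < Im z <= d)].

Definition cboxes : set (set C) :=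
  [set A | exists q : Rr * Rr * Rr * Rr, A = cboxo q.1.1.1 q.1.1.2 q.1.2 q.2].

Lemma cboxo_preim a b c d : pairc @^-1` (cboxo a b c d) = `]a, b]%classic `*` `]c, d]%classic.
Proof.
apply/seteqP; split => -[x y] /=; rewrite /cboxo /= !in_itv /=.
  by move=> /andP[].
by move=> [-> ->].
Qed.

Lemma measurable_cboxo a b c d : measurable (cboxo a b c d).
Proof.
rewrite (_ : cboxo a b c d = cpair @^-1` (pairc @^-1` cboxo a b c d)).
  rewrite cboxo_preim -[X in measurable X]setTI; apply: measurable_cpair => //.
  by apply: measurableX; exact: measurable_itv.
by apply/seteqP; split => -[].
Qed.

Lemma muC_cboxo a b c d : a <= b -> c <= d ->
  muC (cboxo a b c d) = ((b - a) * (d - c))%:E.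
Proof.
move=> ab cd; rewrite /muC cboxo_preim product_measure1E; [|exact: measurable_itv..].
have h (x y : Rr) : x <= y -> leb (`]x, y]%classic : set mR) = (y - x)%:E.
  move=> xy; rewrite lebesgue_measure_itv /= lte_fin; case: ltP => // yx.
  by rewrite (_ : y - x = 0) //; apply: le_anti; rewrite subr_le0 subr_ge0 yx xy.
by transitivity ((b - a)%:E * (d - c)%:E)%E; first by congr (_ * _)%E; exact: h.
Qed.

Lemma real_bound (x : Rr) : exists n : nat, - n%:R < x <= n%:R.
Proof.
have h := archi_boundP (normr_ge0 x); exists (Num.bound `|x|).
by move: h; rewrite ltr_norml => /andP[-> /ltW ->].
Qed.

Lemma cboxes_cover : \bigcup_n (cboxo (- n%:R) n%:R (- n%:R) n%:R) = setT.
Proof.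
apply/seteqP; split => // z _.
have [n /andP[n1 n2]] := real_bound (Re z); have [m /andP[m1 m2]] := real_bound (Im z).
exists (maxn n m) => //; rewrite /cboxo /=.
have nm : n%:R <= (maxn n m)%:R :> Rr by rewrite ler_nat leq_maxl.
have mm : m%:R <= (maxn n m)%:R :> Rr by rewrite ler_nat leq_maxr.
apply/andP; split; apply/andP; split.
- by apply: le_lt_trans n1; rewrite lerN2.
- exact: le_trans nm.
- by apply: le_lt_trans m1; rewrite lerN2.
- exact: le_trans mm.
Qed.

Lemma sigma_cboxes : (measurable : set (set C)) = <<s cboxes >>.
Proof.
have s1 := smallest_sigma_algebra setT cboxes.
have [S0 SC SU] := s1.
apply/seteqP; split; last first.
  apply: smallest_sub; first exact: sigma_algebra_measurable.
  by move=> _ [q ->]; exact: measurable_cboxo.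
have setC_of A : <<s cboxes >> A -> <<s cboxes >> (~` A) by move=> /SC; rewrite setTD.
have half (p : C -> mR) : (forall a b, <<s cboxes >> (p @^-1` `]a, b]%classic)) ->
    forall A : set mR, measurable A -> <<s cboxes >> (p @^-1` A).
  move=> hp; apply: smallest_sub.
    split; first by rewrite /= preimage_set0.
    + by move=> A hA /=; rewrite setTD preimage_setC; exact: setC_of.
    + by move=> F hF /=; rewrite preimage_bigcup; exact: SU.
  by move=> _ [[a b] _ <-] /=; exact: hp.
move=> _ [B mB <-]; rewrite setTI.
suff : (measurable : set (set (mR * mR))) `<=` [set B | <<s cboxes >> (cpair @^-1` B)] by apply.
apply: smallest_sub.
  split; first by rewrite /= preimage_set0.
  + by move=> A hA /=; rewrite setTD preimage_setC; exact: setC_of.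
  + by move=> F hF /=; rewrite preimage_bigcup; exact: SU.
move=> _ [|] [A mA <-]; rewrite setTI /=.
- apply: (half (fun z => Re z)) mA => a b.
  rewrite (_ : _ @^-1` _ = \bigcup_n cboxo a b (- n%:R) n%:R).
    by apply: SU => n; apply: sub_sigma_algebra; exists (a, b, - n%:R, n%:R).
  apply/seteqP; split => z /=; rewrite in_itv /=.
    by move=> abz; have [n hn] := real_bound (Im z); exists n => //; rewrite /cboxo /= abz.
  by move=> [n _]; rewrite /cboxo /= => /andP[].
- apply: (half (fun z => Im z)) mA => a b.
  rewrite (_ : _ @^-1` _ = \bigcup_n cboxo (- n%:R) n%:R a b).
    by apply: SU => n; apply: sub_sigma_algebra; exists (- n%:R, n%:R, a, b).
  apply/seteqP; split => z /=; rewrite in_itv /=.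
    by move=> abz; have [n hn] := real_bound (Re z); exists n => //; rewrite /cboxo /= abz hn.
  by move=> [n _]; rewrite /cboxo /= => /andP[].
Qed.

Lemma cboxes_setI : setI_closed cboxes.
Proof.
move=> _ _ [q ->] [r ->].
exists (Num.max q.1.1.1 r.1.1.1, Num.min q.1.1.2 r.1.1.2,
  Num.max q.1.2 r.1.2, Num.min q.2 r.2).
apply/seteqP; split => z; rewrite /cboxo /= !gt_max !le_min.
  by move=> [/andP[/andP[-> ->] /andP[-> ->]] /andP[/andP[-> ->] /andP[-> ->]]].
by move=> /andP[/andP[/andP[-> ->] /andP[-> ->]] /andP[/andP[-> ->] /andP[-> ->]]].
Qed.

(** Half-open boxes are closed under intersection, generate the sigma-algebra and exhaust the plane
    by sets of finite mass, so uniqueness of measures applies. *)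
Lemma muC_unique (m : {measure set C -> \bar Rr}) (c : Rr) : 0 <= c ->
  (forall a b a' b', a < b -> a' < b' ->
     m (cboxo a b a' b') = (c * ((b - a) * (b' - a')))%:E) ->
  forall A, measurable A -> m A = (c%:E * muC A)%E.
Proof.
move=> c0 mbox A mA.
have empty a b a' b' : ~ (a < b /\ a' < b') -> cboxo a b a' b' = set0.
  move=> h; apply/seteqP; split => // z; rewrite /cboxo /= => /andP[/andP[h1 h2] /andP[h3 h4]].
  by apply: h; split; [exact: lt_le_trans h2|exact: lt_le_trans h4].
apply: (measure_unique cboxes (fun n => cboxo (- n%:R) n%:R (- n%:R) n%:R) _ _ _ _ m (mscale (NngNum c0) muC)) => //.
- exact: sigma_cboxes.
- exact: cboxes_setI.
- by move=> n; exists (- n%:R, n%:R, - n%:R, n%:R).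
- exact: cboxes_cover.
- move=> _ [[[[a b] a'] b'] ->] /=.
  have [[ab a'b']|n] := pselect (a < b /\ a' < b').
    by rewrite mbox // /mscale /= muC_cboxo ?ltW.
  by rewrite empty // !measure0.
- move=> n; have [h|h] := ltP (- n%:R : Rr) n%:R; first by rewrite mbox // ltry.
  by rewrite empty ?measure0 // => -[]; rewrite ltNge h.
Qed.

End box_uniqueness.

(** * C^1 approximations of indicators of intervals *)

Section step.
Implicit Types (t x a b : Rr).

Lemma rder_mul u v (a c x : Rr) : rder u a x -> rder v c x ->
  rder (fun x => u x * v x) (u x * c + v x * a) x.
Proof.
move=> du dv e e0.
have cv := rder_rcont dv.

have e30 : 0 < e / 3 by rewrite divr_gt0.
have [d1 d10 H1] := rder_scale (u x) dv e30.
have [d2 d20 H2] := rder_scale (v x) du e30.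
have [d3 d30 H3] := du 1 ltr01.
have a0 : 0 < 1 + `|a| by rewrite ltr_pwDl.
have e40 : 0 < e / 3 / (1 + `|a|) by rewrite divr_gt0.
have [d4 d40 H4] := cv _ e40.
exists (Num.min (Num.min d1 d2) (Num.min d3 d4)); first by rewrite !lt_min d10 d20 d30 d40.
move=> t; rewrite !lt_min => /andP[/andP[/H1 h1 /H2 h2] /andP[/H3 h3 t4]].
have h4 : `|v (x + t) - v x| <= e / 3 / (1 + `|a|) by apply: H4; rewrite [x + t]addrC addrK.
have h5 : `|u (x + t) - u x| <= (1 + `|a|) * `|t|.
  rewrite (_ : u (x + t) - u x = (u (x + t) - u x - a * t) + a * t); last by ring.
  apply: le_trans (ler_normD _ _) _; rewrite mulrDl normrM mul1r.
  by rewrite lerD2r; rewrite mul1r in h3.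
have h6 : `|(u (x + t) - u x) * (v (x + t) - v x)| <= e / 3 * `|t|.
  rewrite normrM; apply: le_trans (ler_pM _ _ h5 h4) _ => //.
  by rewrite mulrC mulrA divfK // gt_eqF.
rewrite (_ : _ - _ = (u x * v (x + t) - u x * v x - u x * c * t) +
  (v x * u (x + t) - v x * u x - v x * a * t) + (u (x + t) - u x) * (v (x + t) - v x)); last by ring.
apply: le_trans (ler_normD _ _) _; apply: le_trans (lerD (ler_normD _ _) (lexx _)) _.
rewrite [leRHS](_ : _ = e / 3 * `|t| + e / 3 * `|t| + e / 3 * `|t|); last by field.
by apply: lerD => //; apply: lerD.
Qed.

Lemma rder_id x : rder id 1 x.
Proof.
move=> e e0; exists 1 => // t _; rewrite (_ : _ - _ = 0); last by ring.
by rewrite normr0 mulr_ge0 // ltW.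
Qed.

Definition cub x := x * sqp x.

Lemma rder_cub x : rder cub (3 * sqp x) x.
Proof.
apply: eq_rder (rder_mul (rder_id x) (rder_sqp x)) => //.
have xp : x * pos x = sqp x.
  rewrite /sqp; have [x0|/ltW x0] := leP x 0; first by rewrite pos_le0 // mulr0 expr0n.
  by rewrite pos_ge0.
by rewrite mulr1 mulrCA xp; ring.
Qed.

Lemma rcont_sqp x : rcont sqp x. Proof. exact: rder_rcont (rder_sqp x). Qed.

(** A piecewise quadratic C^1 step rising from 0 to 1 over [0, 1]; [dstp] is its derivative and
    [istp] its primitive. *)
Definition stp t := 2 * sqp (1 * t + 0) + - 4 * sqp (1 * t + - 2^-1) + 2 * sqp (1 * t + - 1).
Definition dstp t := 4 * pos (1 * t + 0) + - 8 * pos (1 * t + - 2^-1) + 4 * pos (1 * t + - 1).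
Definition istp t := 2 / 3 * cub (1 * t + 0) + - 4 / 3 * cub (1 * t + - 2^-1) + 2 / 3 * cub (1 * t + - 1).

Lemma rder_stp t : rder stp (dstp t) t.
Proof.
have d c := rder_affine (rder_sqp (1 * t + c)).
apply: eq_rder (rder_add (rder_add (rder_scale 2 (d 0)) (rder_scale (- 4) (d (- 2^-1)))) (rder_scale 2 (d (- 1)))) => //.
by rewrite /dstp; ring.
Qed.

Lemma rcont_dstp t : rcont dstp t.
Proof.
have d c := rcont_affine (@rcont_pos (1 * t + c)).
exact: (rcont_add (rcont_add (rcont_scale 4 (d 0)) (rcont_scale (- 8) (d (- 2^-1)))) (rcont_scale 4 (d (- 1)))).
Qed.

Lemma rder_istp t : rder istp (stp t) t.
Proof.
have d c := rder_affine (rder_cub (1 * t + c)).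
apply: eq_rder (rder_add (rder_add (rder_scale (2 / 3) (d 0)) (rder_scale (- 4 / 3) (d (- 2^-1)))) (rder_scale (2 / 3) (d (- 1)))) => //.
by rewrite /stp; field.
Qed.

Lemma stp_le0 t : t <= 0 -> [/\ stp t = 0, dstp t = 0 & istp t = 0].
Proof.
move=> t0; rewrite /stp /dstp /istp /cub /sqp (@pos_le0 (1 * t + 0)); last by lra.
rewrite (@pos_le0 (1 * t + - 2^-1)); last by lra.
rewrite (@pos_le0 (1 * t + - 1)); last by lra.
by split; ring.
Qed.

Lemma stp_ge1 t : 1 <= t -> [/\ stp t = 1, dstp t = 0 & istp t = t - 2^-1].
Proof.
move=> t0; rewrite /stp /dstp /istp /cub /sqp (@pos_ge0 (1 * t + 0)); last by lra.
rewrite (@pos_ge0 (1 * t + - 2^-1)); last by lra.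
rewrite (@pos_ge0 (1 * t + - 1)); last by lra.
by split; field.
Qed.

Lemma stp_bound t : 0 <= stp t <= 1 /\ 0 <= dstp t <= 2.
Proof.
have [h|h] := leP t 0.
  by have [-> -> _] := stp_le0 h; split; lra.
have [h'|h'] := leP 1 t.
  by have [-> -> _] := stp_ge1 h'; split; lra.
rewrite /stp /dstp /sqp (@pos_ge0 (1 * t + 0)); last by lra.
rewrite (@pos_le0 (1 * t + - 1)); last by lra.
have [k|k] := leP t 2^-1.
  rewrite (@pos_le0 (1 * t + - 2^-1)); last by lra.
  by split; apply/andP; split; nra.
rewrite (@pos_ge0 (1 * t + - 2^-1)); last by lra.
by split; apply/andP; split; nra.
Qed.

(* smooth approximation of the indicator of ]a, b], its primitive and its derivative *)
Definition smi a b eta x := stp (eta^-1 * x + - (a / eta)) + - 1 * stp (eta^-1 * x + - (b / eta)).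
Definition dsmi a b eta x := eta^-1 * dstp (eta^-1 * x + - (a / eta)) +
  - 1 * (eta^-1 * dstp (eta^-1 * x + - (b / eta))).
Definition ismi a b eta x := eta * istp (eta^-1 * x + - (a / eta)) +
  - eta * istp (eta^-1 * x + - (b / eta)).

Lemma rder_smi a b eta x : rder (smi a b eta) (dsmi a b eta x) x.
Proof.
by apply: rder_add; [|apply: rder_scale]; apply: rder_affine; exact: rder_stp.
Qed.

Lemma rcont_dsmi a b eta x : rcont (dsmi a b eta) x.
Proof.
by apply: rcont_add; [|apply: rcont_scale]; apply: rcont_scale; apply: rcont_affine; exact: rcont_dstp.
Qed.

Lemma rder_ismi a b (eta : Rr) x : eta != 0 -> rder (ismi a b eta) (smi a b eta x) x.
Proof.
move=> e0; have d c := rder_affine (k := eta^-1) (rder_istp (eta^-1 * x + c)).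
apply: eq_rder (rder_add (rder_scale eta (d _)) (rder_scale (- eta) (d _))) => //.
by rewrite /smi; field.
Qed.

Let argle (eta a x : Rr) : 0 < eta -> x <= a -> eta^-1 * x + - (a / eta) <= 0.
Proof. by move=> e0 h; rewrite mulrC -mulrBl pmulr_lle0 ?invr_gt0 // subr_le0. Qed.

Let argge (eta a x : Rr) : 0 < eta -> a + eta <= x -> 1 <= eta^-1 * x + - (a / eta).
Proof. by move=> e0 h; rewrite mulrC -mulrBl ler_pdivlMr // mul1r lerBrDl. Qed.

Lemma smi_out a b (eta : Rr) x : 0 < eta -> a <= b -> x <= a \/ b + eta <= x ->
  smi a b eta x = 0 /\ dsmi a b eta x = 0.
Proof.
move=> e0 ab [h|h]; rewrite /smi /dsmi.
  have [-> -> _] := stp_le0 (argle e0 h).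
  have [-> -> _] := stp_le0 (argle e0 (le_trans h ab)).
  by split; ring.
have [-> -> _] := stp_ge1 (argge e0 h).
have h' : a + eta <= x by apply: le_trans h; rewrite lerD2r.
have [-> -> _] := stp_ge1 (argge e0 h').
by split; ring.
Qed.

Lemma smi_in a b (eta : Rr) x : 0 < eta -> a + eta <= x -> x <= b -> smi a b eta x = 1.
Proof.
move=> e0 h h'; rewrite /smi; have [-> _ _] := stp_ge1 (argge e0 h).
by have [-> _ _] := stp_le0 (argle e0 h'); ring.
Qed.

Lemma smi_bound a b eta x : `|smi a b eta x| <= 1.
Proof.
rewrite /smi ler_norml; have [/andP[h1 h2] _] := stp_bound (eta^-1 * x + - (a / eta)).
have [/andP[h3 h4] _] := stp_bound (eta^-1 * x + - (b / eta)).
by move: h1 h2 h3 h4; move: (stp _) (stp _) => *; apply/andP; split; lra.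
Qed.

Lemma ismi_out a b (eta : Rr) x : 0 < eta -> a <= b ->
  (x <= a -> ismi a b eta x = 0) /\ (b + eta <= x -> ismi a b eta x = b - a).
Proof.
move=> e0 ab; rewrite /ismi; split=> h.
  have [_ _ ->] := stp_le0 (argle e0 h).
  by have [_ _ ->] := stp_le0 (argle e0 (le_trans h ab)); ring.
have [_ _ ->] := stp_ge1 (argge e0 h).
have h' : a + eta <= x by apply: le_trans h; rewrite lerD2r.
have [_ _ ->] := stp_ge1 (argge e0 h').
by field; rewrite gt_eqF.
Qed.

Definition rC1c (M : Rr) (h h' : Rr -> Rr) :=
  [/\ forall x, rder h (h' x) x, forall x, rcont h' x
    & forall x, M <= `|x| -> h x = 0 /\ h' x = 0].

Lemma rC1c_smi a b (eta : Rr) : 0 < eta -> a <= b ->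
  rC1c (`|a| + `|b| + eta) (smi a b eta) (dsmi a b eta).
Proof.
move=> e0 ab; split=> x; [exact: rder_smi|exact: rcont_dsmi|move=> h].
apply: smi_out => //; have := ler_norm a; have := ler_norm (- a); rewrite normrN.
have := ler_norm b; have := ler_norm (- b); rewrite normrN => h1 h2 h3 h4.
have n1 : 0 <= `|a| by []. have n2 : 0 <= `|b| by [].
have [x0|x0] := ger0P x.
  by right; rewrite (ger0_norm x0) in h; lra.
by left; rewrite (ltr0_norm x0) in h; lra.
Qed.

(** The smoothed indicator of ]a, b] minus (b - a) times that of ]0, 1] has total integral 0, so its
    primitive has compact support. A functional that kills derivatives therefore sees only the
    length b - a. *)
Lemma rC1c_ismi a b (eta : Rr) : 0 < eta -> a <= b ->
  exists M, rC1c M (fun x => ismi a b eta x + - (b - a) * ismi 0 1 1 x)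
    (fun x => smi a b eta x + - (b - a) * smi 0 1 1 x).
Proof.
move=> e0 ab; exists (`|a| + `|b| + eta + 2); split=> x.
- by apply: rder_add; [|apply: rder_scale]; apply: rder_ismi; rewrite ?oner_eq0 ?gt_eqF.
- have c a' b' et : rcont (smi a' b' et) x by exact: rder_rcont (rder_smi a' b' et x).
  by apply: rcont_add => //; apply: rcont_scale.
- move=> h.
  have := ler_norm a; have := ler_norm (- a); rewrite normrN.
  have := ler_norm b; have := ler_norm (- b); rewrite normrN => h1 h2 h3 h4.
  have n1 : 0 <= `|a| by []. have n2 : 0 <= `|b| by [].
  have [i1 i2] := ismi_out x e0 ab; have [i3 i4] := ismi_out x ltr01 ler01.
  have [x0|x0] := ger0P x.
    rewrite (ger0_norm x0) in h.
    have xb : b + eta <= x by lra.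
    have x2 : 1 + 1 <= x by lra.
    rewrite (i2 xb) (i4 x2); have [-> _] := smi_out e0 ab (or_intror xb).
    by have [-> _] := smi_out ltr01 ler01 (or_intror x2); split; ring.
  rewrite (ltr0_norm x0) in h.
  have xa : x <= a by lra. have x00 : x <= 0 by exact: ltW.
  rewrite (i1 xa) (i3 x00); have [-> _] := smi_out e0 ab (or_introl xa).
  by have [-> _] := smi_out ltr01 ler01 (or_introl x00); split; ring.
Qed.

End step.

(** * Image of |p'|^2 dA under a polynomial p *)

Lemma Wd_poly (p : {poly C}) z : Wd (fun z => p.[z]) (p^`()).[z] 0 z.
Proof.
elim/poly_ind: p => [|p c IH].
  by rewrite deriv0 horner0; under eq_fun do rewrite horner0; exact: Wd_cst.
under eq_fun do rewrite hornerMXaddC.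
apply: eq_Wd (Wd_add (Wd_mul IH (Wd_id z)) (Wd_cst c z)); rewrite ?derivMXaddC ?hornerD ?hornerMX /=; ring.
Qed.

Lemma ccont_poly (p : {poly C}) z : ccont (fun z => p.[z]) z.
Proof. exact: Wd_ccont (Wd_poly p z). Qed.

Lemma poly_lower_bound (q : {poly C}) : q != 0 -> exists m M : Rr, 0 < m /\
  forall z, M <= nc z -> m <= nc q.[z].
Proof.
elim/poly_ind: q => [|q c IH]; first by rewrite eqxx.
have [->|q0] := eqVneq q 0.
  rewrite mul0r add0r polyC_eq0 => c0; exists (nc c), 0; split; first by rewrite nc_gt0.
  by move=> z _; rewrite hornerC.
have [m [M [m0 H]]] := IH q0; move=> _.
exists 1, (Num.max M ((1 + nc c) / m)); split => // z.
rewrite ge_max => /andP[/H h1]; rewrite ler_pdivrMr // => h2.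
rewrite hornerMXaddC; apply: le_trans (nc_ge_sub _ _); rewrite ncM.
have := ler_wpM2r (nc_ge0 z) h1; rewrite [m * _]mulrC.
by move: h2; move: (nc _ * nc _) (nc z * m) (nc c) => *; lra.
Qed.

Lemma poly_proper (p : {poly C}) : (1 < size p)%N -> forall M : Rr, exists M' : Rr,
  forall z, M' <= nc z -> M <= nc p.[z].
Proof.
elim/poly_ind: p => [|q c _]; first by rewrite size_poly0.
move=> sp M; have q0 : q != 0.
  by apply: contraTneq sp => ->; rewrite mul0r add0r size_polyC; case: eqP.
have [m [M' [m0 H]]] := poly_lower_bound q0.
exists (Num.max M' ((M + nc c) / m)) => z.
rewrite ge_max => /andP[/H h1]; rewrite ler_pdivrMr // => h2.
rewrite hornerMXaddC; apply: le_trans (nc_ge_sub _ _); rewrite ncM.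
have := ler_wpM2r (nc_ge0 z) h1; rewrite [m * _]mulrC.
by move: h2; move: (nc _ * nc _) (nc z * m) (nc c) => *; lra.
Qed.

Lemma ccont_rcf F z : ccont F z -> ccont (fun w => rc (sqnorm (F w))) z.
Proof.
move=> cF; have h : (fun w => rc (sqnorm (F w))) = (fun w => F w * cj (F w)).
  by apply/funext => w; rewrite mul_cj.
by rewrite h; apply: ccont_mul => //; apply: ccont_comp cF; exact: ccont_cj.
Qed.

Section tensor.

Definition tens (u v : Rr -> Rr) (w : C) : C := rc (u (Re w)) * rc (v (Im w)).

Lemma ccont_tens u v : (forall x, rcont u x) -> (forall x, rcont v x) ->
  forall w, ccont (tens u v) w.
Proof. by move=> cu cv w; apply: ccont_mul; [exact: ccont_re|exact: ccont_im]. Qed.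

Lemma C1c_tens M h h' k k' : rC1c M h h' -> rC1c M k k' ->
  C1c (M + M) (tens h k)
    (fun w => rc (h (Re w)) * - (ii * rc (k' (Im w) / 2)) + rc (h' (Re w) / 2) * rc (k (Im w)))
    (fun w => rc (h (Re w)) * (ii * rc (k' (Im w) / 2)) + rc (h' (Re w) / 2) * rc (k (Im w))).
Proof.
move=> [dh ch h0] [dk ck k0].
have rh x : rcont h x by exact: rder_rcont (dh x).
have rk x : rcont k x by exact: rder_rcont (dk x).
have ch2 x : rcont (fun x => h' x / 2) x.
  by apply: eq_rcont (rcont_scale 2^-1 (ch x)) => y; rewrite mulrC.
have ck2 x : rcont (fun x => k' x / 2) x.
  by apply: eq_rcont (rcont_scale 2^-1 (ck x)) => y; rewrite mulrC.
split=> w.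
- exact: (Wd_mul (Wd_re (dh (Re w))) (Wd_im (dk (Im w)))).
- exact: (ccont_add (ccont_mul (ccont_re (rh (Re w))) (ccont_opp (ccont_mul (ccont_cst ii w)
    (ccont_im (ck2 (Im w)))))) (ccont_mul (ccont_re (ch2 (Re w))) (ccont_im (rk (Im w))))).
- exact: (ccont_add (ccont_mul (ccont_re (rh (Re w))) (ccont_mul (ccont_cst ii w)
    (ccont_im (ck2 (Im w))))) (ccont_mul (ccont_re (ch2 (Re w))) (ccont_im (rk (Im w))))).
- move=> Mw; have [hM|kM] : M <= `|Re w| \/ M <= `|Im w|.
    have [|h1] := leP M `|Re w|; first by left.
    right; rewrite leNgt; apply/negP => h2; have := le_trans Mw (nc_le_ReIm w).
    by move: h1 h2; move: `|Re w| `|Im w| => *; lra.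
  + by rewrite /tens; have [-> ->] := h0 _ hM; split; rewrite ?mul0r /= ?mul0r ?addr0.
  + by rewrite /tens; have [-> ->] := k0 _ kM; split; rewrite ?mul0r !mulr0 ?oppr0 ?mulr0 ?addr0.
Qed.

End tensor.

Section poly_pushforward.
Variable p : {poly C}.
Hypothesis sp : (1 < size p)%N.
Let J z := (p^`()).[z].

(** The image of |p'|^2 dA under p, tested on F. *)
Definition nuP (F : C -> C) : C := CI muC (fun z => F p.[z] * rc (sqnorm (J z))).

Let cJ z : ccont J z. Proof. exact: ccont_poly. Qed.

Lemma ccont_nuP F z : (forall w, ccont F w) -> ccont (fun z => F p.[z] * rc (sqnorm (J z))) z.
Proof.
move=> cF; apply: ccont_mul; last exact: ccont_rcf.
by apply: ccont_comp; [exact: cF|exact: ccont_poly].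
Qed.

Lemma cintegrable_nuP F (M : Rr) : (forall w, ccont F w) -> (forall w, M <= nc w -> F w = 0) ->
  cintegrable muC (fun z => F p.[z] * rc (sqnorm (J z))).
Proof.
move=> cF F0; have [M' HM] := poly_proper sp M.
apply: (cintegrable_ccont (M := M')) => [z|z /HM/F0 ->]; last by rewrite mul0r.
exact: ccont_nuP.
Qed.

(** As conj(p') is antiholomorphic, A(p) |p'|^2 is the z-derivative of f(p) conj(p'); symmetrically
    B(p) |p'|^2 is the conj(z)-derivative of f(p) p'. Both have compact support because p is proper.
    So the functional kills derivatives, as a multiple of Lebesgue measure must. *)
Lemma nuP_dbar M f A B : C1c M f A B -> nuP A = 0 /\ nuP B = 0.
Proof.
move=> [W cA cB f0]; have [M' HM] := poly_proper sp M.
have cf w : ccont f w by exact: Wd_ccont (W w).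
have WP z := Wd_comp (W p.[z]) (Wd_poly p z).
have cfP z : ccont (fun z => f p.[z]) z by apply: ccont_comp; [exact: cf|exact: ccont_poly].
have cAP z : ccont (fun z => A p.[z]) z by apply: ccont_comp; [exact: cA|exact: ccont_poly].
have cBP z : ccont (fun z => B p.[z]) z by apply: ccont_comp; [exact: cB|exact: ccont_poly].
have ccJ z : ccont (fun z => cj (J z)) z by apply: ccont_comp; [exact: ccont_cj|exact: cJ].
have cJ2 z : ccont (fun z => cj (p^`()^`()).[z]) z by apply: ccont_comp; [exact: ccont_cj|exact: ccont_poly].
have cJ3 z : ccont (fun z => (p^`()^`()).[z]) z by exact: ccont_poly.
split.
- suff C1 : C1c M' (fun z => f p.[z] * cj (J z)) (fun z => A p.[z] * rc (sqnorm (J z)))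
    (fun z => f p.[z] * cj (p^`()^`()).[z] + B p.[z] * cj (J z) * cj (J z)).
    by have [] := CI_dbar0 C1.
  split=> z.
  + apply: eq_Wd (Wd_mul (WP z) (Wd_cjf (Wd_poly p^`() z))).
      by rewrite ?conjc0 -mul_cj /J; ring.
    by rewrite ?conjc0 /J; ring.
  + exact: ccont_nuP.
  + by apply: ccont_add; apply: ccont_mul => //; apply: ccont_mul.
  + by move=> /HM/f0[-> -> ->]; rewrite !mul0r addr0.
- suff C1 : C1c M' (fun z => f p.[z] * J z) (fun z => f p.[z] * (p^`()^`()).[z] + A p.[z] * J z * J z)
    (fun z => B p.[z] * rc (sqnorm (J z))).
    by have [] := CI_dbar0 C1.
  split=> z.
  + apply: eq_Wd (Wd_mul (WP z) (Wd_poly p^`() z)).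
      by rewrite ?conjc0 /J; ring.
    by rewrite ?conjc0 -mul_cj /J; ring.
  + by apply: ccont_add; apply: ccont_mul => //; apply: ccont_mul.
  + exact: ccont_nuP.
  + by move=> /HM/f0[-> -> ->]; rewrite !mul0r addr0.
Qed.

Lemma nuP_lin F G (a : C) (M : Rr) :
  (forall w, ccont F w) -> (forall w, M <= nc w -> F w = 0) ->
  (forall w, ccont G w) -> (forall w, M <= nc w -> G w = 0) ->
  nuP (fun w => F w + a * G w) = nuP F + a * nuP G.
Proof.
move=> cF F0 cG G0; have iF := cintegrable_nuP cF F0; have iG := cintegrable_nuP cG G0.
rewrite /nuP -CIZ // -CID //; last exact: cintegrableZ.
by apply: eq_CI => z; ring.
Qed.

Lemma rC1c_widen M M' h h' : M <= M' -> rC1c M h h' -> rC1c M' h h'.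
Proof. by move=> MM [a b c]; split => // x /(le_trans MM)/c. Qed.

Lemma nuP_tens_deriv M h h' k k' : rC1c M h h' -> rC1c M k k' ->
  nuP (tens h' k) = 0 /\ nuP (tens h k') = 0.
Proof.
move=> Hh Hk; have C1 := C1c_tens Hh Hk; have [_ cA cB f0] := C1.
have [A0 B0] := nuP_dbar C1.
have A00 w : M + M <= nc w -> _ := fun h => let: And3 _ a _ := f0 w h in a.
have B00 w : M + M <= nc w -> _ := fun h => let: And3 _ _ a := f0 w h in a.
split.
- have := nuP_lin 1 cA A00 cB B00; rewrite A0 B0 mulr0 addr0 => <-.
  congr nuP; apply/funext => w; rewrite /tens mul1r.
  by apply: complexP; rewrite !(ReD, ImD, ReM, ImM, ReN, ImN) /=; field.
- have E := nuP_lin (-1) cB B00 cA A00; rewrite A0 B0 mulr0 addr0 in E.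
  move: E; set G := (X in nuP X) => E.
  transitivity (- ii * nuP G); last by rewrite E mulr0.
  rewrite /nuP -CIZ.
    apply: eq_CI => z; rewrite mulrA; congr (_ * _); rewrite /tens /G.
    by apply: complexP; rewrite !(ReD, ImD, ReM, ImM, ReN, ImN) /=; field.
  apply: (cintegrable_nuP (M := M + M) (F := G)) => w.
    by apply: ccont_add => //; apply: ccont_mul => //; exact: ccont_cst.
  by move=> hw; rewrite /G A00 // B00 // mulr0 addr0.
Qed.

(** The two sides differ by the value on a derivative in one variable of a compactly supported
    tensor product, which is 0. *)
Lemma nuP_smi (a b eta : Rr) k k' M : 0 < eta -> a <= b -> rC1c M k k' ->
  nuP (tens (smi a b eta) k) = rc (b - a) * nuP (tens (smi 0 1 1) k) /\
  nuP (tens k (smi a b eta)) = rc (b - a) * nuP (tens k (smi 0 1 1)).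
Proof.
move=> e0 ab Hk; have [N HN] := rC1c_ismi e0 ab.
pose Q : Rr := Num.max (Num.max M N) (Num.max (`|a| + `|b| + eta) (`|0 : Rr| + `|1 : Rr| + 1)).
have QM : M <= Q by rewrite !le_max lexx.
have QN : N <= Q by rewrite !le_max lexx orbT.
have Q1 : `|a| + `|b| + eta <= Q by rewrite !le_max lexx !orbT.
have Q2 : `|0 : Rr| + `|1 : Rr| + 1 <= Q by rewrite !le_max lexx !orbT.
have Hk' := rC1c_widen QM Hk; have HN' := rC1c_widen QN HN.
have Hs := rC1c_widen Q1 (rC1c_smi e0 ab); have Hu := rC1c_widen Q2 (rC1c_smi ltr01 ler01).
have [z1 _] := nuP_tens_deriv HN' Hk'; have [_ z2] := nuP_tens_deriv Hk' HN'.
have tensc u u' v v' : rC1c Q u u' -> rC1c Q v v' ->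
    (forall w, ccont (tens u v) w) /\ (forall w, Q + Q <= nc w -> tens u v w = 0).
  move=> Hu' Hv'; have [W _ _ f0] := C1c_tens Hu' Hv'; split=> w; first exact: Wd_ccont (W w).
  by move=> /f0[].
have [c1 o1] := tensc _ _ _ _ Hs Hk'; have [c2 o2] := tensc _ _ _ _ Hu Hk'.
have [c3 o3] := tensc _ _ _ _ Hk' Hs; have [c4 o4] := tensc _ _ _ _ Hk' Hu.
have E1 := nuP_lin (- rc (b - a)) c1 o1 c2 o2.
have E2 := nuP_lin (- rc (b - a)) c3 o3 c4 o4.
have rN : rc (- (b - a)) = - rc (b - a) by exact: rmorphN.
have T1 : tens (fun x => smi a b eta x + - (b - a) * smi 0 1 1 x) k =
    (fun w => tens (smi a b eta) k w + - rc (b - a) * tens (smi 0 1 1) k w).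
  by apply/funext => w; rewrite /tens; apply: complexP; rewrite !(ReD, ImD, ReM, ImM, ReN, ImN) /=; ring.
have T2 : tens k (fun x => smi a b eta x + - (b - a) * smi 0 1 1 x) =
    (fun w => tens k (smi a b eta) w + - rc (b - a) * tens k (smi 0 1 1) w).
  by apply/funext => w; rewrite /tens; apply: complexP; rewrite !(ReD, ImD, ReM, ImM, ReN, ImN) /=; ring.
by rewrite T1 E1 mulNr in z1; rewrite T2 E2 mulNr in z2; split; apply/eqP;
  rewrite -subr_eq0; apply/eqP.
Qed.

(** The constant of proportionality; geometrically the number of preimages of a generic point, the
    degree of p. *)
Definition cP : Rr := Re (nuP (tens (smi 0 1 1) (smi 0 1 1))).

Lemma nuP_box (a b c d eta : Rr) : 0 < eta -> a <= b -> c <= d ->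
  Re (nuP (tens (smi a b eta) (smi c d eta))) = cP * ((b - a) * (d - c)).
Proof.
move=> e0 ab cd.
have [-> _] := nuP_smi e0 ab (rC1c_smi e0 cd).
have [_ ->] := nuP_smi e0 cd (rC1c_smi ltr01 ler01).
by rewrite mulrA -rcM ReM /cP /=; ring.
Qed.

End poly_pushforward.

Lemma ccvg_ccont F u l : ccont F l -> ccvg u l -> ccvg (fun n => F (u n)) (F l).
Proof.
move=> cF ul e /cF[de de0 H]; have d2 : 0 < de / 2 by rewrite divr_gt0.
have [N HN] := ul _ d2; exists N => n /HN h; apply: H; apply: le_lt_trans h _.
by rewrite ltr_pdivrMr // ltr_pMr // ltr1n.
Qed.

Lemma ccvg_add u v l k : ccvg u l -> ccvg v k -> ccvg (fun n => u n + v n) (l + k).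
Proof.
move=> ul vk e e0; have e2 : 0 < e / 2 by rewrite divr_gt0.
have [N HN] := ul _ e2; have [M HM] := vk _ e2; exists (maxn N M) => n.
rewrite geq_max => /andP[/HN h1 /HM h2].
rewrite (_ : _ - _ = (u n - l) + (v n - k)); last by ring.
by apply: le_trans (nc_triangle _ _) _; move: h1 h2; move: (nc _) (nc (v n - k)) => *; lra.
Qed.

Lemma ccvg_mul u v l k : ccvg u l -> ccvg v k -> ccvg (fun n => u n * v n) (l * k).
Proof.
move=> ul vk.
have h1 : ccvg (fun n => u n * k) (l * k).
  apply: (ccvg_ccont (F := fun z => z * k)) ul.
  by apply: ccont_mul; [exact: ccont_id|exact: ccont_cst].
suff h2 : ccvg (fun n => u n * (v n - k)) 0.
  have := ccvg_add h1 h2; rewrite addr0.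
  by under eq_fun do rewrite -mulrDr addrC subrK.
move=> e e0; have [N HN] := ul _ ltr01.
have p0 : 0 < 1 + nc l by rewrite ltr_wpDr // nc_ge0.
have [M HM] := vk _ (divr_gt0 e0 p0); exists (maxn N M) => n.
rewrite geq_max => /andP[/HN b1 /HM]; rewrite ler_pdivlMr // => b2.
rewrite subr0 ncM; apply: le_trans b2; rewrite mulrC ler_wpM2l ?nc_ge0 //.
have := nc_triangle (u n - l) l; rewrite subrK => b3; apply: le_trans b3 _.
by rewrite lerD2r.
Qed.

Lemma ccvg_near u v l N : (forall n, (N <= n)%N -> u n = v n) -> ccvg u l -> ccvg v l.
Proof.
move=> uv ul e /ul[M HM]; exists (maxn N M) => n.
by rewrite geq_max => /andP[/uv <- /HM].
Qed.

Lemma ccvg_rc (u : nat -> Rr) : (forall e : Rr, 0 < e -> exists N, forall n, (N <= n)%N -> `|u n| <= e) ->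
  ccvg (fun n => rc (u n)) 0.
Proof. by move=> H e /H[N HN]; exists N => n /HN; rewrite subr0 nc_rc. Qed.

Lemma inv_nat_eventually (e : Rr) : 0 < e -> exists N, forall n, (N <= n)%N -> n.+1%:R^-1 <= e.
Proof.
move=> /inv_nat_small[k Hk]; exists k => n kn; apply: le_trans (ltW Hk).
by rewrite lef_pV2 ?posrE // ler_nat.
Qed.

(** * From nonnegative to complex integrands in a change of variables *)

Section change_of_variables.
Context d d' (T : measurableType d) (U : measurableType d').
Variables (m : {measure set T -> \bar Rr}) (m' : {measure set U -> \bar Rr}).
Variables (phi : T -> U) (w : T -> Rr) (c : Rr).
Hypothesis c0 : 0 <= c.
Hypothesis w0 : forall t, 0 <= w t.
Hypothesis mphi : measurable_fun setT phi.
Hypothesis mw : measurable_fun setT (w : T -> mR).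
Hypothesis cov : forall F : U -> \bar Rr, measurable_fun setT F -> (forall u, 0%E <= F u)%E ->
  (\int[m]_t (F (phi t) * (w t)%:E) = c%:E * \int[m']_u F u)%E.

Lemma cov_integral (f : U -> Rr) : m'.-integrable setT (EFin \o f) ->
  m.-integrable setT (EFin \o (fun t => f (phi t) * w t)) /\
  (\int[m]_t (f (phi t) * w t))%R = c * (\int[m']_u f u)%R.
Proof.
move=> /integrableP[mf fi].
have mf' : measurable_fun setT (f : U -> mR) by apply/measurable_EFinP.
have mfw : measurable_fun setT (EFin \o (fun t => f (phi t) * w t)).
  by apply/measurable_EFinP; apply: measurable_funM => //; exact: measurableT_comp.
have ifw : m.-integrable setT (EFin \o (fun t => f (phi t) * w t)).
  apply/integrableP; split => //.
  under eq_integral do rewrite /= normrM (ger0_norm (w0 _)) EFinM.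
  rewrite (cov (F := fun u => `|f u|%:E)) //; last by apply/measurable_EFinP; exact: measurableT_comp mf'.
  by apply: lte_mul_pinfty => //; rewrite ?lee_fin.
split => //.
have ifm : m'.-integrable setT (EFin \o f) by apply/integrableP.
have fp := integrable_fin_num measurableT (integrable_funepos measurableT ifm).
have fn := integrable_fin_num measurableT (integrable_funeneg measurableT ifm).
pose h t := f (phi t) * w t.
have E1 : (\int[m]_t (EFin \o h)^\+ t =
    c%:E * \int[m']_u (EFin \o f)^\+ u)%E.
  rewrite -(cov (F := (EFin \o f)^\+)%E) //; last exact: measurable_funepos.
  apply: eq_integral => t _; rewrite !funeposE /= -!EFin_max -EFinM; congr EFin.
  by rewrite maxr_pMl // mul0r.
have E2 : (\int[m]_t (EFin \o h)^\- t =
    c%:E * \int[m']_u (EFin \o f)^\- u)%E.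
  rewrite -(cov (F := (EFin \o f)^\-)%E) //; last exact: measurable_funeneg.
  apply: eq_integral => t _; rewrite !funenegE /= -?EFinN -!EFin_max -EFinM; congr EFin.
  by rewrite maxr_pMl // mul0r mulNr.
transitivity (fine (c%:E * \int[m']_u (EFin \o f)^\+ u - c%:E * \int[m']_u (EFin \o f)^\- u)%E).
  by rewrite -E1 -E2; congr fine; exact: integralE.
rewrite /Rintegral [in RHS]integralE; move: fp fn.
by case: (integral _ _ _) => [x| |] //; case: (integral _ _ _) => [y| |] //= _ _; rewrite mulrBr.
Qed.

Lemma cov_CI (f : U -> C) : cintegrable m' f ->
  cintegrable m (fun t => f (phi t) * rc (w t)) /\
  CI m (fun t => f (phi t) * rc (w t)) = rc c * CI m' f.
Proof.
move=> [fr fi]; have [r1 r2] := cov_integral fr; have [i1 i2] := cov_integral fi.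
have ER t : Re (f (phi t) * rc (w t)) = Re (f (phi t)) * w t by rewrite ReM /= mulr0 subr0.
have EI t : Im (f (phi t) * rc (w t)) = Im (f (phi t)) * w t by rewrite ImM /= mulr0 add0r.
split.
  by split; [apply: eq_integrable r1|apply: eq_integrable i1] => // t _ /=; rewrite ?ER ?EI.
apply: complexP => /=; rewrite ?mul0r ?subr0 ?addr0.
- by rewrite -r2; apply: eq_Rintegral => t _; exact: ER.
- by rewrite -i2; apply: eq_Rintegral => t _; exact: EI.
Qed.

End change_of_variables.

Lemma tens_cpt M M' h h' k k' : rC1c M h h' -> rC1c M' k k' ->
  exists N : Rr, forall z, N <= nc z -> tens h k z = 0.
Proof.
move=> H K; have M1 : M <= Num.max M M' by rewrite le_max lexx.
have M2 : M' <= Num.max M M' by rewrite le_max lexx orbT.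
have [_ _ _ T0] := C1c_tens (rC1c_widen M1 H) (rC1c_widen M2 K).
by exists (Num.max M M' + Num.max M M') => z /T0[].
Qed.

Section poly_measure.
Variable p : {poly C}.
Hypothesis sp : (1 < size p)%N.
Let w z := sqnorm (p^`()).[z].
Let phi z := p.[z].

Let mw : measurable_fun setT (EFin \o w).
Proof. by apply/measurable_EFinP; apply: measurable_sqnorm; apply: measurable_ccont => z; exact: ccont_poly. Qed.
Let w0 z : 0 <= w z. Proof. exact: sqnorm_ge0. Qed.
Let mphi : measurable_fun setT phi.
Proof. by apply: measurable_ccont => z; exact: ccont_poly. Qed.

Let pushP := dpush_measure muC mw w0 mphi.

Let ind (A : set C) z : C := rc (\1_A z).

(** The ramps start at a and at b and shrink to the right, so the pointwise limit is the indicator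
    of ]a, b], open on the left and closed on the right as in [cboxo]. *)
Lemma smi_ccvg a b x : a <= b ->
  exists N, forall n, (N <= n)%N -> smi a b n.+1%:R^-1 x = (if a < x <= b then 1 else 0).
Proof.
move=> ab; have e0 n : 0 < n.+1%:R^-1 :> Rr by rewrite invr_gt0.
have [xa|ax] /= := leP x a.
  by exists 0%N => n _; have [-> _] := smi_out (e0 n) ab (or_introl xa).
have [xb|bx] := leP x b.
  have d0 : 0 < x - a by rewrite subr_gt0.
  have [N HN] := inv_nat_eventually d0; exists N => n /HN h.
  by apply: smi_in => //; move: h; move: n.+1%:R^-1 => *; lra.
have d0 : 0 < x - b by rewrite subr_gt0.
have [N HN] := inv_nat_eventually d0; exists N => n /HN h.
have [|-> _] // := smi_out (x := x) (e0 n) ab; right.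
by move: h; move: n.+1%:R^-1 => *; lra.
Qed.

Lemma smi_dom a b (eta : Rr) x : a <= b -> 0 < eta -> eta <= 1 ->
  `|smi a b eta x| <= `|smi (a - 1) (b + 1) 1 x|.
Proof.
move=> ab e0 e1; have [h|h] := boolP ((a <= x) && (x <= b + 1)).
  have /andP[h1 h2] := h; rewrite (@smi_in (a - 1)) ?normr1 ?smi_bound //; lra.
have [|-> _] := @smi_out a b eta x e0 ab; last by rewrite normr0.
by move: h; rewrite negb_and -!ltNge => /orP[]?; [left|right]; lra.
Qed.

Let G a b c d n z := tens (smi a b n.+1%:R^-1) (smi c d n.+1%:R^-1) (phi z) * rc (w z).

(** Limit of [nuP_box] as the smoothing width 1/(n+1) tends to 0, dominated by the smoothed
    indicator of a box enlarged by 1 on each side. *)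
Lemma pushP_box a b c d : a < b -> c < d ->
  pushP (cboxo a b c d) = (cP p * ((b - a) * (d - c)))%:E.
Proof.
move=> /ltW ab /ltW cd.
have e0 n : 0 < n.+1%:R^-1 :> Rr by rewrite invr_gt0.
have e1 n : n.+1%:R^-1 <= 1 :> Rr by rewrite invf_le1 // ler1n.
have cs u v e x : rcont (smi u v e) x by exact: rder_rcont (rder_smi u v e x).
have mt a1 b1 e c1 d1 e' : measurable_fun setT (fun z => tens (smi a1 b1 e) (smi c1 d1 e') (phi z) * rc (w z)).
  by apply: measurable_ccont => z; apply: ccont_nuP => v; exact: ccont_tens.
have ab' : a - 1 <= b + 1 by lra.
have cd' : c - 1 <= d + 1 by lra.
have [N0 T0] := tens_cpt (rC1c_smi ltr01 ab') (rC1c_smi ltr01 cd').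
have iT := cintegrable_nuP sp (ccont_tens (cs (a - 1) (b + 1) 1) (cs (c - 1) (d + 1) 1))
  T0.
pose g z := ind (cboxo a b c d) (phi z) * rc (w z).
have mind A : measurable A -> measurable_fun setT (ind A).
  by move=> mA; apply: measurableC_rc; exact: measurable_indic.
have mg : measurable_fun setT g.
  apply: measurableC_mul; first by apply: (measurableT_comp (mind _ _) mphi); exact: measurable_cboxo.
  by apply: measurableC_rc; apply/measurable_EFinP.
have dom n z : nc (G a b c d n z) <= nc (tens (smi (a - 1) (b + 1) 1) (smi (c - 1) (d + 1) 1) (phi z) * rc (w z)).
  rewrite /G /tens !ncM !nc_rc ler_wpM2r // ler_pM //; exact: smi_dom.
have [|[ig1 ig2] cv] := CI_dominated (fun n => mt _ _ _ _ _ _) mg (cintegrable_nc iT) dom.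
  apply: aeW => z; apply: ccvg_mul; last exact: ccvg_cst.
  have [N1 H1] := smi_ccvg (Re (phi z)) ab; have [N2 H2] := smi_ccvg (Im (phi z)) cd.
  apply: (@ccvg_near (fun=> ind (cboxo a b c d) (phi z)) _ _ (maxn N1 N2)); last exact: ccvg_cst.
  move=> n; rewrite geq_max => /andP[/H1 h1 /H2 h2]; rewrite /tens h1 h2 /ind indicE.
  have [h|h] := boolP ((a < Re (phi z) <= b) && (c < Im (phi z) <= d)).
    by rewrite mem_set //; case/andP: h => -> ->; rewrite mulr1.
  rewrite memNset; last exact/negP.
  by move: h; rewrite negb_and => /orP[]/negbTE ->; rewrite ?mul0r ?mulr0.
have RE : Re (CI muC g) = cP p * ((b - a) * (d - c)).
  have := ccvg_Re cv; under eq_fun do rewrite (nuP_box sp (e0 _) ab cd).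
  by move=> /(cvg_lim (@ereal_hausdorff Rr)); rewrite lim_cst //; case.
rewrite -RE /pushP /= integral_dpush_indic //; last exact: measurable_cboxo.
rewrite /CI /= /Rintegral fineK; last exact: integrable_fin_num ig1.
apply: eq_integral => z _; rewrite -EFinM; congr EFin.
by rewrite /= mulr0 subr0.
Qed.

Lemma cP_ge0 : 0 <= cP p.
Proof.
have := pushP_box (ltr01) (ltr01); rewrite subr0 !mulr1 => h.
by rewrite -lee_fin -h.
Qed.

(** The area formula for a polynomial, with the multiplicity as one constant. The image measure
    agrees with a multiple of area on boxes, hence everywhere. *)
Lemma poly_pushforward (F : C -> \bar Rr) : measurable_fun setT F -> (forall z, 0%E <= F z)%E ->
  (\int[muC]_z (F p.[z] * (sqnorm (p^`()).[z])%:E) = (cP p)%:E * \int[muC]_z F z)%E.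
Proof.
move=> mF F0; rewrite -(integral_dpush muC mw w0 mphi) //.
have E := muC_unique cP_ge0 (m := pushP) (fun a b a' b' ab ab' => pushP_box ab ab').
rewrite (eq_measure_integral (mscale (NngNum cP_ge0) muC)); last by move=> A mA _; exact: E.
by rewrite ge0_integral_mscale.
Qed.

End poly_measure.

Lemma sqnorm_rc (x : Rr) : sqnorm (rc x) = x ^+ 2.
Proof. by rewrite sqnormE nc_rc real_normK // num_real. Qed.

Lemma ReM_rc (x y : Rr) : Re (rc x * rc y) = x * y.
Proof. by rewrite ReM /= mulr0 subr0. Qed.

Section affine.
Variables (R : Rr) (b : C).
Hypothesis R0 : 0 < R.

Let pa : {poly C} := rc R *: 'X + b%:P.

Let rR0 : rc R != 0.
Proof. by rewrite -nc_eq0 nc_rc normr_eq0 gt_eqF. Qed.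

Let size_pa : size pa = 2%N.
Proof.
rewrite /pa -mul_polyC size_MXaddC polyC_eq0 (negbTE rR0) /= size_polyC rR0.
by [].
Qed.

Let paE z : pa.[z] = rc R * z + b. Proof. by rewrite /pa !hornerE. Qed.
Let dpaE z : (pa^`()).[z] = rc R. Proof. by rewrite /pa derivD derivZ derivX derivC addr0 hornerZ hornerC mulr1. Qed.

Let sqR : sqnorm (rc R) = R ^+ 2. Proof. exact: sqnorm_rc. Qed.

(** Compare both sides of the area formula on the indicator of the image of the unit square. *)
Let cP_affine : cP pa = 1.
Proof.
have sp : (1 < size pa)%N by rewrite size_pa.
pose B := cboxo (Re b) (Re b + R) (Im b) (Im b + R).
have mB : measurable B by exact: measurable_cboxo.
have mF : measurable_fun setT (EFin \o (\1_B : C -> Rr)).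
  by apply/measurable_EFinP; exact: measurable_indic.
have F0 z : (0%E <= (EFin \o (\1_B : C -> Rr)) z)%E by rewrite lee_fin.
have muB a b' c d : a <= b' -> c <= d ->
    (\int[muC]_z (\1_(cboxo a b' c d) z)%:E)%E = ((b' - a) * (d - c))%:E :> \bar Rr.
  move=> ab cd; have mb := measurable_cboxo a b' c d.
  by rewrite integral_indic // setIT; exact: muC_cboxo.
have := poly_pushforward sp mF F0; rewrite [X in _ = (_ * X)%E]muB ?lerDl ?ltW //.
have -> : (\int[muC]_z ((EFin \o \1_B) pa.[z] * (sqnorm (pa^`()).[z])%:E) =
    (R ^+ 2)%:E * \int[muC]_z (\1_(cboxo 0 1 0 1) z)%:E)%E.
  rewrite -ge0_integralZl ?lee_fin ?sqr_ge0 //; last first.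
    by apply/measurable_EFinP; apply: measurable_indic; exact: measurable_cboxo.
  apply: eq_integral => z _; rewrite dpaE sqR muleC; congr (_ * _)%E; congr EFin.
  rewrite !indicE; congr ((nat_of_bool _)%:R); rewrite paE; apply/idP/idP; rewrite !inE /B /cboxo /=.
    rewrite !ReD !ImD !ReM !ImM /= !mul0r subr0 addr0.
    move=> /andP[/andP[h1 h2] /andP[h3 h4]]; apply/andP; split; apply/andP; split.
    - by rewrite -(pmulr_rgt0 _ R0); lra.
    - by rewrite -(ler_pM2l R0); lra.
    - by rewrite -(pmulr_rgt0 _ R0); lra.
    - by rewrite -(ler_pM2l R0); lra.
  rewrite !ReD !ImD !ReM !ImM /= !mul0r subr0 addr0.
  move=> /andP[/andP[]]; rewrite -(pmulr_rgt0 _ R0) -(ler_pM2l R0) mulr1 => h1 h2.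
  move=> /andP[]; rewrite -(pmulr_rgt0 _ R0) -(ler_pM2l R0) mulr1 => h3 h4.
  by apply/andP; split; apply/andP; split; lra.
rewrite muB ?ler01 // subr0 mulr1 mule1 => -[].
rewrite (_ : _ * _ = R ^+ 2); last by ring.
rewrite -[LHS]mul1r => /esym/mulIf; apply; by rewrite sqrf_eq0 gt_eqF.
Qed.

Lemma integral_affine (F : C -> \bar Rr) : measurable_fun setT F -> (forall z, 0%E <= F z)%E ->
  (\int[muC]_z (F (rc R * z + b)%R * (R ^+ 2)%:E) = \int[muC]_z F z)%E.
Proof.
move=> mF F0; have sp : (1 < size pa)%N by rewrite size_pa.
have := poly_pushforward sp mF F0; rewrite cP_affine mul1e => <-.
by apply: eq_integral => z _; rewrite paE dpaE sqR.
Qed.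

Lemma CI_affine (f : C -> C) : cintegrable muC f ->
  cintegrable muC (fun z => f (rc R * z + b) * rc (R ^+ 2)) /\
  CI muC (fun z => f (rc R * z + b) * rc (R ^+ 2)) = CI muC f.
Proof.
move=> fi; have m1 : measurable_fun setT (fun z => rc R * z + b).
  apply: measurable_ccont => z; apply: ccont_add; last exact: ccont_cst.
  by apply: ccont_mul; [exact: ccont_cst|exact: ccont_id].
have cv (F : C -> \bar Rr) : measurable_fun setT F -> (forall u, 0%E <= F u)%E ->
    (\int[muC]_t (F (rc R * t + b)%R * (R ^+ 2)%:E) = 1%:E * \int[muC]_u F u)%E.
  by move=> mF F0; rewrite mul1e integral_affine.
have [i1 i2] := cov_CI ler01 (fun _ => sqr_ge0 R) m1 (measurable_cst (R ^+ 2 : mR)) cv fi.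
by split => //; rewrite i2 mul1r.
Qed.

End affine.

Lemma integral_translate (b : C) (F : C -> \bar Rr) : measurable_fun setT F -> (forall z, 0%E <= F z)%E ->
  (\int[muC]_z F (z + b)%R = \int[muC]_z F z)%E.
Proof.
move=> mF F0; rewrite -[RHS](integral_affine b ltr01) //.
by apply: eq_integral => z _; rewrite mul1r expr1n mule1.
Qed.

(** * The constant [cP p] depends only on degree and leading coefficient *)

Section homogenization.
Implicit Types (l : seq C) (s z : C).

(** The homogenisation: the sum of c_i z^i s^(d-i), where d + 1 is the length of l. It deforms the
    polynomial at s = 1 into its leading monomial at s = 0. *)
Fixpoint hom l s z : C := if l is c :: l' then z * hom l' s z + c * s ^+ size l' else 0.

Lemma hom1 (p : {poly C}) z : hom p 1 z = p.[z].
Proof.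
rewrite /horner; elim: (polyseq p) => //= c l ->.
by rewrite expr1n mulr1 mulrC.
Qed.

Lemma hom_scale l s z : hom l s (s * z) * s = s ^+ size l * hom l 1 z.
Proof.
elim: l => [|c l IH] /=; first by rewrite mul0r mulr0.
by rewrite mulrDl -[s * z * _ * _]mulrA IH expr1n exprS; ring.
Qed.

Lemma hom0 l z : hom l 0 z = last 0 l * z ^+ (size l).-1.
Proof.
elim: l => [|c l IH] /=; first by rewrite mul0r.
rewrite IH; case: l {IH} => [|c' l] /=; first by rewrite !expr0 mul0r mulr0 add0r.
by rewrite expr0n /= mulr0 addr0 exprS mulrCA.
Qed.

Lemma hom_ccont_s l s z : ccont (fun s => hom l s z) s.
Proof.
elim: l => [|c l IH] /=; first exact: ccont_cst.
by apply: ccont_add; apply: ccont_mul => //; (try exact: ccont_cst); apply: ccont_exp; exact: ccont_id.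
Qed.

Lemma hom_ccont l s z : ccont (fun z => hom l s z) z.
Proof.
elim: l => [|c l IH] /=; first exact: ccont_cst.
by apply: ccont_add; [apply: ccont_mul => //; exact: ccont_id|exact: ccont_cst].
Qed.

Let coef_le s c n : nc s <= 1 -> nc (c * s ^+ n) <= nc c.
Proof.
by move=> s1; rewrite ncM ncX -[leRHS]mulr1 ler_wpM2l ?nc_ge0 // exprn_ile1 ?nc_ge0.
Qed.

Lemma hom_bound l (M : Rr) : exists K : Rr, forall s z, nc s <= 1 -> nc z <= M -> nc (hom l s z) <= K.
Proof.
elim: l => [|c l [K IH]]; first by exists 0 => s z _ _; rewrite nc0.
exists (M * K + nc c) => s z s1 zM /=; apply: le_trans (nc_triangle _ _) _.
by apply: lerD; [rewrite ncM ler_pM ?nc_ge0 ?IH|exact: coef_le].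
Qed.

(** Uniform in |s| <= 1, so that test functions composed with the whole family share one compact
    support. *)
Lemma hom_lower_bound l : last 0 l != 0 -> exists m M : Rr, 0 < m /\
  forall s z, nc s <= 1 -> M <= nc z -> m <= nc (hom l s z).
Proof.
elim: l => [|c l IH] /=; first by rewrite eqxx.
case: l IH => [_ /= c0|c' l /=].
  exists (nc c), 0; split; first by rewrite nc_gt0.
  by move=> s z _ _; rewrite mulr0 add0r mulr1.
move=> /[apply] -[m [M [m0 H]]]; set l' := c' :: l in H *.
exists 1, (Num.max M ((1 + nc c) / m)); split => // s z s1.
rewrite ge_max => /andP[/(H s z s1) h1]; rewrite ler_pdivrMr // => h2.
apply: le_trans (nc_ge_sub _ _); rewrite ncM.
have := coef_le c (size l).+1 s1; have := ler_wpM2l (nc_ge0 z) h1.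
by move: h2; rewrite /l' /=; move: (nc _ * nc _) (nc z * m) (nc c) (nc (_ * _)) => *; lra.
Qed.

Lemma hom_proper l (M : Rr) : last 0 l != 0 -> (1 < size l)%N ->
  exists M' : Rr, forall s z, nc s <= 1 -> M' <= nc z -> M <= nc (hom l s z).
Proof.
case: l => [//|c [//|c' l]] l0 _.
have [m [M1 [m0 H]]] := hom_lower_bound (l := c' :: l) l0; set l' := c' :: l in H *.
exists (Num.max M1 ((M + nc c) / m)) => s z s1.
rewrite ge_max => /andP[/(H s z s1) h1]; rewrite ler_pdivrMr // => h2.
apply: le_trans (nc_ge_sub _ _); rewrite ncM.
have := coef_le c (size l).+1 s1; have := ler_wpM2l (nc_ge0 z) h1.
by move: h2; rewrite /l' /=; move: (nc _ * nc _) (nc z * m) (nc c) (nc (_ * _)) => *; lra.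
Qed.

End homogenization.

Section cP_lead.

Let Phi := tens (smi 0 2 1) (smi 0 2 1).
Let le02 : 0 <= 2 :> Rr. Proof. by []. Qed.
Let cPhi z : ccont Phi z.
Proof. by apply: ccont_tens => x; exact: rder_rcont (rder_smi _ _ _ _). Qed.
Let F z : \bar Rr := (sqnorm (Phi z))%:E.
Let mF : measurable_fun setT F.
Proof. by apply/measurable_EFinP; apply: measurable_sqnorm; exact: measurable_ccont. Qed.
Let F0 z : (0%E <= F z)%E. Proof. by rewrite lee_fin sqnorm_ge0. Qed.

Let Phi_le1 z : nc (rc (sqnorm (Phi z))) <= 1.
Proof.
rewrite nc_rc ger0_norm ?sqnorm_ge0 // sqnormE exprn_ile1 ?nc_ge0 //.
by rewrite /Phi /tens ncM !nc_rc mulr_ile1 // smi_bound.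
Qed.

Let I0 : exists2 I : Rr, 0 < I & (\int[muC]_z F z = I%:E)%E.
Proof.
have [N HN] := tens_cpt (rC1c_smi ltr01 le02) (rC1c_smi ltr01 le02).
have [fin _] : cintegrable muC (fun z => rc (sqnorm (Phi z))).
  apply: (cintegrable_ccont (M := N)) => [z|z /HN]; first exact: ccont_rcf.
  by rewrite /Phi => ->; rewrite sqnormE nc0 expr0n.
have ff := integrable_fin_num measurableT fin.
exists (fine (\int[muC]_z F z)%E); last by rewrite fineK.
have E1 : (\int[muC]_z (\1_(cboxo 1 2 1 2) z)%:E = 1%:E)%E.
  have mb := measurable_cboxo 1 2 1 2; rewrite integral_indic // setIT.
  transitivity (((2 - 1) * (2 - 1))%:E : \bar Rr); last by congr EFin; ring.
  by apply: muC_cboxo; rewrite ler1n.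
rewrite -lte_fin fineK //; apply: lt_le_trans (_ : (1%:E <= _)%E) => //.
rewrite -E1; apply: ge0_le_integral => //.
- by apply/measurable_EFinP; apply: measurable_indic; exact: measurable_cboxo.
- move=> z _; rewrite lee_fin indicE; have [h|h] := pselect (cboxo 1 2 1 2 z); last first.
    by rewrite memNset // sqnorm_ge0.
  rewrite mem_set //; move: h; rewrite /cboxo /= => /andP[/andP[a b] /andP[c d]].
  have h1 x : 1 < x -> x <= 2 -> smi 0 2 1 x = 1.
    by move=> x1 x2; apply: smi_in => //; rewrite add0r ltW.
  by rewrite /Phi /tens !h1 // mulr1 sqnormE nc1 expr1n.
Qed.

Section degree.
Variable p : {poly C}.
Hypothesis sp : (1 < size p)%N.

Let H (s z : C) : C := rc (sqnorm (Phi (hom p s z))) * rc (sqnorm (hom (deriv p) s z)).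

Let size_dp : size (deriv p) = (size p).-1.
Proof.
rewrite /deriv size_poly_eq //; case E : (size p) sp => [|[|n]] //= _.
by rewrite mulrn_eq0 /= -[n.+1]/(n.+2.-1) -E -lead_coefE lead_coef_eq0 -size_poly_eq0 E.
Qed.

Let last_p : last 0 p != 0.
Proof. by rewrite -nth_last -lead_coefE lead_coef_eq0 -size_poly_gt0 ltnW. Qed.

Let cH s z : ccont (H s) z.
Proof.
apply: ccont_mul; last by apply: ccont_rcf; exact: hom_ccont.
by apply: ccont_rcf; apply: ccont_comp; [exact: cPhi|exact: hom_ccont].
Qed.

(** With s = 1/R, [hom p s z] is R^(-N) p(R z), N the degree. The dilation in the source and the one
    in the target compensate exactly, so this integral does not depend on s. *)
Let H_inv (n : nat) : CI muC (H (rc n.+1%:R^-1)) = rc (cP p * fine (\int[muC]_z F z)%E).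
Proof.
set R : Rr := n.+1%:R; have R0 : 0 < R by [].
have S0 : 0 < R^-1 by rewrite invr_gt0.
set N := (size p).-1; have N0 : (0 < N)%N by rewrite /N; case: (size p) sp => [|[]].
have sN : size p = N.+1 by rewrite /N prednK // ltnW.
have rsz : rc R^-1 != 0 by rewrite -nc_eq0 nc_rc normr_eq0 gt_eqF.
have RS : rc R^-1 * rc R = 1 by rewrite -rcM mulVf // gt_eqF.
have h1 z : hom p (rc R^-1) z = rc R^-1 ^+ N * p.[rc R * z].
  have := hom_scale p (rc R^-1) (rc R * z); rewrite mulrA RS mul1r hom1 sN exprSr -mulrA mulrCA.
  by rewrite mulrC => /(mulfI rsz).
have h2 z : hom (deriv p) (rc R^-1) z = rc R^-1 ^+ N.-1 * (deriv p).[rc R * z].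
  have := hom_scale (deriv p) (rc R^-1) (rc R * z); rewrite mulrA RS mul1r hom1 size_dp -/N.
  by rewrite -{1}(prednK N0) exprSr -mulrA mulrCA mulrC => /(mulfI rsz).
have rcX (x : Rr) k : rc x ^+ k = rc (x ^+ k) by rewrite rmorphXn.
have SN0 : 0 < R^-1 ^+ N by rewrite exprn_gt0.
pose K z : \bar Rr := (F (rc (R^-1 ^+ N) * p.[z])%R * (sqnorm (deriv p).[z])%:E)%E.
have mK : measurable_fun setT K.
  apply: emeasurable_funM.
    apply: (measurableT_comp mF); apply: measurable_ccont => z.
    by apply: ccont_mul; [exact: ccont_cst|exact: ccont_poly].
  by apply/measurable_EFinP; apply: measurable_sqnorm; apply: measurable_ccont => z; exact: ccont_poly.
have K0 z : (0%E <= K z)%E by rewrite mule_ge0 // lee_fin sqnorm_ge0.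
have mFs : measurable_fun setT (fun x => F (rc (R^-1 ^+ N) * x)%R).
  apply: (measurableT_comp mF); apply: measurable_ccont => z.
  by apply: ccont_mul; [exact: ccont_cst|exact: ccont_id].
have E3 : (\int[muC]_z F z = ((R^-1 ^+ N) ^+ 2)%:E * \int[muC]_z F (rc (R^-1 ^+ N) * z)%R)%E.
  rewrite -(integral_affine 0 SN0) // -ge0_integralZl ?lee_fin ?sqr_ge0 //.
  by apply: eq_integral => z _; rewrite addr0 muleC.
have E2 := poly_pushforward sp mFs (fun z => F0 _).
have E1 := integral_affine 0 R0 mK K0.
have EH : (\int[muC]_z (Re (H (rc R^-1) z))%:E = (cP p)%:E * \int[muC]_z F z)%E.
  rewrite E3 muleCA -E2 -[X in (_ * X)%E]E1 -ge0_integralZl ?lee_fin ?sqr_ge0 //; last 2 first.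
  - apply: emeasurable_funM; last exact: measurable_cst.
    apply: (measurableT_comp mK); apply: measurable_ccont => z.
    by apply: ccont_add; [apply: ccont_mul; [exact: ccont_cst|exact: ccont_id]|exact: ccont_cst].
  - by move=> z _; rewrite mule_ge0 // lee_fin sqr_ge0.
  apply: eq_integral => z _; rewrite /K /F addr0 /H h1 h2 -!EFinM; congr EFin.
  rewrite ReM_rc !rcX sqnormM sqnorm_rc.
  have -> : R^-1 ^+ N.-1 = R^-1 ^+ N * R.
    by rewrite -{2}(prednK N0) exprSr -mulrA mulVf ?mulr1 // gt_eqF.
  by ring.
apply: complexP => /=.
  rewrite /Rintegral EH; have [I _ ->] := I0; by rewrite -EFinM.
transitivity (\int[muC]_(z in setT) (0 : Rr))%R; last by rewrite Rintegral_cst // mul0r.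
by apply: eq_Rintegral => z _; rewrite mulr0 mul0r addr0.
Qed.

(** Let s = 1/(n+1) tend to 0 in [H_inv]: the constant sequence of integrals converges, by dominated
    convergence, to the integral of the leading monomials. *)
Lemma cP_homog : rc (cP p * fine (\int[muC]_z F z)%E) =
  CI muC (fun z => rc (sqnorm (Phi (lead_coef p * z ^+ (size p).-1))) *
    rc (sqnorm ((lead_coef p *+ (size p).-1) * z ^+ (size p).-2))).
Proof.
have [M TM] := tens_cpt (rC1c_smi ltr01 le02) (rC1c_smi ltr01 le02).
have [M' HM'] := hom_proper M last_p sp; have [B HB] := hom_bound (deriv p) M'.
have s1 n : nc (rc n.+1%:R^-1) <= 1 by rewrite nc_rc ger0_norm ?invr_ge0 // invf_le1 // ler1n.
have e0 : hom p 0 = fun z => lead_coef p * z ^+ (size p).-1.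
  by apply/funext => z; rewrite hom0 -nth_last -lead_coefE.
have e1 : hom (deriv p) 0 = fun z => (lead_coef p *+ (size p).-1) * z ^+ (size p).-2.
  apply/funext => z; rewrite hom0 -nth_last size_dp coef_deriv lead_coefE.
  by case: (size p) sp => [|[]].
have dom n z : nc (H (rc n.+1%:R^-1) z) <= B ^+ 2 * \1_(csq M') z.
  have [h|h] := leP M' (nc z).
    have sq0 : rc (sqnorm 0) = 0 by rewrite sqnormE nc0 expr0n.
    by rewrite /H /Phi TM ?HM' // sq0 mul0r nc0 mulr_ge0 // sqr_ge0.
  rewrite indicE mem_set ?mulr1; last by apply: csq_nc; exact: ltW.
  rewrite /H ncM -[leRHS]mul1r ler_pM ?nc_ge0 ?Phi_le1 // nc_rc ger0_norm ?sqnorm_ge0 // sqnormE.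
  by rewrite lerXn2r ?nnegrE ?nc_ge0 ?HB //; [exact: le_trans (nc_ge0 _) (HB _ _ (s1 n) (ltW h))|exact: ltW].
have lim z : ccvg (fun n => H (rc n.+1%:R^-1) z) (H 0 z).
  have cs : ccvg (fun n => rc (n.+1%:R^-1 : Rr)) 0.
    apply: ccvg_rc => e /inv_nat_eventually[N HN]; exists N => n /HN h.
    by rewrite ger0_norm // invr_ge0.
  apply: (ccvg_ccont (F := fun s => H s z)) cs.
  apply: ccont_mul; last by apply: ccont_rcf; exact: hom_ccont_s.
  by apply: ccont_rcf; apply: ccont_comp; [exact: cPhi|exact: hom_ccont_s].
have [_ cv] := CI_dominated (fun n => measurable_ccont (@cH _)) (measurable_ccont (@cH 0))
  (integrable_csq M' (B ^+ 2)) dom (aeW muC lim).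
transitivity (CI muC (H 0)); last by rewrite /H e0 e1.
apply: (ccvg_unique (u := fun n => CI muC (H (rc n.+1%:R^-1)))) cv.
by under eq_fun do rewrite H_inv; exact: ccvg_cst.
Qed.

End degree.

(** Lets the constant be pulled out when the polynomial varies with a parameter that affects neither
    degree nor leading coefficient. *)
Lemma cP_eq (p q : {poly C}) : (1 < size p)%N -> size p = size q ->
  lead_coef p = lead_coef q -> cP p = cP q.
Proof.
move=> sp spq lpq; have sq : (1 < size q)%N by rewrite -spq.
have := cP_homog sp; rewrite spq lpq -(cP_homog sq) => -[].
have [I Ip ->] := I0; apply: mulIf; by rewrite gt_eqF.
Qed.

End cP_lead.

(** * Measurability of points and of inversion *)

Lemma set1C_preim (x : C) : pairc @^-1` [set x] = [set Re x] `*` [set Im x].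
Proof.
apply/seteqP; split => -[a b] /=; first by move=> <-.
by move=> [-> ->]; case: x.
Qed.

Lemma measurableC_set1 (x : C) : measurable [set x].
Proof.
rewrite (_ : [set x] = cpair @^-1` (pairc @^-1` [set x])).
  rewrite set1C_preim -[X in measurable X]setTI; apply: measurable_cpair => //.
  by apply: measurableX; exact: measurable_set1.
by apply/seteqP; split => z /=; rewrite cpairK.
Qed.

Lemma muC_set1 (x : C) : muC [set x] = 0%E.
Proof.
rewrite /muC set1C_preim product_measure1E; [|exact: measurable_set1..].
by transitivity ((leb [set Re x]) * 0)%E; [congr (_ * _)%E; exact: lebesgue_measure_set1|exact: mule0].
Qed.

Lemma measurable_ccont_on (D : set C) F : measurable D -> (forall z, D z -> ccont F z) ->
  measurable_fun D (fun z => Re (F z) : mR) /\ measurable_fun D (fun z => Im (F z) : mR).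
Proof.
move=> mD cF; split; apply: (measurable_fun_basis measurable_cbox mD) => z e Dz e0;
  have e2 : 0 < e / 2 by rewrite divr_gt0.
  have [de de0 H] := cF z Dz _ e2; have [q qz Hq] := cbox_near z de0.
  exists q => // w Dw /Hq/H h; rewrite -ReB; apply: le_lt_trans (Re_le_nc _) _.
  by apply: le_lt_trans h _; rewrite ltr_pdivrMr // ltr_pMr // ltr1n.
have [de de0 H] := cF z Dz _ e2; have [q qz Hq] := cbox_near z de0.
exists q => // w Dw /Hq/H h; rewrite -ImB; apply: le_lt_trans (Im_le_nc _) _.
by apply: le_lt_trans h _; rewrite ltr_pdivrMr // ltr_pMr // ltr1n.
Qed.

Lemma measurableC_V : measurable_fun setT (fun z : C => z^-1).
Proof.
have m0 := measurableC_set1 0; have mc := measurableC m0.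
have cV z : (~` [set (0 : C)]) z -> ccont (fun z => z^-1) z.
  by move=> /eqP z0; apply: ccont_inv => //; exact: ccont_id.
have [mr mi] := measurable_ccont_on mc cV.
apply: measurable_fun_complex; rewrite -(setUv [set (0 : C)]); apply/measurable_funU => //;
  by split => //; exact: measurable_fun_set1.
Qed.

Lemma measurableC_inv d (T : measurableType d) (f : T -> C) : measurable_fun setT f ->
  measurable_fun setT (fun x => (f x)^-1).
Proof. exact: measurableT_comp measurableC_V. Qed.

Lemma rcont_cst (k x : Rr) : rcont (fun=> k) x.
Proof. by move=> e e0; exists 1 => // y _; rewrite subrr normr0 ltW. Qed.

(** * Reproducing formula on the unit disc *)

Section recip.
Variable q : Rr.
Hypothesis q0 : 0 < q.

(* the C^1 function equal to 1/r for r >= q *)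
Definition krec r : Rr := if r < q then (2 * q - r) / q ^+ 2 else r^-1.

Lemma rder_krec r : rder krec (- (Num.max r q ^+ 2)^-1) r.
Proof.
move=> e e0; have qn : q != 0 by rewrite gt_eqF.
have [rq|qr] := ltP r q.
  exists (q - r); first by rewrite subr_gt0.
  move=> t; rewrite ltr_norml => /andP[_ t2]; rewrite /krec rq ifT; last by lra.
  rewrite (_ : _ - _ = 0); last by field.
  by rewrite normr0 mulr_ge0 //; exact: ltW.
have r0 := lt_le_trans q0 qr; have rn : r != 0 by rewrite gt_eqF.
have eq0 : 0 < e * q ^+ 3 by rewrite mulr_gt0 // exprn_gt0.
exists (Num.min (e * q ^+ 3) (if q < r then r - q else 1)).
  by rewrite lt_min eq0; case: ifP => /= h; rewrite ?subr_gt0 ?ltr01.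
move=> t; rewrite lt_min => /andP[t1 t2]; rewrite {2}/krec ltNge qr /=.
have [rtq|qrt] := ltP (r + t) q; last first.
  have rt0 := lt_le_trans q0 qrt; have rtn : r + t != 0 by rewrite gt_eqF.
  rewrite /krec ltNge qrt /= (_ : _ - _ = t ^+ 2 / (r ^+ 2 * (r + t))); last by field; do ?(apply/andP; split).
  have p3 : 0 < r ^+ 2 * (r + t) by rewrite mulr_gt0 // exprn_gt0.
  rewrite normrM normrX (ger0_norm (_ : 0 <= (r ^+ 2 * (r + t))^-1)) ?invr_ge0 ?(ltW p3) // ler_pdivrMr //.
  have P3 : q ^+ 3 <= r ^+ 2 * (r + t).
    by rewrite exprSr ler_pM ?exprn_ge0 ?lerXn2r ?nnegrE ?(ltW q0) ?(ltW r0).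
  have h1 := ler_wpM2r (normr_ge0 t) (ltW t1).
  have h2 := ler_wpM2l (mulr_ge0 (ltW e0) (normr_ge0 t)) P3.
  apply: le_trans h2; apply: le_trans (_ : e * q ^+ 3 * `|t| <= _); first by rewrite expr2.
  by rewrite mulrAC.
move: t2; case: ifP => [qr' /ltW|/negbT]; first by rewrite ler_norml => /andP[h _]; exfalso; lra.
rewrite -leNgt => rq _; have {rq}rq : r = q by apply: le_anti; rewrite rq.
rewrite rq in rtq *; rewrite /krec rtq (_ : _ - _ = 0); last by field.
by rewrite normr0 mulr_ge0 //; exact: ltW.
Qed.

(** The left side is the derivative of r [krec] r. It vanishes for r >= q, where r [krec] r is
    constantly 1. *)
Lemma krecE r : krec r - r * (Num.max r q ^+ 2)^-1 = 2 * pos (q - r) / q ^+ 2.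
Proof.
have qn : q != 0 by rewrite gt_eqF.
have [rq|qr] := ltP r q.
  by rewrite /krec rq pos_ge0 ?subr_ge0; [field|exact: ltW].
have rn : r != 0 by rewrite gt_eqF // (lt_le_trans q0).
rewrite /krec ltNge qr /= pos_le0; last by rewrite subr_le0.
by field; rewrite ?rn ?qn.
Qed.

Lemma krec_bound r : 0 <= r -> 0 <= r * krec r <= 1.
Proof.
move=> r0; rewrite /krec; have [rq|qr] := ltP r q; last first.
  by rewrite mulfV ?gt_eqF ?lexx ?ler01 ?(lt_le_trans q0).
have q2 : 0 < q ^+ 2 by rewrite exprn_gt0.
rewrite mulrA ler_pdivlMr // ler_pdivrMr // mul0r mul1r.
by apply/andP; split; nra.
Qed.

End recip.

Definition C1at (f A B : C -> C) z := [/\ Wd f (A z) (B z) z, ccont A z & ccont B z].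

Lemma eq_C1at f A B f' A' B' z : f =1 f' -> A =1 A' -> B =1 B' -> C1at f A B z -> C1at f' A' B' z.
Proof. by move=> /funext -> /funext -> /funext ->. Qed.

Lemma C1at_mul f A B g A' B' z : C1at f A B z -> C1at g A' B' z ->
  C1at (fun w => f w * g w) (fun w => f w * A' w + A w * g w) (fun w => f w * B' w + B w * g w) z.
Proof.
move=> [W cA cB] [W' cA' cB']; have cf := Wd_ccont W; have cg := Wd_ccont W'.
by split; [exact: Wd_mul|apply: ccont_add; exact: ccont_mul|apply: ccont_add; exact: ccont_mul].
Qed.

Lemma ccont_sqnorm z : ccont (fun w => rc (sqnorm w)) z.
Proof. by apply: (ccont_rcf (F := id)); exact: ccont_id. Qed.

Lemma C1at_sqnorm (h h' : Rr -> Rr) z : rder h (h' (sqnorm z)) (sqnorm z) ->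
  ccont (fun w => rc (h' (sqnorm w))) z ->
  C1at (fun w => rc (h (sqnorm w))) (fun w => rc (h' (sqnorm w)) * cj w) (fun w => rc (h' (sqnorm w)) * w) z.
Proof.
move=> dh ch; split; last 2 first.
- by apply: ccont_mul => //; exact: ccont_cj.
- by apply: ccont_mul => //; exact: ccont_id.
have W : Wd (fun w => rc (sqnorm w)) (cj z) z z.
  have -> : (fun w => rc (sqnorm w)) = (fun w => w * cj w) by apply/funext => w; rewrite mul_cj.
  by apply: eq_Wd (Wd_mul (Wd_id z) (Wd_cj z)); rewrite ?mulr0 ?mul0r ?mulr1 ?mul1r ?add0r ?addr0.
have := Wd_comp (Wd_re (z := rc (sqnorm z)) dh) W; apply: eq_Wd; rewrite ?conjcK -mulrDr.
  by apply: complexP; rewrite !(ReM, ImM, ReD, ImD) /=; field.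
by apply: complexP; rewrite !(ReM, ImM, ReD, ImD) /=; field.
Qed.

Lemma C1at_shift f A B x z : C1at f A B (z - x) ->
  C1at (fun w => f (w - x)) (fun w => A (w - x)) (fun w => B (w - x)) z.
Proof.
move=> [W cA cB].
have cs : ccont (fun w => w - x) z by apply: ccont_sub; [exact: ccont_id|exact: ccont_cst].
split; [|exact: (ccont_comp (F := A))|exact: (ccont_comp (F := B))].
have := Wd_comp (f := f) (g := fun w => w - x) W (Wd_sub (Wd_id z) (Wd_cst x z)).
by apply: eq_Wd; rewrite !subr0 ?conjc1 ?conjc0 ?mulr0 ?mulr1 ?addr0 ?add0r.
Qed.

Section regularized.
Variable q : Rr.
Hypothesis q0 : 0 < q.

(** A C^1 regularisation of 1/u, equal to it once |u|^2 >= q. Its conj(u)-derivative [Rqb] is a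
    nonnegative bump on the small disc, an approximate point mass. *)
Definition Rq (u : C) : C := cj u * rc (krec q (sqnorm u)).
Definition Rqb (u : C) : C := rc (2 * pos (q - sqnorm u) / q ^+ 2).

Lemma C1at_Rq : exists A, forall z, C1at Rq A Rqb z.
Proof.
pose h' r := - (Num.max r q ^+ 2)^-1.
exists (fun w => cj w * (rc (h' (sqnorm w)) * cj w) + 0 * rc (krec q (sqnorm w))) => z.
have mxE r : Num.max r q = q + pos (1 * r + - q).
  by rewrite mul1r; have [h|h] := ltP r q; [rewrite pos_le0|rewrite pos_ge0]; lra.
have mx0 r : Num.max r q != 0 by rewrite gt_eqF // lt_max q0 orbT.
have cm : ccont (fun w => rc (Num.max (sqnorm w) q)) z.
  apply: (ccont_comp (F := fun w => rc (Num.max (Re w) q)) (G := fun w => rc (sqnorm w))).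
    apply: (ccont_re (u := fun r => Num.max r q)); under [X in rcont X _]eq_fun do rewrite mxE.
    by apply: rcont_add; [exact: rcont_cst|apply: rcont_affine; exact: rcont_pos].
  exact: ccont_sqnorm.
have ch : ccont (fun w => rc (h' (sqnorm w))) z.
  have -> : (fun w => rc (h' (sqnorm w))) = fun w => - ((rc (Num.max (sqnorm w) q)) ^+ 2)^-1.
    by apply/funext => w; rewrite /h' rmorphN fmorphV rmorphXn.
  apply: ccont_opp; apply: ccont_inv; last exact: ccont_exp.
  by rewrite expf_neq0 // -nc_eq0 nc_rc normr_eq0.
have H1 := C1at_sqnorm (rder_krec q0 (sqnorm z)) ch.
have H2 : C1at cj (fun=> 0) (fun=> 1) z by split; [exact: Wd_cj|exact: ccont_cst|exact: ccont_cst].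
apply: eq_C1at (C1at_mul H2 H1) => // w.
rewrite mul1r mulrCA [cj w * w]mulrC mul_cj -rcM -rcD /Rqb -(krecE q0); congr rc.
by rewrite /h'; ring.
Qed.

Lemma RqE u : q <= sqnorm u -> Rq u = u^-1.
Proof.
move=> qu; rewrite /Rq /krec ltNge qu /=.
have u0 : u != 0.
  by apply/eqP => u0; move: qu; rewrite u0 sqnormE nc0 expr0n leNgt q0.
by apply: (mulfI u0); rewrite mulrA mul_cj divff // -rcM mulfV // sqnormE expf_neq0 // nc_eq0.
Qed.

Lemma mul_Rq u : u * Rq u = rc (sqnorm u * krec q (sqnorm u)).
Proof. by rewrite /Rq mulrA mul_cj rcM. Qed.

End regularized.

Lemma nc_sqnorm_le1 z : nc z <= 1 -> sqnorm z <= nc z.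
Proof. by move=> z1; rewrite sqnormE expr2 -[leRHS]mulr1 ler_wpM2l ?nc_ge0. Qed.

(** Pi times the Bergman kernel of the unit disc at (x, l). *)
Definition kb (x l : C) : C := ((1 - cj l * x) ^+ 2)^-1.

Lemma kb_den x l : nc l <= 1 -> 1 - nc x <= nc (1 - cj l * x).
Proof.
move=> l1; have := nc_ge_sub 1 (- (cj l * x)); rewrite ncN nc1; apply: le_trans.
by rewrite lerB // ncM nc_cj -[leRHS]mul1r ler_wpM2r ?nc_ge0.
Qed.

Lemma measurable_kb x : measurable_fun setT (kb x).
Proof.
apply: measurableC_inv; apply: measurable_ccont => z; apply: ccont_exp; apply: ccont_sub.
  exact: ccont_cst.
by apply: ccont_mul; [exact: ccont_cj|exact: ccont_cst].
Qed.

(** The profile of the approximate point mass after rescaling to the unit disc. Its integral [c0] is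
    pi. *)
Definition c0fun (v : C) : C := rc (2 * pos (1 - sqnorm v)).
Definition c0 : Rr := Re (CI muC c0fun).

Lemma ccont_pos_sqnorm (k c : Rr) z : ccont (fun w => rc (pos (k * sqnorm w + c))) z.
Proof.
apply: (ccont_comp (F := fun w => rc (pos (k * Re w + c))) (G := fun w => rc (sqnorm w))); last exact: ccont_sqnorm.
by apply: (ccont_re (u := fun r => pos (k * r + c))); apply: rcont_affine; exact: rcont_pos.
Qed.

Lemma ccont_c0fun z : ccont c0fun z.
Proof.
have -> : c0fun = fun w => rc 2 * rc (pos (-1 * sqnorm w + 1)).
  by apply/funext => w; rewrite /c0fun -rcM; congr (rc (_ * pos _)); ring.
by apply: ccont_mul; [exact: ccont_cst|exact: ccont_pos_sqnorm].
Qed.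

Lemma c0fun_out v : 1 <= nc v -> c0fun v = 0.
Proof.
move=> v1; rewrite /c0fun pos_le0 ?mulr0 // subr_le0 sqnormE.
by rewrite -[leLHS](expr1n _ 2) lerXn2r ?nnegrE ?nc_ge0 ?ler01.
Qed.

Lemma pos_nng x : 0 <= pos x. Proof. by rewrite /pos le_max lexx orbT. Qed.

(** On the square with sides ]0, 1/2] one has |v|^2 <= 1/2, so the profile is at least 1 there. *)
Lemma c0_gt0 : 0 < c0.
Proof.
have [fin _] := cintegrable_ccont ccont_c0fun c0fun_out.
have ff := integrable_fin_num measurableT fin.
have mb := measurable_cboxo 0 (1 / 2) 0 (1 / 2).
have E1 : (\int[muC]_z (\1_(cboxo 0 (1 / 2) 0 (1 / 2)) z)%:E = (1 / 4)%:E)%E.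
  rewrite integral_indic // setIT.
  transitivity (((1 / 2 - 0) * (1 / 2 - 0))%:E : \bar Rr); last by congr EFin; field.
  by apply: muC_cboxo; lra.
rewrite /c0 /CI /= /Rintegral -lte_fin fineK //; apply: lt_le_trans (_ : ((1 / 4)%:E <= _)%E) => //.
  by rewrite lte_fin; lra.
rewrite -E1; apply: ge0_le_integral => //.
- by apply/measurable_EFinP; exact: measurable_indic.
- by apply/measurable_EFinP; exact: (mRe (measurable_ccont ccont_c0fun)).
- move=> z _; rewrite lee_fin indicE; have [h|h] := pselect (cboxo 0 (1 / 2) 0 (1 / 2) z); last first.
    by rewrite memNset // mulr_ge0 ?pos_nng.
  rewrite mem_set //; move: h; rewrite /cboxo /sqnorm /= => /andP[/andP[a b] /andP[c d]].
  by rewrite pos_ge0; nra.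
Qed.

Lemma C1at_inv f A B z : f z != 0 -> C1at f A B z ->
  C1at (fun w => (f w)^-1) (fun w => - A w / f w ^+ 2) (fun w => - B w / f w ^+ 2) z.
Proof.
move=> fz [W cA cB]; have cf := Wd_ccont W.
have ci : ccont (fun w => (f w ^+ 2)^-1) z by apply: ccont_inv; [rewrite expf_neq0|exact: ccont_exp].
by split; [exact: Wd_inv|apply: ccont_mul ci; exact: ccont_opp..].
Qed.

Section disc_step.
Variables (g : C -> C) (x : C) (e : Rr).
Local Notation d := (1 - nc x).
Hypothesis (x1 : nc x < 1) (e0 : 0 < e) (ed : e <= d / 8).
Hypothesis gi : cintegrable muC g.
Hypothesis gd : forall z, nc z < 1 -> exists c, Wd g c 0 z.
Hypothesis g0 : forall z, 1 <= nc z -> g z = 0.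

Let d0 : 0 < d. Proof. by rewrite subr_gt0. Qed.
Let q0 : 0 < e ^+ 2. Proof. by rewrite exprn_gt0. Qed.

(** A cutoff in r = |l|^2: it is 1 up to 1 - 2e and 0 from 1 - e on. *)
Definition hc r := stp (- e^-1 * r + (e^-1 - 1)).
Definition dhc r := - e^-1 * dstp (- e^-1 * r + (e^-1 - 1)).
(** A conj(l)-primitive of (l - x) [kb x l] that vanishes on the unit circle and equals -1 at l =
    x. *)
Definition Mx (l : C) : C := (rc (sqnorm l) - 1) * (1 - cj l * x)^-1.
(** [T1], [T2], [T3] are g times the three terms of the conj(l)-derivative of cutoff * [Mx] * [Rq]:
    derivative on the cutoff (boundary layer), on [Mx] (the kernel), on [Rq] (point mass at x). *)
Definition T1 l := g l * (rc (dhc (sqnorm l)) * l * (Mx l * Rq (e ^+ 2) (l - x))).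
Definition T2 l := g l * (rc (hc (sqnorm l)) * (kb x l * ((l - x) * Rq (e ^+ 2) (l - x)))).
Definition T3 l := g l * (rc (hc (sqnorm l)) * (Mx l * Rqb (e ^+ 2) (l - x))).

Let argE r : e * (- e^-1 * r + (e^-1 - 1)) = 1 - r - e.
Proof. by field; rewrite gt_eqF. Qed.

Lemma hc_out r : 1 - e <= r -> hc r = 0 /\ dhc r = 0.
Proof.
move=> h; rewrite /hc /dhc; have [|-> -> _] := @stp_le0 (- e^-1 * r + (e^-1 - 1)); last by rewrite mulr0.
by rewrite -(ler_pM2l e0) argE mulr0; move: h; lra.
Qed.

Lemma hc_in r : r <= 1 - 2 * e -> hc r = 1 /\ dhc r = 0.
Proof.
move=> h; rewrite /hc /dhc; have [|-> -> _] := @stp_ge1 (- e^-1 * r + (e^-1 - 1)); last by rewrite mulr0.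
by rewrite -(ler_pM2l e0) argE mulr1; move: h; lra.
Qed.

Lemma hc_le1 r : `|hc r| <= 1.
Proof. by rewrite ger0_norm; have [/andP[]] := stp_bound (- e^-1 * r + (e^-1 - 1)). Qed.

Lemma den_neq0 l : nc l <= 1 -> 1 - cj l * x != 0.
Proof. by move=> l1; rewrite -nc_gt0; apply: lt_le_trans (kb_den x l1). Qed.

Lemma kb_le l : nc l <= 1 -> nc (kb x l) <= (d ^+ 2)^-1.
Proof.
move=> l1; rewrite /kb ncV ncX lef_pV2 ?posrE ?exprn_gt0 //.
  by rewrite lerXn2r ?nnegrE ?nc_ge0 ?(ltW d0) // kb_den.
by rewrite nc_gt0 den_neq0.
Qed.

Lemma Mx_le l : nc l <= 1 -> nc (Mx l) <= (1 - sqnorm l) / d.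
Proof.
move=> l1; have s1 : sqnorm l <= 1 by apply: le_trans (nc_sqnorm_le1 l1) l1.
rewrite /Mx ncM ncV -(rmorph1 (real_complex Rr)) -rcB nc_rc ler0_norm ?subr_le0 // opprB.
by rewrite ler_wpM2l ?subr_ge0 // lef_pV2 ?posrE // ?kb_den // nc_gt0 den_neq0.
Qed.

Let C1at_sq1 z : C1at (fun l => rc (sqnorm l) - 1) cj id z.
Proof.
split; [|exact: ccont_cj|exact: ccont_id].
have -> : (fun w => rc (sqnorm w) - 1) = (fun w => w * cj w - 1) by apply/funext => w; rewrite mul_cj.
by apply: eq_Wd (Wd_sub (Wd_mul (Wd_id z) (Wd_cj z)) (Wd_cst 1 z)); ring.
Qed.

Let C1at_den z : C1at (fun l => 1 - cj l * x) (fun=> 0) (fun=> - x) z.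
Proof.
split; [|exact: ccont_cst..].
by apply: eq_Wd (Wd_sub (Wd_cst 1 z) (Wd_mul (Wd_cj z) (Wd_cst x z))); ring.
Qed.

Let C1at_chi z : C1at (fun l => rc (hc (sqnorm l))) (fun l => rc (dhc (sqnorm l)) * cj l)
  (fun l => rc (dhc (sqnorm l)) * l) z.
Proof.
apply: C1at_sqnorm; first by apply: rder_affine; exact: rder_stp.
apply: (ccont_comp (F := fun w => rc (dhc (Re w))) (G := fun w => rc (sqnorm w))); last exact: ccont_sqnorm.
by apply: (ccont_re (u := dhc)); apply: rcont_scale; apply: rcont_affine; exact: rcont_dstp.
Qed.

(** The product rule identifies the sum with g times a conj(l)-derivative of a function supported
    inside the disc, so [goursat] applies. *)
Lemma T_sum : CI muC (fun l => T1 l + T2 l + T3 l) = 0.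
Proof.
have [AR HR] := C1at_Rq q0.
have CM z (z1 : nc z < 1) := C1at_mul (C1at_sq1 z) (C1at_inv (f := fun l => 1 - cj l * x) (den_neq0 (ltW z1)) (C1at_den z)).
have C2 z (z1 : nc z < 1) := C1at_mul (C1at_chi z) (C1at_mul (CM z z1) (C1at_shift (HR (z - x)))).
have rho1 : 1 - e / 2 < 1 by move: e0; lra.
have := goursat (g := g) rho1 (C1c_local rho1 C2 _) gi gd.
have out z : 1 - e / 2 <= nc z -> hc (sqnorm z) = 0 /\ dhc (sqnorm z) = 0.
  move=> h; apply: hc_out; rewrite sqnormE.
  have e1 : e <= 1 by apply: le_trans ed _; have := nc_ge0 x; lra.
  apply: le_trans (_ : (1 - e / 2) ^+ 2 <= _).
    by have := sqr_ge0 (e / 2); move: e1; nra.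
  by rewrite lerXn2r ?nnegrE ?nc_ge0 //; move: e1; lra.
move=> H; rewrite -[RHS]H.
  apply: eq_CI => z; have [z1|z1] := ltP (nc z) 1; last by rewrite /T1 /T2 /T3 g0 // !mul0r !addr0.
  have Dn := den_neq0 (ltW z1); rewrite /T1 /T2 /T3 /Mx /kb -mul_cj.
  have en : rc e != 0 by rewrite -nc_eq0 nc_rc normr_eq0 gt_eqF.
  by field; apply/andP; split; [exact: Dn|exact: en].
by move=> z /out[-> ->]; split; rewrite !(mul0r, addr0).
Qed.

(** In the layer 1 - 2e < |l|^2 < 1 - e the cutoff has slope at most 2/e, while |Mx| <= 2e/d because
    [Mx] vanishes on the circle; the powers of e cancel. The assumption e <= d/8 keeps the layer at
    distance at least d/2 from x, which bounds |Rq| by 2/d. *)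
Lemma T1_le l : nc (T1 l) <= nc (g l) * (8 / d ^+ 2).
Proof.
have p0 : 0 <= 8 / d ^+ 2 by rewrite divr_ge0 // sqr_ge0.
have [l1|l1] := ltP (nc l) 1; last by rewrite /T1 g0 // mul0r nc0 mul0r.
rewrite /T1 ncM ler_wpM2l ?nc_ge0 //.
have [h|h1] := leP (1 - e) (sqnorm l); first by have [_ ->] := hc_out h; rewrite !mul0r nc0.
have [h|h2] := leP (sqnorm l) (1 - 2 * e); first by have [_ ->] := hc_in h; rewrite !mul0r nc0.
have sl := nc_sqnorm_le1 (ltW l1).
have lx : d / 2 <= nc (l - x).
  have := nc_ge_sub l (- x); rewrite ncN; apply: le_trans.
  by move: sl h2 ed; lra.
have e1 : e <= nc (l - x) by apply: le_trans lx; move: ed d0; lra.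
have qs : e ^+ 2 <= sqnorm (l - x) by rewrite sqnormE lerXn2r ?nnegrE ?nc_ge0 // ltW.
have n0 : 0 < nc (l - x) by apply: lt_le_trans e1.
rewrite RqE // ncM [nc (rc _ * l)]ncM nc_rc [nc (Mx l * _)]ncM ncV.
have b1 : `|dhc (sqnorm l)| <= 2 / e.
  have ei : 0 < e^-1 by rewrite invr_gt0.
  rewrite /dhc normrM normrN (gtr0_norm ei) [leLHS]mulrC ler_pM2r //.
  have [_ /andP[k0 k1]] := stp_bound (- e^-1 * sqnorm l + (e^-1 - 1)).
  by rewrite ger0_norm.
have b2 : nc (Mx l) <= 2 * e / d.
  apply: le_trans (Mx_le (ltW l1)) _; rewrite ler_wpM2r ?invr_ge0 ?(ltW d0) //.
  by move: h2; lra.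
have b3 : (nc (l - x))^-1 <= 2 / d.
  by rewrite -[2 / d]invf_div lef_pV2 ?posrE // divr_gt0.
have -> : 8 / d ^+ 2 = 2 / e * 1 * (2 * e / d * (2 / d)) by field; rewrite !gt_eqF.
apply: ler_pM; [by rewrite mulr_ge0 ?nc_ge0|by rewrite mulr_ge0 ?invr_ge0 ?nc_ge0| |].
  by apply: ler_pM; rewrite ?nc_ge0 //; exact: ltW.
by apply: ler_pM; rewrite ?invr_ge0 ?nc_ge0.
Qed.

Lemma T2_le l : nc (T2 l) <= nc (g l) * (d ^+ 2)^-1.
Proof.
have [l1|l1] := ltP (nc l) 1; last by rewrite /T2 g0 // mul0r nc0 mul0r.
rewrite /T2 ncM ler_wpM2l ?nc_ge0 // mul_Rq ncM nc_rc ncM nc_rc.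
have /andP[k0 k1] := krec_bound q0 (sqnorm_ge0 (l - x)).
rewrite (ger0_norm k0) -[leRHS]mul1r; apply: ler_pM; [by []|by rewrite mulr_ge0 ?nc_ge0|exact: hc_le1|].
by rewrite -[leRHS]mulr1; apply: ler_pM; rewrite ?nc_ge0 //; apply: kb_le; exact: ltW.
Qed.

(** Zooming in at x by the factor e turns the shrinking bump into the fixed profile [c0fun]. *)
Lemma T3_scale v : T3 (rc e * v + x) * rc (e ^+ 2) =
  g (rc e * v + x) * (rc (hc (sqnorm (rc e * v + x))) * (Mx (rc e * v + x) * c0fun v)).
Proof.
rewrite /T3 addrK; move: (Mx _) (g _) (rc (hc _)) => m gg hh; rewrite -!mulrA; do 3 congr (_ * _).
rewrite /Rqb /c0fun -rcM; congr (rc _).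
rewrite sqnormM sqnorm_rc (_ : e ^+ 2 - e ^+ 2 * sqnorm v = e ^+ 2 * (1 - sqnorm v)); last by ring.
have -> : pos (e ^+ 2 * (1 - sqnorm v)) = e ^+ 2 * pos (1 - sqnorm v).
  by rewrite /pos maxr_pMr ?mulr0 // ltW.
by field; rewrite gt_eqF.
Qed.

Lemma hc_near v : nc v <= 1 -> nc (rc e * v + x) < 1 /\ hc (sqnorm (rc e * v + x)) = 1.
Proof.
move=> v1; have h : nc (rc e * v + x) <= e + nc x.
  apply: le_trans (nc_triangle _ _) _; rewrite lerD2r ncM nc_rc gtr0_norm //.
  by rewrite -[leRHS]mulr1 ler_wpM2l // ltW.
have h1 : nc (rc e * v + x) < 1 by apply: le_lt_trans h _; move: ed d0; lra.
split=> //; have [] // := @hc_in (sqnorm (rc e * v + x)).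
apply: le_trans (nc_sqnorm_le1 (ltW h1)) _; apply: le_trans h _.
by move: ed d0; lra.
Qed.

Let mg : measurable_fun setT g. Proof. exact: cintegrable_measurable gi. Qed.

Let mMx : measurable_fun setT Mx.
Proof.
apply: measurableC_mul.
  by apply: measurable_ccont => z; have [W _ _] := C1at_sq1 z; exact: Wd_ccont W.
by apply: measurableC_inv; apply: measurable_ccont => z; have [W _ _] := C1at_den z; exact: Wd_ccont W.
Qed.

Let mhc : measurable_fun setT (fun l => rc (hc (sqnorm l))).
Proof. by apply: measurable_ccont => z; have [W _ _] := C1at_chi z; exact: Wd_ccont W. Qed.

Let mdhc : measurable_fun setT (fun l => rc (dhc (sqnorm l)) * l).
Proof. by apply: measurable_ccont => z; have [] := C1at_chi z. Qed.

Let mRq : measurable_fun setT (fun l : C => Rq (e ^+ 2) (l - x)).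
Proof.
have [A HA] := C1at_Rq q0.
by apply: measurable_ccont => z; have [W _ _] := C1at_shift (HA (z - x)); exact: Wd_ccont W.
Qed.

Let mRqb : measurable_fun setT (fun l : C => Rqb (e ^+ 2) (l - x)).
Proof.
have [A HA] := C1at_Rq q0.
by apply: measurable_ccont => z; have [] := C1at_shift (HA (z - x)).
Qed.

Let mlx : measurable_fun setT (fun l : C => l - x).
Proof. by apply: measurable_ccont => z; apply: ccont_sub; [exact: ccont_id|exact: ccont_cst]. Qed.

Lemma measurable_T1 : measurable_fun setT T1.
Proof. by apply: measurableC_mul => //; apply: measurableC_mul => //; exact: measurableC_mul. Qed.

Lemma measurable_T2 : measurable_fun setT T2.
Proof.
apply: measurableC_mul => //; apply: measurableC_mul => //; apply: measurableC_mul.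
  exact: measurable_kb.
exact: measurableC_mul.
Qed.

Lemma measurable_T3 : measurable_fun setT T3.
Proof. by apply: measurableC_mul => //; apply: measurableC_mul => //; exact: measurableC_mul. Qed.

End disc_step.

Section bergman_disc.
Variables (g : C -> C) (x : C).
Local Notation d := (1 - nc x).
Hypothesis (x1 : nc x < 1).
Hypothesis gi : cintegrable muC g.
Hypothesis gd : forall z, nc z < 1 -> exists c, Wd g c 0 z.
Hypothesis g0 : forall z, 1 <= nc z -> g z = 0.

Let d0 : 0 < d. Proof. by rewrite subr_gt0. Qed.
Let mg : measurable_fun setT g. Proof. exact: cintegrable_measurable gi. Qed.
Let cg : ccont g x. Proof. by have [c W] := gd x1; exact: Wd_ccont W. Qed.

Let scaleK (k : Rr) (F : C -> C) : 0 <= k -> measurable_fun setT F ->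
  (forall l, nc (F l) <= nc (g l) * k) -> cintegrable muC F.
Proof.
move=> k0 mF FK; apply: (cintegrable_le mF (cintegrable_nc (cintegrableZ (rc k) gi))) => l.
by apply: le_trans (FK l) _; rewrite ncM nc_rc ger0_norm // mulrC.
Qed.

Let domK (k : Rr) (F : nat -> C -> C) f : 0 <= k -> (forall n, measurable_fun setT (F n)) ->
  measurable_fun setT f -> (forall n l, nc (F n l) <= nc (g l) * k) ->
  {ae muC, forall l, ccvg (F^~ l) (f l)} ->
  cintegrable muC f /\ ccvg (fun n => CI muC (F n)) (CI muC f).
Proof.
move=> k0 mF mf FK ae; apply: (CI_dominated mF mf (cintegrable_nc (cintegrableZ (rc k) gi))) ae.
by move=> n l; apply: le_trans (FK n l) _; rewrite ncM nc_rc ger0_norm // mulrC.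
Qed.

Let CI_c0fun : CI muC c0fun = rc c0.
Proof.
apply: complexP => //=; transitivity (\int[muC]_(z in setT) (0 : Rr))%R => //.
by rewrite Rintegral_cst // mul0r.
Qed.

(** Let e tend to 0 in T1 + T2 + T3 with total integral 0. The boundary term tends to 0, the second
    to the integral of g [kb x], and the third to -c0 g(x), as [Mx] is -1 at x. *)
Theorem bergman_disc : cintegrable muC (fun l => g l * kb x l) /\
  CI muC (fun l => g l * kb x l) = rc c0 * g x.
Proof.
have [de de0 Hde] := ccont_local_bound cg.
(* Starting scale: small against the distance from x to the circle, and inside the disc of radius
   [de] where g is bounded. *)
have [m [m0 md mde]] : exists m : Rr, [/\ 0 < m, m <= d / 8 & m < de].
  exists (Num.min (d / 8) (de / 2)); split; [by rewrite lt_min !divr_gt0|by rewrite ge_min lexx|].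
  by rewrite gt_min; apply/orP; right; rewrite ltr_pdivrMr // ltr_pMr // ltr1n.
have [e eE] : exists e : nat -> Rr, forall n, e n = m * n.+1%:R^-1 by exists (fun n => m * n.+1%:R^-1).
have e0 n : 0 < e n by rewrite eE mulr_gt0 // invr_gt0.
have em n : e n <= m by rewrite eE -[leRHS]mulr1 ler_wpM2l ?(ltW m0) // invf_le1 // ler1n.
have ed n : e n <= d / 8 by apply: le_trans (em n) md.
have ede n : e n < de by apply: le_lt_trans (em n) mde.
have esmall (r : Rr) : 0 < r -> exists N, forall n, (N <= n)%N -> e n <= r.
  move=> r0; have [N HN] := inv_nat_eventually (divr_gt0 r0 m0); exists N => n /HN.
  by rewrite eE ler_pdivlMr // mulrC.
have d2 : 0 <= (d ^+ 2)^-1 by rewrite invr_ge0 sqr_ge0.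
have d8 : 0 <= 8 / d ^+ 2 by rewrite divr_ge0 // sqr_ge0.
have m1 n := measurable_T1 x (e0 n) gi; have m2 n := measurable_T2 x (e0 n) gi.
have m3 n := measurable_T3 x (e0 n) gi.
have inside l : nc l < 1 -> exists N, forall n, (N <= n)%N -> sqnorm l <= 1 - 2 * e n.
  move=> l1; have h : 0 < (1 - sqnorm l) / 2.
    by rewrite divr_gt0 // subr_gt0; apply: le_lt_trans (nc_sqnorm_le1 (ltW l1)) l1.
  have [N HN] := esmall _ h; exists N => n /HN; rewrite ler_pdivlMr // => {}h.
  by rewrite lerBrDr addrC -lerBrDr mulrC.
have b1 n l := T1_le x1 (e0 n) (ed n) g0 l.
have b2 n l := T2_le x1 (e0 n) g0 l.
have [_ c1] : cintegrable muC (fun=> 0) /\ ccvg (fun n => CI muC (T1 g x (e n))) (CI muC (fun=> 0)).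
  apply: (domK d8 m1 (measurable_cst (0 : C)) b1); apply: aeW => l.
  have [l1|l1] := ltP (nc l) 1; last first.
    by apply: (@ccvg_near (fun=> 0) _ _ 0) (ccvg_cst 0) => n _; rewrite /T1 g0 // mul0r.
  have [N HN] := inside l l1; apply: (@ccvg_near (fun=> 0) _ _ N) (ccvg_cst 0) => n /HN h.
  by rewrite /T1; have [_ ->] := hc_in (e0 n) h; rewrite !mul0r mulr0.
have [ik c2] : cintegrable muC (fun l => g l * kb x l) /\
    ccvg (fun n => CI muC (T2 g x (e n))) (CI muC (fun l => g l * kb x l)).
  apply: (domK d2 m2 _ b2); first by apply: measurableC_mul => //; exact: measurable_kb.
  (* The regularised quotient tends to 1 except at l = x, a null set. *)
  exists [set x]; split; [exact: measurableC_set1|exact: muC_set1|].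
  move=> l /= /contra_notP; apply => lx.
  have {}lx : 0 < nc (l - x) by rewrite nc_gt0 subr_eq0; apply/eqP.
  have [l1|l1] := ltP (nc l) 1; last first.
    by apply: (@ccvg_near (fun=> g l * kb x l) _ _ 0) (ccvg_cst _) => n _; rewrite /T2 g0 // !mul0r.
  have [N HN] := inside l l1; have [N' HN'] := esmall _ lx.
  apply: (@ccvg_near (fun=> g l * kb x l) _ _ (maxn N N')) (ccvg_cst _) => n.
  rewrite geq_max => /andP[/HN h /HN' h']; rewrite /T2; have [-> _] := hc_in (e0 n) h.
  rewrite RqE ?exprn_gt0 // ?mulfV -?nc_gt0 // ?mulr1 ?mul1r //.
  by rewrite sqnormE lerXn2r ?nnegrE ?nc_ge0 // ltW.
pose T3' n v := g (rc (e n) * v + x) * (rc (hc (e n) (sqnorm (rc (e n) * v + x))) * (Mx x (rc (e n) * v + x) * c0fun v)).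
pose K : Rr := (nc (g x) + 1) * (1 * (d^-1 * 2)).
have G0 : 0 <= nc (g x) + 1 by rewrite addr_ge0 // nc_ge0.
have K0 : 0 <= K by rewrite /K mul1r !mulr_ge0 // invr_ge0 ltW.
have b3 n v : nc (T3' n v) <= K * \1_(csq 1) v.
  have [v1|v1] := leP 1 (nc v); first by rewrite /T3' c0fun_out // !mulr0 nc0 mulr_ge0.
  rewrite indicE mem_set ?mulr1; last by apply: csq_nc; exact: ltW.
  have [near _] := hc_near x1 (e0 n) (ed n) (ltW v1).
  have nn : nc (rc (e n) * v + x - x) < de.
    rewrite addrK ncM nc_rc gtr0_norm //; apply: le_lt_trans (ede n).
    by rewrite -[leRHS]mulr1 ler_wpM2l // ltW.
  rewrite /T3' ncM; apply: ler_pM; rewrite ?nc_ge0 //; first exact: Hde.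
  rewrite ncM; apply: ler_pM; rewrite ?nc_ge0 //; first by rewrite nc_rc; exact: hc_le1.
  rewrite ncM; apply: ler_pM; rewrite ?nc_ge0 //.
    apply: le_trans (Mx_le x1 (ltW near)) _; rewrite -[leRHS]mul1r ler_wpM2r ?invr_ge0 ?(ltW d0) //.
    by rewrite lerBlDr lerDl sqnorm_ge0.
  rewrite /c0fun nc_rc ger0_norm ?mulr_ge0 ?pos_nng // -[leRHS]mulr1 ler_wpM2l //.
  by rewrite /pos ge_max ler01 andbT lerBlDr lerDl sqnorm_ge0.
have i3 n : cintegrable muC (T3 g x (e n)).
  apply: (cintegrable_cpt (M := 1) (K := K / e n ^+ 2)) => // z; last first.
    by move=> z1; rewrite /T3 g0 // mul0r.
  have e20 : 0 < e n ^+ 2 by rewrite exprn_gt0.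
  have en : rc (e n) != 0 by rewrite -nc_eq0 nc_rc normr_eq0 gt_eqF.
  have := T3_scale g x (e0 n) ((rc (e n))^-1 * (z - x)); rewrite mulVKf // subrK => E.
  rewrite ler_pdivlMr // -[X in _ * X](gtr0_norm e20) -nc_rc -ncM E.
  have := b3 n ((rc (e n))^-1 * (z - x)); rewrite /T3' mulVKf // subrK => h.
  by apply: le_trans h _; rewrite -[leRHS]mulr1 ler_wpM2l // indicE lern1 leq_b1.
have E3 n : CI muC (T3 g x (e n)) = CI muC (T3' n).
  have [_ <-] := CI_affine x (e0 n) (i3 n); apply: eq_CI => v; exact: T3_scale.
have mT3' n : measurable_fun setT (T3' n).
  have -> : T3' n = fun v => T3 g x (e n) (rc (e n) * v + x) * rc (e n ^+ 2).
    by apply/funext => v; rewrite T3_scale.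
  apply: measurableC_mul; last exact: measurable_cst.
  apply: (measurableT_comp (m3 n)); apply: measurable_ccont => z.
  by apply: ccont_add; [apply: ccont_mul; [exact: ccont_cst|exact: ccont_id]|exact: ccont_cst].
have Mxx : Mx x x = -1.
  have Dn := den_neq0 x1 (ltW x1); rewrite /Mx -mul_cj [x * _]mulrC.
  by apply: (mulIf Dn); rewrite mulfVK // mulN1r opprB.
have cM : ccont (Mx x) x.
  apply: ccont_mul; last apply: ccont_inv.
  - by apply: ccont_sub; [exact: ccont_sqnorm|exact: ccont_cst].
  - exact: (den_neq0 x1 (ltW x1)).
  - apply: ccont_sub; first exact: ccont_cst.
    by apply: ccont_mul; [exact: ccont_cj|exact: ccont_cst].
have m3' : measurable_fun setT (fun v => g x * Mx x x * c0fun v).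
  by apply: measurableC_mul; [exact: measurable_cst|exact: measurable_ccont ccont_c0fun].
have [_ c3] : cintegrable muC (fun v => g x * Mx x x * c0fun v) /\
    ccvg (fun n => CI muC (T3' n)) (CI muC (fun v => g x * Mx x x * c0fun v)).
  apply: (CI_dominated mT3' m3' (integrable_csq 1 K) b3); apply: aeW => v.
  have [v1|v1] := leP 1 (nc v).
    by rewrite /T3' c0fun_out // mulr0; under eq_fun do rewrite !mulr0; exact: ccvg_cst.
  have ce : ccvg (fun n => rc (e n) * v + x) x.
    rewrite -[X in ccvg _ X]add0r -[X in ccvg _ (X + _)](mul0r v).
    apply: ccvg_add (ccvg_cst x); apply: ccvg_mul (ccvg_cst v).
    apply: ccvg_rc => r /esmall[N HN]; exists N => n /HN h; by rewrite gtr0_norm.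
  have := ccvg_mul (ccvg_mul (ccvg_ccont cg ce) (ccvg_ccont cM ce)) (ccvg_cst (c0fun v)).
  apply: (@ccvg_near _ _ _ 0) => n _; rewrite /T3'.
  have [_ ->] := hc_near x1 (e0 n) (ed n) (ltW v1).
  by rewrite mul1r mulrA.
split => //.
have i0 := cintegrable_ccont ccont_c0fun c0fun_out.
rewrite CIZ // Mxx mulrN1 CI_c0fun in c3; rewrite CI0 in c1.
have c123 := ccvg_add (ccvg_add c1 c2) c3; rewrite add0r mulNr in c123.
suff z0 : ccvg (fun n => CI muC (T1 g x (e n)) + CI muC (T2 g x (e n)) + CI muC (T3' n)) 0.
  by have /eqP := ccvg_unique c123 z0; rewrite subr_eq0 mulrC => /eqP.
apply: (@ccvg_near (fun=> 0) _ _ 0) (ccvg_cst 0) => n _.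
have i1 := scaleK d8 (m1 n) (b1 n); have i2 := scaleK d2 (m2 n) (b2 n).
rewrite -E3 -CID // -CID //; first by rewrite (T_sum x1 (e0 n) (ed n) gi gd g0).
exact: cintegrableD.
Qed.

End bergman_disc.

(** * Reproducing formula on the polydisc *)

Definition updt n (t : Cn n) (i : 'I_n) (z : C) : Cn n :=
  [tuple if j == i then z else tnth t j | j < n].

Definition polyd n (t : Cn n) := forall j, nc (tnth t j) < 1.

(** Holomorphy in each variable separately, a hypothesis inherited by the slices in the
    induction. *)
Definition sephol n (g : Cn n -> C) := forall i t, polyd t ->
  exists c, Wd (fun z => g (updt t i z)) c 0 (tnth t i).

Lemma tnth_cons0 n z (t : Cn n) : tnth (cons_tuple z t) ord0 = z.
Proof. by rewrite (tnth_nth 0). Qed.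

Lemma tnth_consS n z (t : Cn n) i : tnth (cons_tuple z t) (lift ord0 i) = tnth t i.
Proof. by rewrite !(tnth_nth 0). Qed.

Lemma updt_cons0 n z (t : Cn n) w : updt (cons_tuple z t) ord0 w = cons_tuple w t.
Proof.
apply: eq_from_tnth => j; rewrite tnth_mktuple; case: (unliftP ord0 j) => [i ->|->].
  by rewrite !tnth_consS.
by rewrite eqxx tnth_cons0.
Qed.

Lemma updt_consS n z (t : Cn n) i w : updt (cons_tuple z t) (lift ord0 i) w = cons_tuple z (updt t i w).
Proof.
apply: eq_from_tnth => j; rewrite tnth_mktuple; case: (unliftP ord0 j) => [k ->|->].
  by rewrite !tnth_consS tnth_mktuple (inj_eq lift_inj).
by rewrite !tnth_cons0.
Qed.

Lemma polyd_cons n z (t : Cn n) : nc z < 1 -> polyd t -> polyd (cons_tuple z t).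
Proof.
by move=> z1 t1 j; case: (unliftP ord0 j) => [i ->|->]; rewrite ?tnth_consS ?tnth_cons0.
Qed.

Lemma polyd_consI n z (t : Cn n) : polyd (cons_tuple z t) -> nc z < 1 /\ polyd t.
Proof.
move=> h; split=> [|i]; first by have := h ord0; rewrite tnth_cons0.
by have := h (lift ord0 i); rewrite tnth_consS.
Qed.

Definition kbn n (x t : Cn n) : C := \prod_j kb (tnth x j) (tnth t j).

Lemma kbn_cons n x (xs : Cn n) z t : kbn (cons_tuple x xs) (cons_tuple z t) = kb x z * kbn xs t.
Proof.
rewrite /kbn big_ord_recl !tnth_cons0; congr (_ * _).
by apply: eq_bigr => i _; rewrite !tnth_consS.
Qed.

Lemma measurable_kbn n (x : Cn n) : measurable_fun setT (kbn x).
Proof.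
apply: measurableC_prod => j; apply: (measurableT_comp (measurable_kb _)).
exact: measurable_tnth.
Qed.

Lemma kbn_bound n (x : Cn n) : polyd x -> exists K : Rr, 0 <= K /\ forall t, polyd t -> nc (kbn x t) <= K.
Proof.
move=> px; exists (\prod_j ((1 - nc (tnth x j)) ^+ 2)^-1); split.
  by apply: prodr_ge0 => j _; rewrite invr_ge0 sqr_ge0.
move=> t pt; rewrite nc_prod; apply: ler_prod => j _; rewrite nc_ge0 /=.
by apply: kb_le; [exact: px|exact: ltW].
Qed.

Lemma cintegrable_mul_bounded d (T : measurableType d) (m : {measure set T -> \bar Rr})
    (g k : T -> C) (K : Rr) : cintegrable m g -> measurable_fun setT k ->
  (forall t, g t = 0 \/ nc (k t) <= K) -> cintegrable m (fun t => g t * k t).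
Proof.
move=> ig mk gk; have mg := cintegrable_measurable ig.
apply: (cintegrable_le (measurableC_mul mg mk) (cintegrable_nc (cintegrableZ (rc K) ig))) => t.
rewrite !ncM nc_rc mulrC; case: (gk t) => [->|h]; first by rewrite nc0 !mulr0.
by rewrite ler_wpM2r ?nc_ge0 //; apply: le_trans h (ler_norm _).
Qed.

(** The disc formula in the first variable after the induction hypothesis in the others. The slice
    through the given point need not be among the almost all slices that Fubini provides, so its
    integrability has to be recovered. *)
Theorem bergman_polydisc n (g : Cn n -> C) (x : Cn n) :
  cintegrable (muN n) g -> sephol g -> (forall t, ~ polyd t -> g t = 0) -> polyd x ->
  cintegrable (muN n) (fun t => g t * kbn x t) /\
  CI (muN n) (fun t => g t * kbn x t) = rc c0 ^+ n * g x.
Proof.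
elim: n g x => [|n IH] g x ig hg g0 px.
  have G (t : Cn 0) : g t * kbn x t = g x by rewrite /kbn big_ord0 mulr1 [t]tuple0 [x]tuple0.
  split.
    by apply: eq_cintegrable ig => t; rewrite G [t]tuple0 [x]tuple0.
  rewrite expr0 mul1r; under eq_CI do rewrite G.
  by apply: complexP; rewrite /= /Rintegral integral_dirac // diracT mul1e.
have [K [K0 HK]] := kbn_bound px.
have iG : cintegrable (muN n.+1) (fun t => g t * kbn x t).
  apply: (cintegrable_mul_bounded (K := K) ig (measurable_kbn x)) => t.
  by have [/HK|/g0] := pselect (polyd t); [right|left].
split => //.
have mg := cintegrable_measurable ig.
have [x0 [xs xE]] : exists x0 xs, x = cons_tuple x0 xs by exists (thead x), (behead_tuple x); exact: (esym (unconscK x)).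
rewrite {x}xE in px iG K HK K0 *; have [x01 pxs] := polyd_consI px.
have [iH -> _] := CI_muS iG; have [_ _ aeg] := CI_muS ig.
set h := (fun z => _) in iH *.
pose gx z := g (cons_tuple z xs).
have mgx : measurable_fun setT gx.
  apply: (measurableT_comp mg); exact: (measurableT_comp (@measurable_consc n) (pair2_measurable _)).
(* For almost every z the slice is integrable and the induction hypothesis evaluates the inner
   integral. *)
have aeh : {ae muC, forall z, h z = rc c0 ^+ n * (gx z * kb x0 z)}.
  apply: filterS aeg => z igz; rewrite /h.
  have -> : (fun t => g (cons_tuple z t) * kbn (cons_tuple x0 xs) (cons_tuple z t)) =
      fun t => kb x0 z * (g (cons_tuple z t) * kbn xs t).
    by apply/funext => t; rewrite kbn_cons mulrCA.
  have [z1|z1] := ltP (nc z) 1; last first.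
    have g0z t : g (cons_tuple z t) = 0.
      by apply: g0 => /polyd_consI[]; rewrite ltNge z1.
    rewrite /gx g0z mul0r mulr0 -[RHS](@CI0 _ _ (muN n)).
    by apply: eq_CI => t; rewrite g0z mul0r mulr0.
  have hgz : sephol (fun t => g (cons_tuple z t)).
    move=> i t pt; have [c W] := hg (lift ord0 i) _ (polyd_cons z1 pt); exists c.
    by move: W; under eq_fun do rewrite updt_consS; rewrite tnth_consS.
  have g0z t : ~ polyd t -> g (cons_tuple z t) = 0.
    by move=> pt; apply: g0 => /polyd_consI[].
  have [i1 E1] := IH _ xs igz hgz g0z pxs.
  by rewrite CIZ // E1 /gx mulrCA; congr (_ * _); rewrite mulrC.
have c00 : rc c0 ^+ n != 0 by rewrite expf_neq0 // -nc_eq0 nc_rc normr_eq0 gt_eqF // c0_gt0.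
have g0x z : 1 <= nc z -> gx z = 0.
  by move=> z1; apply: g0 => /polyd_consI[]; rewrite ltNge z1.
have igx : cintegrable muC gx.
  (* On the disc, k inverts the factor c0^n [kb x0 z] and is bounded. Multiplying the integrable
     inner integral by it gives back [gx], which is therefore integrable. *)
  pose k z : C := if nc z < 1 then (rc c0 ^+ n)^-1 * (1 - cj z * x0) ^+ 2 else 0.
  have mk : measurable_fun setT k.
    apply: measurable_fun_ifT; last exact: measurable_cst.
      by apply: measurable_fun_ltr; [exact: (measurable_nc (f := id))|exact: measurable_cst].
    apply: measurable_ccont => z; apply: ccont_mul; first exact: ccont_cst.
    apply: ccont_exp; apply: ccont_sub; first exact: ccont_cst.
    by apply: ccont_mul; [exact: ccont_cj|exact: ccont_cst].
  have ihk : cintegrable muC (fun z => h z * k z).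
    apply: (cintegrable_mul_bounded (K := nc (rc c0 ^+ n)^-1 * 2 ^+ 2) iH mk) => z; right.
    rewrite /k; case: ifP => z1; last by rewrite nc0 mulr_ge0 ?nc_ge0 ?sqr_ge0.
    rewrite ncM ncX ler_wpM2l ?nc_ge0 // lerXn2r ?nnegrE ?nc_ge0 //.
    apply: le_trans (nc_triangleB _ _) _; rewrite nc1 lerD2l ncM nc_cj.
    by rewrite mulr_ile1 ?nc_ge0 // ltW.
  apply: (ae_eq_cintegrable mgx ihk); apply: filterS aeh => z hz _.
  rewrite hz /k; case: ifP => [z1|/negbT]; last by rewrite -leNgt => /g0x ->; rewrite mulr0.
  have := den_neq0 x01 (ltW z1); rewrite /kb; move: (1 - _) (rc c0 ^+ n) c00 => D c c1 D0.
  by field; rewrite ?D0 ?c1.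
have gdx z : nc z < 1 -> exists c, Wd gx c 0 z.
  move=> z1; have [c W] := hg ord0 _ (polyd_cons z1 pxs); exists c.
  by move: W; under eq_fun do rewrite updt_cons0; rewrite tnth_cons0.
have [ik E] := bergman_disc x01 igx gdx g0x.
transitivity (CI muC (fun z => rc c0 ^+ n * (gx z * kb x0 z))); last first.
  by rewrite CIZ // E exprSr mulrA.
apply: ae_eq_CI; first exact: cintegrable_measurable iH.
- exact: cintegrable_measurable (cintegrableZ _ ik).
- by apply: filterS aeh => z -> _.
Qed.

(** * Change of variables along the symmetrization map *)

(** The coefficients of degree at least 1 of (p + s_1 X + ... + s_n X^n)(1 + l X). For p = 1 this
    adjoins a root; general p is required because it becomes a function of l when coordinates are
    peeled off. *)
Definition step n (l p : C) (s : Cn n) : Cn n.+1 :=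
  [tuple nth 0 (p :: s) k.+1 + l * nth 0 (p :: s) k | k < n.+1].

(** Horner evaluation: the sum of s_k (-l)^(n-k) with s_0 = a. For s = [pi_n t] and a = 1 it is the
    product of the t_j - l. *)
Definition wf (l a : C) (s : seq C) : C := foldl (fun a x => x - l * a) a s.

Lemma step_cons n l p z (s : Cn n) : step l p (cons_tuple z s) = cons_tuple (z + l * p) (step l z s).
Proof.
apply: eq_from_tnth => k; rewrite tnth_mktuple; case: (unliftP ord0 k) => [i ->|->].
  by rewrite tnth_consS tnth_mktuple.
by rewrite tnth_cons0.
Qed.

Lemma step0 l p (s : Cn 0) : step l p s = [tuple l * p].
Proof.
by apply: eq_from_tnth => k; rewrite tnth_mktuple (ord1 k) [s]tuple0 (tnth_nth 0) /= add0r.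
Qed.

(** Generalised over the running Horner value b' for the induction. For b' = 0 it says that
    adjoining the root m multiplies the evaluation at l by m - l. *)
Lemma wf_step n l m p b b' (s : Cn n) : b = p - l * b' ->
  wf l (b + m * b') (step m p s) = (m - l) * wf l b s.
Proof.
elim: n p b b' s => [|n IH] p b b' s bE.
  by rewrite step0 [s]tuple0 /wf /= bE; ring.
have -> : s = cons_tuple (thead s) (behead_tuple s) by exact: (esym (unconscK s)).
move: (thead s) (behead_tuple s) => z t; rewrite step_cons /wf /= -!/(wf _ _ _).
rewrite -(IH z (z - l * b) b t erefl); congr (wf _ _ _).
by rewrite bE; ring.
Qed.

Section measurability.
Context d (T : measurableType d).

Lemma measurable_Cn n (f : T -> Cn n) : (forall k, measurable_fun setT (fun t => tnth (f t) k)) ->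
  measurable_fun setT f.
Proof.
by move=> mf; apply/measurable_fun_tnthP.
Qed.

Lemma measurable_nthC n (f : T -> Cn n) k : measurable_fun setT f ->
  measurable_fun setT (fun t => nth 0 (f t) k).
Proof.
move=> mf; have [kn|nk] := ltnP k n; last first.
  rewrite (_ : (fun _ => _) = fun=> 0); first exact: measurable_cst.
  by apply/funext => t; rewrite nth_default // size_tuple.
rewrite (_ : (fun _ => _) = fun t => tnth (f t) (Ordinal kn)).
  exact: (measurableT_comp (measurable_tnth (Ordinal kn)) mf).
by apply/funext => t; rewrite (tnth_nth 0).
Qed.

Lemma measurable_step n (l p : T -> C) (s : T -> Cn n) : measurable_fun setT l ->
  measurable_fun setT p -> measurable_fun setT s ->
  measurable_fun setT (fun t => step (l t) (p t) (s t)).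
Proof.
move=> ml mp ms; apply: measurable_Cn => k; under eq_fun do rewrite tnth_mktuple /=.
apply: measurableC_add; first exact: measurable_nthC.
apply: measurableC_mul => //; case: (nat_of_ord k) => [|j] //=; exact: measurable_nthC.
Qed.

Lemma measurable_wf n (l a : T -> C) (s : T -> Cn n) : measurable_fun setT l ->
  measurable_fun setT a -> measurable_fun setT s ->
  measurable_fun setT (fun t => wf (l t) (a t) (s t)).
Proof.
elim: n a s => [|n IH] a s ml ma ms.
  rewrite (_ : (fun _ => _) = a) //; apply/funext => t; by rewrite [s t]tuple0.
have -> : (fun t => wf (l t) (a t) (s t)) =
    fun t => wf (l t) (thead (s t) - l t * a t) (behead_tuple (s t)).
  by apply/funext => t; rewrite -{1}[s t]unconscK.
have [m1 m2] : measurable_fun setT (fun t => thead (s t)) /\ measurable_fun setT (fun t => behead_tuple (s t)).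
  by split; [exact: (measurableT_comp (measurable_tnth ord0) ms)|exact: (measurableT_comp (@measurable_behead _ _ _) ms)].
by apply: IH => //; apply: measurableC_add => //; apply: measurableC_opp; exact: measurableC_mul.
Qed.

End measurability.

Section step_integral.

Local Notation wt l Q s := (sqnorm (wf l (deriv ('X * Q)).[l] s)).

Lemma integral_muN_ge0 n (g : Cn n.+1 -> \bar Rr) : measurable_fun setT g -> (forall t, 0%E <= g t)%E ->
  (\int[muN n.+1]_t g t = \int[muC]_z \int[muN n]_t g (cons_tuple z t))%E.
Proof. exact: integral_muS_ge0. Qed.

Lemma integral_muN0 (h : Cn 0 -> \bar Rr) : (\int[muN 0]_t h t = h [tuple])%E.
Proof.
have hE : h = cst (h [tuple]) by apply/funext => t; rewrite [t]tuple0.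
by rewrite hE /= integral_dirac // diracT mul1e.
Qed.

Lemma integral_muN1 (F : Cn 1 -> \bar Rr) : measurable_fun setT F -> (forall t, 0%E <= F t)%E ->
  (\int[muN 1]_t F t = \int[muC]_z F [tuple z])%E.
Proof.
move=> mF F0; rewrite integral_muN_ge0 //; apply: eq_integral => z _.
by rewrite integral_muN0; congr F; exact: val_inj.
Qed.

(** The weight is the squared modulus of the Jacobian determinant of (l, s) -> [step l Q.[l] s].
    Induction on n: the first new coordinate z = s_1 + l Q(l) is freed by a translation; for fixed z
    the remaining coordinates form the same map with Q replaced by z - X Q. The case of no s is
    [poly_pushforward] for X Q. The constant must be uniform in z, hence it depends on Q only
    through size and leading coefficient. *)
Lemma step_integral n (k : nat) (a : C) : (0 < k)%N -> exists2 c : Rr, 0 <= c &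
  forall Q : {poly C}, size Q = k -> lead_coef Q = a ->
  forall F : Cn n.+1 -> \bar Rr, measurable_fun setT F -> (forall t, 0%E <= F t)%E ->
  (\int[muC]_l \int[muN n]_s (F (step l Q.[l] s) * (wt l Q s)%:E) =
    c%:E * \int[muN n.+1]_t F t)%E.
Proof.
have mpoly (p : {poly C}) : measurable_fun setT (fun z => p.[z]).
  by apply: measurable_ccont => z; exact: ccont_poly.
elim: n k a => [|n IH] k a k0.
  (* If no polynomial has this size and leading coefficient, the claim is vacuous and any constant
     will do. *)
  have [[Q0 [Q0k Q0a]]|no] := pselect (exists Q : {poly C}, size Q = k /\ lead_coef Q = a); last first.
    by exists 0 => // Q Qk Qa; case: no; exists Q.
  have sX (Q : {poly C}) : size Q = k -> size ('X * Q) = k.+1.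
    by move=> Qk; rewrite mulrC size_mulX ?Qk // -size_poly_gt0 Qk.
  have sX0 := sX _ Q0k.
  exists (cP ('X * Q0)); first by apply: cP_ge0; rewrite sX0.
  move=> Q Qk Qa F mF F0; rewrite integral_muN1 //.
  rewrite (@cP_eq ('X * Q0) ('X * Q)) ?sX // ?lead_coefM ?Qa ?Q0a //.
  have mF1 : measurable_fun setT (fun z => F [tuple z]).
    apply: (measurableT_comp mF); apply: measurable_Cn => i; rewrite (ord1 i).
    by under eq_fun do rewrite tnth0; exact: measurable_id.
  rewrite -(poly_pushforward _ mF1) ?sX //; apply: eq_integral => z _.
  by rewrite integral_muN0 step0 hornerM hornerX.
(* z - X Q has one more coefficient than Q and leading coefficient -a, whatever z is. *)
have [c c0 Hc] := IH k.+1 (- a) isT; exists c => // Q Qk Qa F mF F0.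
pose G (l z : C) (s : Cn n) := (F (cons_tuple z (step l (z - l * Q.[l])%R s)) *
  (sqnorm (wf l (z - l * Q.[l] - l * (deriv ('X * Q)).[l])%R s))%:E)%E.
have mG : measurable_fun setT (fun p : C * C * Cn n => G p.1.1 p.1.2 p.2).
  have p1 : measurable_fun setT (fun p : C * C * Cn n => p.1.1) by exact: (measurableT_comp measurable_fst measurable_fst).
  have p2 : measurable_fun setT (fun p : C * C * Cn n => p.1.2) by exact: (measurableT_comp measurable_snd measurable_fst).
  have p3 : measurable_fun setT (fun p : C * C * Cn n => p.2) by exact: measurable_snd.
  have pQ : measurable_fun setT (fun p : C * C * Cn n => p.1.2 - p.1.1 * Q.[p.1.1]).
    apply: measurableC_add => //; apply: measurableC_opp; apply: measurableC_mul => //.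
    exact: (measurableT_comp (mpoly Q) p1).
  apply: emeasurable_funM.
    apply: (measurableT_comp mF).
    exact: (measurableT_comp (@measurable_consc n.+1) (measurable_fun_pair p2 (measurable_step p1 pQ p3))).
  apply/measurable_EFinP; apply: measurable_sqnorm; apply: measurable_wf => //.
  apply: measurableC_add => //; apply: measurableC_opp; apply: measurableC_mul => //.
  exact: (measurableT_comp (mpoly _) p1).
have G0 l z s : (0%E <= G l z s)%E by rewrite mule_ge0 // lee_fin sqnorm_ge0.
have mIG : measurable_fun setT (fun p : C * C => \int[muN n]_s G p.1 p.2 s)%E.
  exact: (measurable_fun_integral (muN n) mG).
transitivity (\int[muC]_l \int[muC]_z \int[muN n]_s G l z s)%E.
  apply: eq_integral => l _; rewrite integral_muN_ge0; last 2 first.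
  - apply: emeasurable_funM.
      apply: (measurableT_comp mF); apply: measurable_step; [exact: measurable_cst|exact: measurable_cst|exact: measurable_id].
    apply/measurable_EFinP; apply: measurable_sqnorm.
    by apply: measurable_wf; [exact: measurable_cst|exact: measurable_cst|exact: measurable_id].
  - by move=> t; rewrite mule_ge0 // lee_fin sqnorm_ge0.
  (* Translating z by l Q(l) makes the first coordinate of the image a free variable. *)
  rewrite -[RHS](integral_translate (l * Q.[l])).
  - apply: eq_integral => z _; apply: eq_integral => s _.
    by rewrite /G step_cons addrK.
  - exact: (measurableT_comp mIG (pair1_measurable l)).
  - by move=> z; apply: integral_ge0.
rewrite (fubini_tonelli (m1 := muC) (m2 := muC) (fun p => \int[muN n]_s G p.1 p.2 s)%E) //=; last first.
  by move=> p; apply: integral_ge0.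
rewrite integral_muN_ge0 // -ge0_integralZl //; last 2 first.
- exact: measurable_muS_F.
- by move=> z _; apply: integral_ge0.
(* The weights match because (X Q1)' = z - X Q - X (X Q)' for Q1 = z - X Q. *)
apply: eq_integral => z _; pose Q1 : {poly C} := z%:P - 'X * Q.
have Qn : Q != 0 by rewrite -size_poly_gt0 Qk.
have sXQ : size ('X * Q) = k.+1 by rewrite mulrC size_mulX ?Qk.
have sz : (size (z%:P : {poly C}) < size (- ('X * Q)))%N.
  by rewrite size_polyN sXQ (leq_ltn_trans (size_polyC_leq1 _)).
have sQ1 : size Q1 = k.+1 by rewrite /Q1 addrC size_polyDl // size_polyN.
have lQ1 : lead_coef Q1 = - a.
  by rewrite /Q1 addrC lead_coefDl // lead_coefN lead_coefM lead_coefX mul1r Qa.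
rewrite -(Hc Q1 sQ1 lQ1); last 2 first.
- exact: measurable_slice.
- by [].
apply: eq_integral => l _; apply: eq_integral => s _; rewrite /G.
have -> : Q1.[l] = z - l * Q.[l] by rewrite /Q1 !hornerE.
congr (_ * (sqnorm (wf _ _ _))%:E)%E.
rewrite [in RHS]derivM derivX mul1r hornerD [in RHS]hornerM hornerX.
have -> : deriv Q1 = - deriv ('X * Q) by rewrite /Q1 derivB derivC sub0r.
by rewrite {1}/Q1 hornerD !hornerN hornerC hornerM hornerX; ring.
Qed.

End step_integral.

Section symmetrization.

(** The factors 1 + x X make the coefficients the elementary symmetric functions without signs. *)
Definition es (l : seq C) : {poly C} := \prod_(x <- l) (1 + x *: 'X).

Lemma es_cons x l : es (x :: l) = es l + x *: ('X * es l).
Proof. by rewrite /es big_cons mulrDl mul1r -scalerAl. Qed.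

Lemma esym_kE n k (l : Cn n) : esym_k k l = (es l)`_k.
Proof.
rewrite /es big_tuple; under eq_bigr do rewrite addrC.
rewrite bigA_distr coef_sum /esym_k big_mkcond; apply: eq_bigr => S _.
have -> : \prod_i (if i \in S then tnth l i *: 'X else 1) =
    (\prod_(i in S) tnth l i) *: 'X^#|S| :> {poly C}.
  by rewrite -big_mkcond /= scaler_prod prodr_const.
by rewrite coefZ coefXn eq_sym; case: eqP; rewrite ?mulr1 ?mulr0.
Qed.

Lemma nth_pi n (l : Cn n) k : nth 0 (1 :: pi_n l) k = (es l)`_k.
Proof.
case: k => [|k] /=.
  rewrite -esym_kE /esym_k (big_pred1 finset.set0) ?big_set0 // => S.
  by rewrite cards_eq0.
have [kn|nk] := ltnP k n.
  by rewrite (nth_map (Ordinal kn)) ?size_enum_ord // nth_enum_ord // esym_kE.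
have sz : (size (pi_n l) <= k)%N by rewrite size_tuple.
rewrite -esym_kE nth_default // /esym_k big_pred0 // => S.
by apply/negbTE; rewrite neq_ltn (leq_ltn_trans (max_card _)) // card_ord ltnS.
Qed.

Lemma pi_cons n x (l : Cn n) : pi_n (cons_tuple x l) = step x 1 (pi_n l).
Proof.
apply: eq_from_tnth => k; rewrite !tnth_mktuple esym_kE !nth_pi /= es_cons.
by rewrite coefD coefZ coefXM.
Qed.

Lemma wf_pi n x (l : Cn n) : wf x 1 (pi_n l) = \prod_(j < n) (tnth l j - x).
Proof.
elim: n l => [|n IH] l; first by rewrite big_ord0 [pi_n l]tuple0.
have -> : l = cons_tuple (thead l) (behead_tuple l) by exact: (esym (unconscK l)).
move: (thead l) (behead_tuple l) => y t; rewrite pi_cons big_ord_recl tnth_cons0.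
under eq_bigr do rewrite tnth_consS.
by rewrite -IH -(@wf_step _ x y 1 1 0) ?mulr0 ?addr0 ?subr0.
Qed.

Fixpoint vdm n : Cn n -> C := match n return Cn n -> C with
  | 0 => fun=> 1
  | n'.+1 => fun t => (\prod_(j < n') (tnth (behead_tuple t) j - thead t)) * vdm (behead_tuple t)
  end.

Lemma vdm_cons n x (l : Cn n) : vdm (cons_tuple x l) = (\prod_(j < n) (tnth l j - x)) * vdm l.
Proof.
by have E : behead_tuple (cons_tuple x l) = l :> Cn n by [exact: val_inj]; rewrite /= E theadE.
Qed.

Lemma measurable_pi n : measurable_fun setT (@pi_n n).
Proof.
apply: measurable_Cn => k; under eq_fun do rewrite tnth_mktuple /esym_k big_mkcond.
apply: measurableC_sum => S; case: (#|S| == _); last exact: measurable_cst.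
under eq_fun do rewrite big_mkcond; apply: measurableC_prod => j.
by case: (j \in S); [exact: measurable_tnth|exact: measurable_cst].
Qed.

Lemma measurable_vdm n : measurable_fun setT (@vdm n).
Proof.
elim: n => [|n IH]; first exact: measurable_cst.
apply: measurableC_mul; last exact: (measurableT_comp IH (@measurable_behead _ _ _)).
apply: measurableC_prod => j; apply: measurableC_add; last by apply: measurableC_opp; exact: measurable_tnth.
exact: (measurableT_comp (measurable_tnth j) (@measurable_behead _ _ _)).
Qed.

(** Split off one root l: its contribution to |V|^2 is the product of the |t_j - l|^2, which is
    exactly the weight of [step_integral] for Q = 1, and the other roots are handled by induction.
    Geometrically c is n!, the number of orderings of the roots. *)
Theorem integral_pi n : exists2 c : Rr, 0 <= c &
  forall F : Cn n -> \bar Rr, measurable_fun setT F -> (forall t, 0%E <= F t)%E ->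
  (\int[muN n]_t (F (pi_n t) * (sqnorm (vdm t))%:E) = c%:E * \int[muN n]_t F t)%E.
Proof.
elim: n => [|n [c c0 Hc]].
  exists 1 => // F mF F0; rewrite !integral_muN0 mul1e sqnormE nc1 expr1n mule1.
  by congr F; exact: tuple0.
have [c' c'0 Hc'] := @step_integral n 1 1 isT.
exists (c' * c); first exact: mulr_ge0.
move=> F mF F0; have mV := @measurable_vdm n.+1.
have h1 : size (1 : {poly C}) = 1%N by rewrite size_poly1.
have h2 : lead_coef (1 : {poly C}) = 1 by rewrite lead_coef1.
have mW : measurable_fun setT (fun p : C * Cn n => F (step p.1 1%R p.2) * (sqnorm (wf p.1 1%R p.2))%:E)%E.
  apply: emeasurable_funM.
    apply: (measurableT_comp mF); apply: measurable_step; [exact: measurable_fst|exact: measurable_cst|exact: measurable_snd].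
  apply/measurable_EFinP; apply: measurable_sqnorm.
  by apply: measurable_wf; [exact: measurable_fst|exact: measurable_cst|exact: measurable_snd].
rewrite integral_muN_ge0; last 2 first.
- apply: emeasurable_funM; first exact: (measurableT_comp mF (@measurable_pi _)).
  by apply/measurable_EFinP; exact: measurable_sqnorm.
- by move=> t; rewrite mule_ge0 // lee_fin sqnorm_ge0.
have Hc1 : (\int[muC]_l \int[muN n]_s (F (step l 1%R s) * (sqnorm (wf l 1%R s))%:E) =
    c'%:E * \int[muN n.+1]_t F t)%E.
  rewrite -(Hc' 1 h1 h2 F mF F0); apply: eq_integral => l _; apply: eq_integral => s _.
  by rewrite hornerC mulr1 derivX hornerC.
rewrite mulrC EFinM -muleA -Hc1 -ge0_integralZl //; last 2 first.
- exact: (measurable_fun_integral (muN n) mW).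
- by move=> z _; apply: integral_ge0 => s _; rewrite mule_ge0 // lee_fin sqnorm_ge0.
apply: eq_integral => l _.
rewrite -(Hc (fun s => F (step l 1%R s) * (sqnorm (wf l 1%R s))%:E)%E); last 2 first.
- exact: (measurableT_comp mW (pair1_measurable l)).
- by move=> t; rewrite mule_ge0 // lee_fin sqnorm_ge0.
by apply: eq_integral => t _; rewrite pi_cons wf_pi vdm_cons sqnormM EFinM muleA.
Qed.

End symmetrization.

(** * A zero of the kernel determinant from roots of unity *)

Section zeros.
Variable n : nat.
Hypothesis n3 : (2 < n)%N.

Let n0 : (0 < n)%N. Proof. exact: leq_trans n3. Qed.

Lemma prim_rootC : exists w : C, n.-primitive_root w.
Proof.
have [r Dp] := closed_field_poly_normal ('X^n - 1 : {poly C}).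
rewrite (monicP _) ?monicXnsubC // scale1r in Dp.
have rn : all n.-unity_root r by apply/allP => z; rewrite -root_prod_XsubC -Dp.
have sz : (n < (size r).+1)%N by rewrite -(size_prod_XsubC r id) -Dp size_XnsubC.
have [|z] := hasP (has_prim_root n0 rn _ sz); last by exists z.
by rewrite -separable_prod_XsubC -Dp separable_Xn_sub_1 // pnatr_eq0 -lt0n.
Qed.

Section sum.
Variables (w u : C).
Hypotheses (pw : n.-primitive_root w) (ut : u ^+ n * n.-1%:R = -1).

Lemma sum_prim_root e : \sum_(j < n) (w ^+ e) ^+ j = (n%:R *+ (n %| e)%N : C).
Proof.
have [d|nd] := boolP (n %| e)%N.
  have -> : w ^+ e = 1 by apply/eqP; rewrite -(prim_order_dvd pw).
  by under eq_bigr do rewrite expr1n; rewrite sumr_const card_ord.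
have we : w ^+ e - 1 != 0 by rewrite subr_eq0 -(prim_order_dvd pw).
by apply: (mulfI we); rewrite -subrX1 -exprM mulnC exprM (prim_expr_order pw) expr1n subrr mulr0n mulr0.
Qed.

Let un1 : 1 - u ^+ n != 0.
Proof.
rewrite subr_eq0 eq_sym; apply/eqP => h; move: ut; rewrite h mul1r => /eqP.
by rewrite -subr_eq0 opprK natr1 pnatr_eq0.
Qed.

(** Write 1/(1 - v) = S(v)/(1 - v^n) with S a finite geometric sum. Summing S(u w^j)^2 over j keeps
    the terms with m + l divisible by n, namely (0, 0) and the n - 1 pairs with m + l = n, which
    gives n (1 + (n-1) u^n) = 0. *)
Lemma sum_kernel_roots : \sum_(j < n) ((1 - u * w ^+ j) ^+ 2)^-1 = 0.
Proof.
pose S (v : C) := \sum_(m < n) v ^+ m.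
have E (j : 'I_n) : ((1 - u * w ^+ j) ^+ 2)^-1 = S (u * w ^+ j) ^+ 2 / (1 - u ^+ n) ^+ 2.
  have vn : (u * w ^+ j) ^+ n = u ^+ n.
    by rewrite exprMn exprAC (prim_expr_order pw) expr1n mulr1.
  have := subrX1 (u * w ^+ j) n; rewrite vn -/(S _) => h.
  have h' : 1 - u ^+ n = (1 - u * w ^+ j) * S (u * w ^+ j) by rewrite -opprB h -mulNr opprB.
  have := un1; rewrite h' mulf_eq0 negb_or => /andP[v0 s0].
  by field; rewrite v0 s0.
under eq_bigr do rewrite E; rewrite -mulr_suml.
suff -> : \sum_(j < n) S (u * w ^+ j) ^+ 2 = 0 by rewrite mul0r.
have -> : \sum_(j < n) S (u * w ^+ j) ^+ 2 =
    \sum_(m < n) \sum_(l < n) u ^+ (m + l) * (n%:R *+ (n %| m + l)%N).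
  rewrite /S; under eq_bigr do rewrite expr2 big_distrlr /=.
  rewrite exchange_big /=; apply: eq_bigr => m _; rewrite exchange_big /=; apply: eq_bigr => l _.
  rewrite -sum_prim_root mulr_sumr; apply: eq_bigr => j _.
  by rewrite -exprD exprMn -!exprM mulnC.
have row (m : 'I_n) : \sum_(l < n) u ^+ (m + l) * (n%:R *+ (n %| m + l)%N) =
    n%:R * (if m == 0%N :> nat then 1 else u ^+ n).
  have lt0 : ((n - m) %% n < n)%N by rewrite ltn_mod.
  rewrite (bigD1 (Ordinal lt0)) //= big1 ?addr0; last first.
    move=> l /eqP ln; rewrite (_ : (n %| m + l)%N = false) ?mulr0n ?mulr0 //.
    apply/negbTE/negP => /dvdnP[k mlk]; apply: ln; apply: val_inj => /=.
    have ml := ltn_ord m; have ll := ltn_ord l.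
    have [k0|k1] : (k = 0 \/ k = 1)%N by move: mlk; case: k => [|[|k]]; [left|right|nia].
      have [m0 l0] : (m = 0 :> nat /\ l = 0 :> nat)%N by move: mlk; rewrite k0; lia.
      by rewrite m0 l0 subn0 modnn.
    have -> : (l = n - m :> nat)%N by move: mlk; rewrite k1; lia.
    rewrite modn_small //; move: ml ll mlk; rewrite k1; lia.
  case: eqP => [->|/eqP m0].
    by rewrite subn0 modnn add0n expr0 dvdn0 mul1r mulr1.
  have mn : (n - m < n)%N by move: m0 (ltn_ord m) n0; lia.
  by rewrite modn_small // subnKC ?dvdnn ?(ltnW (ltn_ord m)) // mulrC.
under eq_bigr do rewrite row; rewrite -mulr_sumr; move: ut n0; case: (n) => [//|k] /= utk _.
rewrite big_ord_recl /=; under eq_bigr do rewrite /=.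
rewrite sumr_const card_ord -(mulr_natr (u ^+ _)); move: utk => /= ->.
by rewrite subrr mulr0.
Qed.

End sum.

(** Both points are b times the n-th roots of unity, so y_k a_j = (b^2 w^j) w^k and
    [sum_kernel_roots] makes every column sum zero. *)
Lemma det_kernel_zero : exists a y : Cn n, [/\ polyd a, polyd y,
  injective (tnth a), injective (tnth y) &
  \det (\matrix_(k, j) ((1 - tnth y k * tnth a j) ^+ 2)^-1) = 0].
Proof.
have [w pw] := prim_rootC.
pose t : C := - (n.-1%:R)^-1.
have nn : n.-1%:R != 0 :> C by rewrite pnatr_eq0; lia.
pose b : C := (2 * n)%N.-root t.
have b2 : b ^+ (2 * n) = t by rewrite rootCK // muln_gt0.
have ncw : nc w = 1.
  have := congr1 (@Normc.normc Rr) (prim_expr_order pw); rewrite ncX nc1 => /eqP.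
  by rewrite pexpr_eq1 ?nc_ge0 // => /eqP.
(* |b|^(2n) = 1/(n-1), which is less than 1 because n > 2. *)
have ncb : nc b < 1.
  rewrite ltNge; apply/negP => b1.
  have h := exprn_ege1 (2 * n) b1; move: h; rewrite -ncX b2 /t ncN ncV.
  have -> : nc (n.-1%:R) = n.-1%:R.
    by rewrite -(rmorph_nat (real_complex Rr)) nc_rc ger0_norm.
  have h2 : 1 < n.-1%:R :> Rr by rewrite ltr1n; lia.
  by rewrite leNgt invf_lt1 ?h2 // (lt_trans ltr01 h2).
have bn : b != 0.
  apply/eqP => b0; move: b2; rewrite b0 expr0n muln_eq0 /= /t.
  have -> : (n == 0)%N = false by lia.
  by move/eqP; rewrite eq_sym oppr_eq0 invr_eq0 (negbTE nn).
pose a : Cn n := [tuple b * w ^+ j | j < n].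
have pa : polyd a by move=> j; rewrite tnth_mktuple ncM ncX ncw expr1n mulr1.
have ia : injective (tnth a).
  move=> i j; rewrite !tnth_mktuple => /(mulfI bn) /eqP.
  rewrite (eq_prim_root_expr pw) => /eqP.
  by rewrite !modn_small // => /val_inj.
(* The all-ones row vector lies in the left kernel. *)
exists a, a; split => //; apply/eqP/det0P; exists (const_mx 1).
  apply/eqP => /rowP /(_ (Ordinal n0)); rewrite !mxE => /eqP; by rewrite oner_eq0.
apply/rowP => j; rewrite !mxE; under eq_bigr do rewrite !mxE mul1r !tnth_mktuple.
under eq_bigr do rewrite mulrACA -expr2 [w ^+ _ * _]mulrC mulrA.
apply: (@sum_kernel_roots w (b ^+ 2 * w ^+ j)) => //.
rewrite exprMn -exprM b2 exprAC (prim_expr_order pw) expr1n mulr1 /t mulNr mulVf //.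
Qed.

End zeros.

(** * Description of the symmetrized polydisc by roots *)

Section characterization.

Lemma consP n (z : Cn n.+1) : exists x (t : Cn n), z = cons_tuple x t.
Proof. by exists (thead z), (behead_tuple z); exact: (esym (unconscK z)). Qed.

(** Division by the linear factor of a root: vanishing of the last Horner value is vanishing of the
    remainder. *)
Lemma step_of_root n l p (z : Cn n.+1) : wf l p z = 0 -> exists s : Cn n, step l p s = z.
Proof.
elim: n p z => [|n IH] p z; have [x [t ->]] := consP z.
  rewrite [t]tuple0 /wf /= => /eqP; rewrite subr_eq0 => /eqP xE.
  by exists [tuple]; rewrite step0 -xE; exact: val_inj.
rewrite /wf /= -/(wf _ _ _) => /IH[s sE].
by exists (cons_tuple (x - l * p) s); rewrite step_cons subrK sE.
Qed.

(** As a function of l the Horner value is a nonconstant polynomial, so it has a root. The auxiliary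
    claim lets the starting value be a nonzero polynomial q, to make the induction possible. *)
Lemma wf_root_exists n (z : Cn n.+1) : exists l, wf l 1 z = 0.
Proof.
suff H m (q : {poly C}) (t : seq C) : size t = m -> size q != 0%N -> exists r : {poly C}, size r = (size q + m)%N /\
    forall l, wf l q.[l] t = r.[l].
  have [|r [sr Hr]] := H n.+1 1 z (size_tuple z); first by rewrite size_poly1.
  have /closed_rootP[l /rootP rl] : size r != 1%N by rewrite sr size_poly1.
  by exists l; rewrite -rl -Hr hornerC.
elim: m q t => [|m IH] q [|x t] //= st q0; first by exists q; rewrite addn0.
have qn : q != 0 by rewrite -size_poly_eq0.
have sq : size (x%:P - 'X * q) = (size q).+1.
  have sX : size ('X * q) = (size q).+1 by rewrite mulrC size_mulX.
  rewrite addrC size_polyDl size_polyN sX // size_polyC.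
  by case: (x == 0) => //; rewrite ltnS lt0n.
have [||r [sr Hr]] := IH (x%:P - 'X * q) t; [by case: st|by rewrite sq|].
exists r; split; first by rewrite sr sq addSnnS.
by move=> l; rewrite -Hr !hornerE.
Qed.

Lemma surj_pi n (z : Cn n) : exists t, z = pi_n t.
Proof.
elim: n z => [|n IH] z; first by exists z; rewrite [z]tuple0 [pi_n _]tuple0.
have [l /step_of_root[s <-]] := wf_root_exists z; have [t ->] := IH s.
by exists (cons_tuple l t); rewrite pi_cons.
Qed.

Lemma unit_discE z : unit_disc z <-> nc z < 1.
Proof. by rewrite /unit_disc /= normE -(rmorph1 (real_complex Rr)) ltcR. Qed.

Lemma Gn_rootP n (t : Cn n) : Gn (pi_n t) -> polyd t.
Proof.
move=> [t' [d E]] j; rewrite ltNge; apply/negP => tj.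
have := wf_pi (tnth t j) t; rewrite E wf_pi [RHS](bigD1 j) //= subrr mul0r => /eqP.
apply/negP; rewrite -nc_eq0 nc_prod prodf_seq_neq0; apply/allP => i _ /=.
rewrite nc_eq0 subr_eq0; apply/eqP => ti.
by have /unit_discE := d i; rewrite ti ltNge tj.
Qed.

Lemma polyd_Gn n (t : Cn n) : polyd t -> Gn (pi_n t).
Proof. by move=> pt; exists t; split => // j; apply/unit_discE. Qed.

(** z has some preimage under [pi_n] by the fundamental theorem of algebra, and its coordinates are
    the roots of l -> [wf l 1 z]; all must lie in the disc. *)
Lemma GnP n (z : Cn n) : Gn z <-> forall l, 1 <= nc l -> wf l 1 z != 0.
Proof.
split.
  move=> [t [d ->]] l l1; rewrite wf_pi -nc_eq0 nc_prod prodf_seq_neq0; apply/allP => i _ /=.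
  rewrite nc_eq0 subr_eq0; apply/eqP => ti.
  by have /unit_discE := d i; rewrite ti ltNge l1.
have [t ->] := surj_pi z => H; apply: polyd_Gn => j; rewrite ltNge; apply/negP => tj.
by have := H _ tj; rewrite wf_pi (bigD1 j) //= subrr mul0r eqxx.
Qed.

Definition ratpt (q : rat * rat) : C := complex.Complex (ratr q.1) (ratr q.2).

Lemma ratpt_near l (e : Rr) : 0 < e -> exists q, nc (l - ratpt q) < e.
Proof.
move=> e0; have e2 : 0 < e / 2 by rewrite divr_gt0.
have [p hp] := rat_near (Re l) e2; have [q hq] := rat_near (Im l) e2.
exists (p, q); apply: le_lt_trans (nc_le_ReIm _) _; rewrite ReB ImB /=.
by rewrite [e]splitr ltrD.
Qed.

Lemma ccont_wf n (z : Cn n) l : ccont (fun l => wf l 1 z) l.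
Proof.
suff H (a : C -> C) : ccont a l -> ccont (fun l => wf l (a l) z) l.
  exact: (H (fun=> 1) (ccont_cst _ _)).
elim: n z a => [|n IH] z a ca; first by rewrite [z]tuple0; exact: ca.
have [x [t ->]] := consP z; rewrite /wf /=; apply: (IH t (fun l => x - l * a l)).
by apply: ccont_sub; [exact: ccont_cst|apply: ccont_mul => //; exact: ccont_id].
Qed.

(** z is in G_n iff for some k the evaluation at every rational point q with |q| > 1 - 1/(k+1) has
    modulus at least 1/(k+1): a countable combination of measurable conditions. *)
Lemma measurable_Gn n : measurable (@Gn n).
Proof.
pose B k (q : rat * rat) : set (Cn n) := [set z | nc (wf (ratpt q) 1 z) < k.+1%:R^-1].
pose P k (q : rat * rat) := 1 - k.+1%:R^-1 < nc (ratpt q).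
have mB k q : measurable (B k q).
  have m1 : measurable_fun setT (fun z : Cn n => nc (wf (ratpt q) 1 z) : mR).
    by apply: measurable_nc; apply: measurable_wf; [exact: measurable_cst|exact: measurable_cst|exact: measurable_id].
  have := m1 measurableT `]-oo, k.+1%:R^-1[%classic (measurable_itv _).
  rewrite setTI; congr measurable; apply/seteqP; split => z /=; rewrite /B /= in_itv //=.
suff -> : @Gn n = \bigcup_k \bigcap_(q in P k) ~` B k q.
  by apply: bigcup_measurable => k _; exact: bigcap_count_measurable.
apply/seteqP; split => z.
  move=> [t [d zE]]; have dt j : nc (tnth t j) < 1 by apply/unit_discE.
  have [r r1 tr] : exists2 r : Rr, r < 1 & forall j, nc (tnth t j) <= r.
    exists (\big[Num.max/0]_j nc (tnth t j)); last by move=> j; rewrite (bigD1 j) //= le_max lexx.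
    by elim/big_ind: _ => // x y x1 y1; rewrite gt_max x1.
  have r0 : 0 < (1 - r) / 2 by rewrite divr_gt0 // subr_gt0.
  (* With all roots of modulus at most r, a rational point with |q| > 1 - (1-r)/2 is at distance at
     least (1-r)/2 from each root, so the evaluation is at least ((1-r)/2)^n. *)
  have [k1 hk1] := inv_nat_small r0; have [k2 hk2] := inv_nat_small (exprn_gt0 n r0).
  exists (maxn k1 k2) => // q hq; rewrite /P in hq; apply/negP; rewrite -leNgt.
  have mono k : (k <= maxn k1 k2)%N -> (maxn k1 k2).+1%:R^-1 <= k.+1%:R^-1 :> Rr.
    by move=> h; rewrite lef_pV2 ?posrE // ler_nat.
  apply: le_trans (mono _ (leq_maxr _ _)) _; apply: le_trans (ltW hk2) _.
  rewrite zE wf_pi nc_prod -[X in _ ^+ X]card_ord -prodr_const; apply: ler_prod => j _.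
  rewrite (ltW r0) /=; have := nc_ge_sub (ratpt q) (- tnth t j); rewrite ncN ncB.
  apply: le_trans; have := tr j; have := mono _ (leq_maxl k1 k2).
  move: hq hk1 r0; move: ((maxn k1 k2).+1%:R^-1) (k1.+1%:R^-1) (nc (ratpt q)) (nc (tnth t j)); clear.
  by move=> a b c e *; lra.
move=> [k _ Hk]; apply/GnP => l l1; apply/eqP => wl.
have k0 : 0 < k.+1%:R^-1 / 2 :> Rr by rewrite divr_gt0 // invr_gt0.
have [de de0 Hde] := ccont_wf z l k0.
have [q hq] : exists q, nc (l - ratpt q) < Num.min de (k.+1%:R^-1).
  by apply: ratpt_near; rewrite lt_min de0 /= invr_gt0 ltr0n.
move: hq; rewrite lt_min ncB => /andP[h1 h2].
have Pq : P k q.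
  have := nc_ge_sub l (ratpt q - l); rewrite addrCA subrr addr0; rewrite /P; apply: lt_le_trans.
  by move: h2 l1; move: (k.+1%:R^-1) (nc _) (nc _) => *; lra.
have := Hk q Pq; rewrite /B /=; apply; have := Hde _ h1; rewrite wl subr0 => h.
by apply: le_lt_trans h _; rewrite ltr_pdivrMr // ltr_pMr ?invr_gt0 // ltr1n.
Qed.

(** Each coordinate is a sum, over some of the subsets of the indices, of products of modulus at
    most 1. *)
Lemma Gn_bounded n (z : Cn n) : Gn z -> forall j, nc (tnth z j) <= #|{set 'I_n}|%:R.
Proof.
move=> [t [d ->]] j; rewrite tnth_mktuple /esym_k; apply: le_trans (nc_sum _ _ _) _.
rewrite -sum1_card natr_sum [leRHS](bigID (fun S : {set 'I_n} => #|S| == j.+1)) /=.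
rewrite -[leLHS]addr0; apply: lerD; last by apply: sumr_ge0 => S _; exact: ler01.
apply: ler_sum => S _; rewrite nc_prod; apply: prodr_ile1 => i.
by rewrite nc_ge0 /=; have /unit_discE/ltW := d i.
Qed.

End characterization.

(** * Integrability of bounded functions with bounded support *)

Section bounded_sets.
Variable M : Rr.

Definition bxf n (t : Cn n) : Rr := \prod_(j < n) \1_(csq M) (tnth t j).

Lemma bxf_ge0 n (t : Cn n) : 0 <= bxf t.
Proof. by apply: prodr_ge0 => j _. Qed.

Lemma bxf1 n (t : Cn n) : (forall j, nc (tnth t j) <= M) -> bxf t = 1.
Proof. by move=> h; rewrite /bxf big1 // => j _; rewrite indicE mem_set //; exact: csq_nc. Qed.

Lemma measurable_bxf n : measurable_fun setT (@bxf n : Cn n -> mR).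
Proof.
apply: measurable_prod => j _; apply: (measurableT_comp _ (measurable_tnth j)).
by apply: measurable_indic; exact: measurable_csq.
Qed.

Lemma integrable_bxf n : (muN n).-integrable setT (EFin \o @bxf n).
Proof.
have mb m := @measurable_bxf m.
apply/integrableP; split; first by apply/measurable_EFinP; exact: mb.
under eq_integral do rewrite /= ger0_norm ?bxf_ge0 //.
elim: n => [|n IH]; first by rewrite integral_muN0 /bxf big_ord0 ltry.
rewrite integral_muN_ge0; [|by apply/measurable_EFinP; exact: mb|by move=> t; rewrite lee_fin bxf_ge0].
under eq_integral => z _.
  under eq_integral => t _.
    rewrite /bxf big_ord_recl tnth_cons0; under eq_bigr do rewrite tnth_consS.
    rewrite EFinM; over.
  rewrite ge0_integralZl ?lee_fin //; [|by apply/measurable_EFinP; exact: mb|by move=> t _; rewrite lee_fin bxf_ge0].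
  over.
have h : (\int[muN n]_t (bxf t)%:E)%E \is a fin_num.
  by rewrite ge0_fin_numE // integral_ge0 // => t _; rewrite lee_fin bxf_ge0.
rewrite ge0_integralZr //; last 2 first.
- by apply/measurable_EFinP; apply: measurable_indic; exact: measurable_csq.
- by apply: integral_ge0 => t _; rewrite lee_fin bxf_ge0.
rewrite integral_indic ?setIT; [|exact: measurableT|exact: measurable_csq].
by apply: lte_mul_pinfty => //; rewrite ge0_fin_numE // muC_csq.
Qed.

Lemma cintegrable_bounded n (f : Cn n -> C) (K : Rr) : measurable_fun setT f ->
  (forall t, nc (f t) <= K) -> (forall t, f t != 0 -> forall j, nc (tnth t j) <= M) ->
  cintegrable (muN n) f.
Proof.
move=> mf fK f0; have ib := integrableZl measurableT K (integrable_bxf n).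
apply: (cintegrable_le (g := fun t => K * bxf t) mf).
  by apply: eq_integrable ib => // t _; rewrite EFinM.
move=> t; have [->|/f0 ht] := eqVneq (f t) 0; last by rewrite bxf1 // mulr1.
by rewrite nc0 mulr_ge0 ?bxf_ge0 // (le_trans (nc_ge0 _) (fK t)).
Qed.

End bounded_sets.

(** * Holomorphic functions of several variables: continuity and measurability *)

Section frechet.
Variable n : nat.
Implicit Types (z h a : Cn n) (f : Cn n -> C) (D : set (Cn n)).

(** [lin] is complex linear, with no conjugation. *)
Definition lin a h : C := \sum_j tnth a j * tnth h j.
Definition nrm1 h : Rr := \sum_j nc (tnth h j).

Definition FDon D f z a := forall e : Rr, 0 < e -> exists2 de : Rr, 0 < de & forall h,
  (forall j, nc (tnth h j) < de) -> D (addCn z h) ->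
  nc (f (addCn z h) - f z - lin a h) <= e * nrm1 h.

Lemma holomorphic_onE D f : holomorphic_on D f <-> forall z, D z -> exists a, FDon D f z a.
Proof.
have nrmE h : \sum_j `|tnth h j| = rc (nrm1 h).
  by rewrite rmorph_sum; apply: eq_bigr => j _; exact: normE.
split=> H z Dz; have [a Ha] := H z Dz; exists a => e e0; have [de de0 Hde] := Ha e e0;
  exists de => // h hd Dh.
- have := Hde h _ Dh; rewrite nrmE normE -[complex.Complex e 0]/(rc e) -rcM lecR; apply.
  by move=> j; rewrite normE ltcR.
- rewrite nrmE normE -[complex.Complex e 0]/(rc e) -rcM lecR; apply: Hde => // j.
  by have := hd j; rewrite normE ltcR.
Qed.

Lemma nrm1_ge0 h : 0 <= nrm1 h.
Proof. by apply: sumr_ge0 => j _; exact: nc_ge0. Qed.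

Lemma lin_le a h : nc (lin a h) <= nrm1 a * nrm1 h.
Proof.
apply: le_trans (nc_sum _ _ _) _; rewrite /nrm1 mulr_sumr; apply: ler_sum => j _.
rewrite ncM ler_wpM2r ?nc_ge0 // (bigD1 j) //= lerDl.
by apply: sumr_ge0 => i _; exact: nc_ge0.
Qed.

Lemma FDon_cont D f z a : FDon D f z a -> forall e : Rr, 0 < e -> exists2 de : Rr, 0 < de & forall h,
  (forall j, nc (tnth h j) < de) -> D (addCn z h) -> nc (f (addCn z h) - f z) <= e.
Proof.
move=> Ha e e0; have [de de0 Hde] := Ha 1 ltr01.
have K0 : 0 < (1 + nrm1 a) * n.+1%:R by rewrite mulr_gt0 // ltr_pwDl // nrm1_ge0.
exists (Num.min de (e / ((1 + nrm1 a) * n.+1%:R))); first by rewrite lt_min de0 divr_gt0.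
move=> h hd Dh; have h1 j : nc (tnth h j) < de by have := hd j; rewrite lt_min => /andP[].
have h2 : (1 + nrm1 a) * nrm1 h <= e.
  have : nrm1 h <= n.+1%:R * (e / ((1 + nrm1 a) * n.+1%:R)).
    have E0 : 0 <= e / ((1 + nrm1 a) * n.+1%:R) by rewrite divr_ge0 // ltW.
    apply: le_trans (_ : n%:R * (e / ((1 + nrm1 a) * n.+1%:R)) <= _); last first.
      by rewrite ler_wpM2r // ler_nat.
    have -> (X : Rr) : n%:R * X = \sum_(j < n) X by rewrite sumr_const card_ord mulr_natl.
    apply: ler_sum => j _.
    by have := hd j; rewrite lt_min => /andP[_ /ltW].
  move=> /(ler_wpM2l (_ : 0 <= 1 + nrm1 a)) => /(_ (addr_ge0 ler01 (nrm1_ge0 a))).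
  have -> : (1 + nrm1 a) * (n.+1%:R * (e / ((1 + nrm1 a) * n.+1%:R))) = e.
    by rewrite mulrA mulrC divfK // gt_eqF.
  by [].
apply: le_trans h2; rewrite mulrDl mul1r.
rewrite -[f _ - f z](subrK (lin a h)); apply: le_trans (nc_triangle _ _) _.
by apply: lerD; [have := Hde h h1 Dh; rewrite mul1r|exact: lin_le].
Qed.

Definition subCn y z : Cn n := [tuple tnth y j - tnth z j | j < n].

Lemma addCn_subCn y z : addCn z (subCn y z) = y.
Proof. by apply: eq_from_tnth => j; rewrite !tnth_mktuple addrC subrK. Qed.

Definition ccbox (q : n.-tuple (rat * rat * nat)) : set (Cn n) :=
  [set t | forall j, cbox (tnth q j) (tnth t j)].

Lemma measurable_ccbox q : measurable (ccbox q).
Proof.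
pose B (j : 'I_n) := ~` [set t : Cn n | cbox (tnth q j) (tnth t j)].
have mB j : measurable (B j).
  apply: measurableC; rewrite -[X in measurable X]setTI.
  exact: (measurable_tnth j) measurableT _ (measurable_cbox _).
rewrite (_ : ccbox q = \bigcap_(j in setT) ~` B j); first exact: bigcap_count_measurable.
apply/seteqP; split => t /=; first by move=> h j _ hb; apply: hb; exact: h.
by move=> h j; apply: contrapT => nb; exact: (h j I nb).
Qed.

Lemma ccbox_near z (e : Rr) : 0 < e -> exists2 q, ccbox q z & forall y, ccbox q y ->
  forall j, nc (tnth y j - tnth z j) < e.
Proof.
move=> e0; have h (j : 'I_n) : exists q, cbox q (tnth z j) /\ forall w, cbox q w -> nc (w - tnth z j) < e.
  by have [q q1 q2] := cbox_near (tnth z j) e0; exists q.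
have /choice[qf Hq] := h.
exists [tuple qf j | j < n] => [j|y Hy j]; first by rewrite tnth_mktuple; have [] := Hq j.
by have := Hy j; rewrite tnth_mktuple; have [_] := Hq j; apply.
Qed.

(** Differentiability gives continuity relative to D, and rational boxes form a countable base. *)
Lemma measurable_holomorphic D f : measurable D -> holomorphic_on D f ->
  measurable_fun setT (fun z => if `[< D z >] then f z else 0).
Proof.
move=> mD /holomorphic_onE hf.
have key (p : C -> Rr) : (forall v w : C, p (v - w) = p v - p w) -> (forall w : C, `|p w| <= nc w) ->
    p 0 = 0 -> measurable_fun setT (fun z => p (if `[< D z >] then f z else 0) : mR).
  move=> pB pn p0.
  have mf : measurable_fun D (fun z => p (f z) : mR).
    apply: (measurable_fun_basis measurable_ccbox mD) => z e Dz e0.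
    have e2 : 0 < e / 2 by rewrite divr_gt0.
    have [a Ha] := hf z Dz; have [de de0 Hde] := FDon_cont Ha e2.
    have [q qz Hq] := ccbox_near z de0; exists q => // y Dy /Hq hy.
    have := Hde (subCn y z); rewrite addCn_subCn => /(_ _ Dy) h.
    rewrite -pB; apply: le_lt_trans (pn _) _; apply: le_lt_trans (h _) _.
      by move=> j; rewrite tnth_mktuple.
    by rewrite ltr_pdivrMr // ltr_pMr // ltr1n.
  have := (measurable_restrictT _ mD).1 mf; congr measurable_fun; apply/funext => z.
  rewrite /patch; case: asboolP => [h|h]; first by rewrite mem_set.
  by rewrite memNset // p0.
apply: measurable_fun_complex; apply: key => //.
- exact: ReB. - exact: Re_le_nc. - exact: ImB. - exact: Im_le_nc.
Qed.

End frechet.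

(** * Pullback of holomorphic functions to the polydisc *)

Section partial_holomorphy.

Definition hol1 (F : C -> C) z := exists c, Wd F c 0 z.

Lemma hol1_cst a z : hol1 (fun=> a) z. Proof. by exists 0; exact: Wd_cst. Qed.
Lemma hol1_id z : hol1 id z. Proof. by exists 1; exact: Wd_id. Qed.
Lemma hol1_sub F G z : hol1 F z -> hol1 G z -> hol1 (fun w => F w - G w) z.
Proof. by move=> [a A] [b B]; exists (a - b); apply: eq_Wd (Wd_sub A B); rewrite ?subr0. Qed.
Lemma hol1_mul F G z : hol1 F z -> hol1 G z -> hol1 (fun w => F w * G w) z.
Proof.
move=> [a A] [b B]; exists (F z * b + a * G z); apply: eq_Wd (Wd_mul A B) => //.
by rewrite mulr0 mul0r addr0.
Qed.
Lemma hol1_prod n (F : 'I_n -> C -> C) z : (forall j, hol1 (F j) z) ->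
  hol1 (fun w => \prod_(j < n) F j w) z.
Proof.
elim: n F => [|n IH] F HF; first by under eq_fun do rewrite big_ord0; exact: hol1_cst.
by under eq_fun do rewrite big_ord_recl; apply: hol1_mul => //; apply: IH.
Qed.

Lemma hol1_vdm n (t : Cn n) i z : hol1 (fun w => vdm (updt t i w)) z.
Proof.
elim: n t i z => [|n IH] t i z; first by case: i.
have [x [s ->]] := consP t; case: (unliftP ord0 i) => [j ->|->].
  under eq_fun do rewrite updt_consS vdm_cons; apply: hol1_mul; last exact: IH.
  apply: hol1_prod => k; apply: hol1_sub; last exact: hol1_cst.
  under eq_fun do rewrite tnth_mktuple; case: (k == j); [exact: hol1_id|exact: hol1_cst].
under eq_fun do rewrite updt_cons0 vdm_cons; apply: hol1_mul; last exact: hol1_cst.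
by apply: hol1_prod => k; apply: hol1_sub; [exact: hol1_cst|exact: hol1_id].
Qed.

Lemma updt_id n (t : Cn n) i : updt t i (tnth t i) = t.
Proof. by apply: eq_from_tnth => j; rewrite tnth_mktuple; case: eqP => [->|]. Qed.

(** Each monomial of an elementary symmetric polynomial has degree at most 1 in each variable, so
    [pi_n] is affine along coordinate lines; e is the direction. *)
Lemma pi_updt n (t : Cn n) i : exists e : Cn n, forall w,
  pi_n (updt t i (tnth t i + w)) = addCn (pi_n t) [tuple w * tnth e j | j < n].
Proof.
exists [tuple \sum_(S : {set 'I_n} | (#|S| == k.+1) && (i \in S)) \prod_(j in S :\ i) tnth t j | k < n] => w.
apply: eq_from_tnth => k; rewrite !tnth_mktuple /esym_k mulr_sumr.
rewrite (bigID (fun S : {set 'I_n} => i \in S)) /= [in RHS](bigID (fun S : {set 'I_n} => i \in S)) /=.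
rewrite addrAC; congr (_ + _); last first.
  apply: eq_bigr => S /andP[_ iS]; apply: eq_bigr => j jS; rewrite tnth_mktuple.
  by case: eqP => // ji; move: iS; rewrite -ji jS.
rewrite -big_split /=; apply: eq_bigr => S /andP[_ iS].
rewrite (big_setD1 i) //= [in RHS](big_setD1 i) //= tnth_mktuple eqxx -mulrDl; congr (_ * _).
apply: eq_bigr => j; rewrite !inE => /andP[/negbTE ji _]; by rewrite tnth_mktuple ji.
Qed.

(** Along a coordinate line [pi_n] is affine, so the derivative of f(pi_n) is the differential of f
    on the direction e. The radius condition keeps the moved point in the polydisc. *)
Lemma sephol_pullback n (f : Cn n -> C) : holomorphic_on (@Gn n) f ->
  sephol (fun t => if `[< polyd t >] then f (pi_n t) * vdm t else 0).
Proof.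
move=> /holomorphic_onE hf i t pt.
have t1 : 0 < 1 - nc (tnth t i) by rewrite subr_gt0.
have near z : nc (z - tnth t i) < 1 - nc (tnth t i) -> polyd (updt t i z).
  move=> hz j; rewrite tnth_mktuple; case: eqP => [_|_]; last exact: pt.
  have := nc_triangle (z - tnth t i) (tnth t i); rewrite subrK => h; apply: le_lt_trans h _.
  by rewrite -ltrBrDr.
suff [c W] : hol1 (fun z => f (pi_n (updt t i z)) * vdm (updt t i z)) (tnth t i).
  by exists c; apply: (Wd_near t1 _ W) => z /near pz; rewrite asboolT.
apply: hol1_mul; last exact: hol1_vdm.
have [a Ha] := hf _ (polyd_Gn pt); have [e He] := pi_updt t i.
exists (lin a e) => r r0; have N0 := nrm1_ge0 e.
have r1 : 0 < r / (1 + nrm1 e) by rewrite divr_gt0 // ltr_pwDl.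
have [de de0 Hde] := Ha _ r1.
exists (Num.min (1 - nc (tnth t i)) (de / (1 + nrm1 e))).
  by rewrite lt_min t1 divr_gt0 // ltr_pwDl.
move=> h; rewrite lt_min => /andP[h1 h2]; rewrite mul0r subr0 He.
have -> : pi_n (updt t i (tnth t i)) = pi_n t by rewrite updt_id.
have -> : lin a e * h = lin a [tuple h * tnth e j | j < n].
  by rewrite /lin mulr_suml; apply: eq_bigr => j _; rewrite tnth_mktuple mulrAC mulrA.
apply: le_trans (Hde _ _ _) _.
- move=> j; rewrite tnth_mktuple ncM; move: h2; rewrite ltr_pdivlMr ?ltr_pwDl //.
  apply: le_lt_trans; rewrite ler_wpM2l ?nc_ge0 // /nrm1 (bigD1 j) //= addrCA lerDl.
  by rewrite addr_ge0 // sumr_ge0 // => k _; exact: nc_ge0.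
- rewrite -He; apply: polyd_Gn; apply: near; by rewrite addrC addKr.
- have -> : nrm1 [tuple h * tnth e j | j < n] = nc h * nrm1 e.
    by rewrite /nrm1 mulr_sumr; apply: eq_bigr => j _; rewrite tnth_mktuple ncM.
  rewrite mulrCA [leRHS]mulrC ler_wpM2l ?nc_ge0 // mulrAC ler_pdivrMr ?ltr_pwDl //.
  by rewrite ler_wpM2l ?(ltW r0) // lerDr.
Qed.

End partial_holomorphy.

(** * Differentiation rules and boundedness for rational functions *)

Section frechet_calculus.
Variable n : nat.
Implicit Types (z h a b : Cn n) (f g : Cn n -> C) (r k : Cn n -> C).

Definition nearh (P : Cn n -> Prop) := exists2 de : Rr, 0 < de & forall h,
  (forall j, nc (tnth h j) < de) -> P h.

Lemma nearhI P Q : nearh P -> nearh Q -> nearh (fun h => P h /\ Q h).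
Proof.
move=> [d1 d10 H1] [d2 d20 H2]; exists (Num.min d1 d2); first by rewrite lt_min d10.
by move=> h hd; split; [apply: H1|apply: H2] => j; have := hd j; rewrite lt_min => /andP[].
Qed.

Lemma nearh_sub (P Q : Cn n -> Prop) : (forall h, P h -> Q h) -> nearh P -> nearh Q.
Proof. by move=> PQ [d d0 H]; exists d => // h /H/PQ. Qed.

Definition small r := forall e : Rr, 0 < e -> nearh (fun h => nc (r h) <= e * nrm1 h).
Definition tends0 k := forall e : Rr, 0 < e -> nearh (fun h => nc (k h) <= e).

Lemma small_add r1 r2 : small r1 -> small r2 -> small (fun h => r1 h + r2 h).
Proof.
move=> s1 s2 e e0; have e2 : 0 < e / 2 by rewrite divr_gt0.
apply: nearh_sub (nearhI (s1 _ e2) (s2 _ e2)) => h [h1 h2].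
apply: le_trans (nc_triangle _ _) _; apply: le_trans (lerD h1 h2) _.
by rewrite -mulrDl -splitr.
Qed.

Lemma small_mul k r (K : Rr) : nearh (fun h => nc (k h) <= K) -> small r -> small (fun h => k h * r h).
Proof.
move=> kK sr e e0; have K1 : 0 < `|K| + 1 by rewrite ltr_wpDl.
have eK : 0 < e / (`|K| + 1) by rewrite divr_gt0.
apply: nearh_sub (nearhI kK (sr _ eK)) => h [h1 h2]; rewrite ncM.
apply: le_trans (_ : (`|K| + 1) * (e / (`|K| + 1) * nrm1 h) <= _); last first.
  by rewrite mulrA [_ * (e / _)]mulrC divfK ?gt_eqF.
apply: ler_pM; rewrite ?nc_ge0 //; apply: le_trans h1 _; apply: le_trans (ler_norm K) _.
by rewrite lerDl.
Qed.

Lemma small_lin k a : tends0 k -> small (fun h => k h * lin a h).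
Proof.
move=> tk e e0; have K1 : 0 < nrm1 a + 1 by rewrite ltr_wpDl ?nrm1_ge0.
have eK : 0 < e / (nrm1 a + 1) by rewrite divr_gt0.
apply: nearh_sub (tk _ eK) => h h1; rewrite ncM.
apply: le_trans (ler_pM (nc_ge0 _) (nc_ge0 _) h1 (lin_le a h)) _.
rewrite mulrA ler_wpM2r ?nrm1_ge0 // -mulrA ger_pMr // mulrC ler_pdivrMr // mul1r.
by rewrite lerDl.
Qed.

Lemma eq_small r1 r2 : (forall h, r1 h = r2 h) -> small r1 -> small r2.
Proof. by move=> /funext ->. Qed.

(** Differentiability in a full neighbourhood, unlike [FDon]; suited to explicit rational
    expressions. *)
Definition FD f z := exists a, small (fun h => f (addCn z h) - f z - lin a h).

Lemma FD_cont f z : FD f z -> tends0 (fun h => f (addCn z h) - f z).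
Proof.
move=> [a sa] e e0; have Ha : FDon setT f z a.
  by move=> e' /sa[de de0 H]; exists de => // h /H.
by have [de de0 H] := FDon_cont Ha e0; exists de => // h /H; apply.
Qed.

Lemma FD_near_le f z : FD f z -> nearh (fun h => nc (f (addCn z h)) <= nc (f z) + 1).
Proof.
move=> /FD_cont/(_ 1 ltr01); apply: nearh_sub => h h1.
have := nc_triangle (f (addCn z h) - f z) (f z); rewrite subrK => h2.
by apply: le_trans h2 _; rewrite addrC lerD2l.
Qed.

Lemma nearhT (P : Cn n -> Prop) : (forall h, P h) -> nearh P.
Proof. by move=> H; exists 1. Qed.

Lemma small0 : small (fun=> 0).
Proof. by move=> e e0; apply: nearhT => h; rewrite nc0 mulr_ge0 ?nrm1_ge0 // ltW. Qed.

Lemma FD_cst (c : C) z : FD (fun=> c) z.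
Proof.
exists [tuple 0 | j < n]; apply: eq_small small0 => h.
by rewrite /lin big1 => [|j _]; rewrite ?subrr ?subr0 // tnth_mktuple mul0r.
Qed.

Lemma FD_coord i z : FD (fun z => tnth z i) z.
Proof.
exists [tuple (if j == i then 1 else 0) | j < n]; apply: eq_small small0 => h.
rewrite /lin (bigD1 i) //= big1 => [|j /negbTE ji]; rewrite tnth_mktuple ?ji ?mul0r //.
by rewrite tnth_mktuple eqxx; ring.
Qed.

Lemma FD_add f g z : FD f z -> FD g z -> FD (fun z => f z + g z) z.
Proof.
move=> [a sa] [b sb]; exists (addCn a b); apply: eq_small (small_add sa sb) => h.
have -> : lin (addCn a b) h = lin a h + lin b h.
  by rewrite /lin -big_split; apply: eq_bigr => j _; rewrite tnth_mktuple mulrDl.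
by ring.
Qed.

Lemma linZ (c : C) a h : lin [tuple c * tnth a j | j < n] h = c * lin a h.
Proof. by rewrite /lin mulr_sumr; apply: eq_bigr => j _; rewrite tnth_mktuple mulrA. Qed.

Lemma FD_mul f g z : FD f z -> FD g z -> FD (fun z => f z * g z) z.
Proof.
move=> Ff Fg; have [a sa] := Ff; have [b sb] := Fg.
exists (addCn [tuple g z * tnth a j | j < n] [tuple f z * tnth b j | j < n]).
have s1 := small_mul (FD_near_le Ff) sb.
have s2 := small_mul (k := fun=> g z) (nearhT (fun h => lexx _)) sa.
have s3 := small_lin b (FD_cont Ff).
apply: eq_small (small_add (small_add s1 s2) s3) => h.
have -> : lin (addCn [tuple g z * tnth a j | j < n] [tuple f z * tnth b j | j < n]) h =
    g z * lin a h + f z * lin b h.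
  rewrite -!linZ /lin -big_split; apply: eq_bigr => j _; by rewrite !tnth_mktuple mulrDl.
by ring.
Qed.

Lemma FD_inv f z : f z != 0 -> FD f z -> FD (fun z => (f z)^-1) z.
Proof.
move=> fz Ff; have [a sa] := Ff; have n0 : 0 < nc (f z) / 2 by rewrite divr_gt0 // nc_gt0.
exists [tuple - (f z ^+ 2)^-1 * tnth a j | j < n].
have low : nearh (fun h => nc (f z) / 2 <= nc (f (addCn z h))).
  apply: nearh_sub (FD_cont Ff n0) => h h1.
  have := nc_ge_sub (f z) (f (addCn z h) - f z); rewrite addrCA subrr addr0.
  by apply: le_trans; move: h1; move: (nc (f z)) (nc (_ - _)) => *; lra.
have bd : nearh (fun h => nc ((f (addCn z h) * f z ^+ 2)^-1) <= (nc (f z) / 2 * nc (f z) ^+ 2)^-1).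
  apply: nearh_sub low => h h1; rewrite ncV ncM ncX lef_pV2 ?posrE.
  - by rewrite ler_wpM2r ?exprn_ge0 ?nc_ge0.
  - by rewrite mulr_gt0 ?exprn_gt0 ?nc_gt0 // -nc_gt0 (lt_le_trans n0 h1).
  - by rewrite mulr_gt0 ?exprn_gt0 ?nc_gt0.
have s1 := small_mul (k := fun=> - f z) (nearhT (fun h => lexx _)) sa.
have s2 := small_lin a (FD_cont Ff).
have s3 := small_mul bd (small_add s1 s2).
move=> e e0; apply: nearh_sub (nearhI low (s3 e e0)) => h [l1]; rewrite linZ.
have fh : f (addCn z h) != 0 by rewrite -nc_gt0 (lt_le_trans n0 l1).
congr (nc _ <= _); by field; rewrite fz fh.
Qed.

Lemma FD_sum I (s : seq I) (F : I -> Cn n -> C) z : (forall i, FD (F i) z) ->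
  FD (fun z => \sum_(i <- s) F i z) z.
Proof.
move=> H; elim: s => [|i s IH]; first by under eq_fun do rewrite big_nil; exact: FD_cst.
by under eq_fun do rewrite big_cons; exact: FD_add.
Qed.

Lemma FD_prod I (s : seq I) (F : I -> Cn n -> C) z : (forall i, FD (F i) z) ->
  FD (fun z => \prod_(i <- s) F i z) z.
Proof.
move=> H; elim: s => [|i s IH]; first by under eq_fun do rewrite big_nil; exact: FD_cst.
by under eq_fun do rewrite big_cons; exact: FD_mul.
Qed.

Definition bdd f := exists K : Rr, forall z, Gn z -> nc (f z) <= K.

Lemma bdd_cst (c : C) : bdd (fun=> c). Proof. by exists (nc c). Qed.

Lemma bdd_coord i : bdd (fun z => tnth z i).
Proof. by exists #|{set 'I_n}|%:R => z /Gn_bounded. Qed.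

Lemma bdd_add f g : bdd f -> bdd g -> bdd (fun z => f z + g z).
Proof.
move=> [K HK] [L HL]; exists (K + L) => z Gz; apply: le_trans (nc_triangle _ _) _.
by rewrite lerD ?HK ?HL.
Qed.

Lemma bdd_mul f g : bdd f -> bdd g -> bdd (fun z => f z * g z).
Proof. by move=> [K HK] [L HL]; exists (K * L) => z Gz; rewrite ncM ler_pM ?nc_ge0 ?HK ?HL. Qed.

Lemma bdd_inv f (m : Rr) : 0 < m -> (forall z, Gn z -> m <= nc (f z)) -> bdd (fun z => (f z)^-1).
Proof.
move=> m0 H; exists m^-1 => z Gz; rewrite ncV lef_pV2 ?posrE ?H //.
exact: lt_le_trans m0 (H z Gz).
Qed.

Lemma bdd_sum I (s : seq I) (F : I -> Cn n -> C) : (forall i, bdd (F i)) ->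
  bdd (fun z => \sum_(i <- s) F i z).
Proof.
move=> H; elim: s => [|i s IH]; first by under eq_fun do rewrite big_nil; exact: bdd_cst.
by under eq_fun do rewrite big_cons; exact: bdd_add.
Qed.

Lemma bdd_prod I (s : seq I) (F : I -> Cn n -> C) : (forall i, bdd (F i)) ->
  bdd (fun z => \prod_(i <- s) F i z).
Proof.
move=> H; elim: s => [|i s IH]; first by under eq_fun do rewrite big_nil; exact: bdd_cst.
by under eq_fun do rewrite big_cons; exact: bdd_mul.
Qed.

End frechet_calculus.

(** * The determinant divided by the Vandermonde product, as a function on G_n *)

Section kappa.
Variables (n : nat) (b : Cn n).
Hypothesis pb : polyd b.

(** With E the generating polynomial of z, [Eb] is E(x), that is the product of the 1 + t_j x when z
    = [pi_n t], and [Nb] is x^i ((i+1) E(x) - x E'(x)). *)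
Definition Eb (z : Cn n) (x : C) : C := \sum_(k < n.+1) nth 0 (1 :: z) k * x ^+ k.
Definition Nb (z : Cn n) (x : C) (i : nat) : C :=
  x ^+ i * \sum_(k < n.+1) (i.+1%:R - k%:R) * (nth 0 (1 :: z) k * x ^+ k).
Definition kap_entry (z : Cn n) (i j : 'I_n) : C := Nb z (tnth b j) i / Eb z (tnth b j) ^+ 2.
(** An explicit formula in the coordinates of z, so holomorphy of the quotient of the determinant by
    the Vandermonde product follows without removing singularities. *)
Definition kap (z : Cn n) : C := \det (\matrix_(i, j) kap_entry z i j).

Lemma size_es (t : seq C) : (size (es t) <= (size t).+1)%N.
Proof.
elim: t => [|x t IH]; first by rewrite /es big_nil size_poly1.
rewrite es_cons; apply/leq_sizeP => -[//|j] hj; rewrite coefD coefZ coefXM /=.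
by rewrite !nth_default ?mulr0 ?addr0 //; apply: leq_trans IH _ => //; exact: ltnW.
Qed.

Lemma sum_coef_weighted (p : {poly C}) m x : (size p <= m)%N ->
  \sum_(i < m) i%:R * (p`_i * x ^+ i) = x * (deriv p).[x].
Proof.
move=> pm; have c i : ('X * deriv p)`_i = p`_i *+ i by rewrite coefXM coef_deriv; case: i.
have sq : (size ('X * deriv p)%R <= m)%N.
  by apply/leq_sizeP => j mj; rewrite c nth_default ?mul0rn // (leq_trans pm).
have -> : x * (deriv p).[x] = ('X * deriv p)%R.[x] by rewrite hornerM hornerX.
rewrite (horner_coef_wide _ sq); apply: eq_bigr => i _.
by rewrite c !mulrnAl mul1r.
Qed.

Lemma Eb_pi (t : Cn n) x : Eb (pi_n t) x = (es t).[x].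
Proof.
have sz : (size (es t) <= n.+1)%N by rewrite -[in X in (_ <= X)%N](size_tuple t) size_es.
by rewrite (horner_coef_wide _ sz); apply: eq_bigr => k _; rewrite nth_pi.
Qed.

Lemma Nb_pi (t : Cn n) x i : Nb (pi_n t) x i =
  x ^+ i * (i.+1%:R * (es t).[x] - x * (deriv (es t)).[x]).
Proof.
have sz : (size (es t) <= n.+1)%N by rewrite -[in X in (_ <= X)%N](size_tuple t) size_es.
rewrite -(sum_coef_weighted _ sz) (horner_coef_wide _ sz) mulr_sumr -sumrB /Nb.
by congr (_ * _); apply: eq_bigr => k _; rewrite nth_pi mulrBl.
Qed.

Lemma horner_es (t : Cn n) x : (es t).[x] = \prod_(j < n) (1 + tnth t j * x).
Proof.
rewrite /es big_tuple horner_prod; apply: eq_bigr => j _.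
by rewrite hornerD hornerC hornerZ hornerX.
Qed.

(** Each factor satisfies |1 + t_i b_j| >= 1 - |b_j|, uniformly over G_n: the denominators are
    bounded away from 0. *)
Lemma Eb_lower (z : Cn n) j : Gn z -> (1 - nc (tnth b j)) ^+ n <= nc (Eb z (tnth b j)).
Proof.
move=> [t [d ->]]; rewrite Eb_pi horner_es nc_prod -[X in _ ^+ X]card_ord -prodr_const.
apply: ler_prod => i _; rewrite subr_ge0 (ltW (pb j)) /=.
have := nc_ge_sub 1 (tnth t i * tnth b j); rewrite nc1; apply: le_trans.
rewrite lerB // ncM -[leRHS]mul1r ler_wpM2r ?nc_ge0 //.
by have /unit_discE/ltW := d i.
Qed.

Lemma Eb_neq0 (z : Cn n) j : Gn z -> Eb z (tnth b j) != 0.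
Proof.
move=> /(Eb_lower j) h; rewrite -nc_gt0; apply: lt_le_trans h.
by rewrite exprn_gt0 // subr_gt0.
Qed.

Let FD_nth k z : FD (fun z : Cn n => nth 0 (1 :: z) k) z.
Proof.
case: k => [|k]; first exact: FD_cst.
have [kn|nk] := ltnP k n.
  have -> : (fun z : Cn n => nth 0 (1 :: z) k.+1) = fun z => tnth z (Ordinal kn).
    by apply/funext => y; rewrite (tnth_nth 0).
  exact: FD_coord.
have -> : (fun z : Cn n => nth 0 (1 :: z) k.+1) = fun=> 0.
  by apply/funext => y; rewrite /= nth_default // size_tuple.
exact: FD_cst.
Qed.

Let bdd_nth k : bdd (fun z : Cn n => nth 0 (1 :: z) k).
Proof.
case: k => [|k]; first exact: bdd_cst.
have [kn|nk] := ltnP k n.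
  have -> : (fun z : Cn n => nth 0 (1 :: z) k.+1) = fun z => tnth z (Ordinal kn).
    by apply/funext => y; rewrite (tnth_nth 0).
  exact: bdd_coord.
have -> : (fun z : Cn n => nth 0 (1 :: z) k.+1) = fun=> 0.
  by apply/funext => y; rewrite /= nth_default // size_tuple.
exact: bdd_cst.
Qed.

Lemma FD_kap z : Gn z -> FD kap z.
Proof.
move=> Gz; apply: FD_sum => s; apply: FD_mul; first exact: FD_cst.
apply: FD_prod => i; under eq_fun do rewrite mxE; set j := s i.
apply: FD_mul.
  apply: FD_mul; first exact: FD_cst.
  by apply: FD_sum => k; apply: FD_mul; [exact: FD_cst|apply: FD_mul => //; exact: FD_cst].
apply: FD_inv; first by rewrite expf_neq0 // Eb_neq0.
have FE : FD (fun z => Eb z (tnth b j)) z by apply: FD_sum => k; apply: FD_mul => //; exact: FD_cst.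
by under eq_fun do rewrite expr2; exact: FD_mul.
Qed.

Lemma bdd_kap : bdd kap.
Proof.
apply: bdd_sum => s; apply: bdd_mul; first exact: bdd_cst.
apply: bdd_prod => i; under eq_fun do rewrite mxE; set j := s i.
apply: bdd_mul.
  apply: bdd_mul; first exact: bdd_cst.
  by apply: bdd_sum => k; apply: bdd_mul; [exact: bdd_cst|apply: bdd_mul => //; exact: bdd_cst].
apply: (bdd_inv (m := ((1 - nc (tnth b j)) ^+ n) ^+ 2)) => [|z Gz].
  by rewrite !exprn_gt0 // subr_gt0.
rewrite ncX; have e0 : 0 <= (1 - nc (tnth b j)) ^+ n by rewrite exprn_ge0 // subr_ge0 ltW.
by rewrite lerXn2r ?nnegrE ?nc_ge0 // Eb_lower.
Qed.

Lemma kap_holomorphic : holomorphic_on (@Gn n) kap.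
Proof.
apply/holomorphic_onE => z /FD_kap[a sa]; exists a => e /sa[de de0 H].
by exists de => // h /H.
Qed.

Lemma es_split (t : Cn n) k : exists Q : {poly C}, es t = (1 + tnth t k *: 'X) * Q /\ (size Q <= n)%N.
Proof.
exists (es [seq tnth t m | m <- enum (predC1 k)]); split.
  by rewrite {1}/es big_tuple (bigD1 k) //= /es big_map big_enum.
by apply: leq_trans (size_es _) _; rewrite size_map -cardE cardC1 card_ord prednK // (leq_ltn_trans _ (ltn_ord k)).
Qed.

Let Wm (t : Cn n) : 'M[C]_n := \matrix_(k, m) (- tnth t k) ^+ m.
Let Tm (t : Cn n) : 'M[C]_n := \matrix_(m, i) if (m <= i)%N then (es t)`_(i - m) else 0.

(** Expansion of E / (1 + t_k X) by the geometric series. In matrix form the quotients' coefficients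
    are a Vandermonde matrix in the -t_k times a unitriangular matrix in the symmetric functions. *)
Let quotient_coef (t : Cn n) k (Q : {poly C}) i : es t = (1 + tnth t k *: 'X) * Q ->
  Q`_i = \sum_(m < i.+1) (- tnth t k) ^+ m * (es t)`_(i - m).
Proof.
move=> tQ; have c j : (es t)`_j = Q`_j + tnth t k * (if j is j'.+1 then Q`_j' else 0).
  by rewrite tQ mulrDl mul1r -scalerAl coefD coefZ coefXM; case: j.
elim: i => [|i IH]; first by rewrite big_ord_recl big_ord0 expr0 mul1r addr0 c mulr0 addr0.
rewrite big_ord_recl expr0 mul1r subn0 c.
have -> : \sum_(m < i.+1) (- tnth t k) ^+ lift ord0 m * (es t)`_(i.+1 - lift ord0 m) = - tnth t k * Q`_i.
  by rewrite IH mulr_sumr; apply: eq_bigr => m _; rewrite lift0 subSS exprS mulrA.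
by ring.
Qed.

(** The matrix factors as [Wm] times [Tm] times the matrix of [kap]: with E = (1 + t_k X) Q one has
    (1 + t_k x)^-2 = Q(x)^2 / E(x)^2, and Q^2 is linear in the coefficients of Q once E is known, by
    Q^2 = (Q + x Q') E - x Q E'. *)
Lemma det_kernel_matrix (t : Cn n) : polyd t ->
  \det (\matrix_(k, j) ((1 + tnth t k * tnth b j) ^+ 2)^-1) = \det (Wm t) * kap (pi_n t).
Proof.
move=> pt.
have dT : \det (Tm t) = 1.
  rewrite -det_tr det_trig; last first.
    by apply/is_trig_mxP => i j ij; rewrite !mxE leqNgt ij.
  by apply: big1 => i _; rewrite !mxE leqnn subnn -nth_pi.
transitivity (\det (Wm t) * \det (Tm t) * kap (pi_n t)); last by rewrite dT mulr1.
rewrite /kap -!det_mulmx; congr (\det _).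
apply/matrixP => k j; rewrite !mxE.
have [Q [tQ sQ]] := es_split t k; set x := tnth b j.
have WT i : (Wm t *m Tm t) k i = Q`_i.
  rewrite (quotient_coef i tQ) !mxE; under eq_bigr do rewrite !mxE.
  rewrite (big_ord_widen n (fun m => (- tnth t k) ^+ m * (es t)`_(i - m))) ?ltn_ord //.
  rewrite [RHS]big_mkcond /=; apply: eq_bigr => m _; rewrite ltnS.
  by case: ifP => //; rewrite mulr0.
have E0 := Eb_neq0 j (polyd_Gn pt); rewrite -/x Eb_pi in E0.
under eq_bigr do rewrite WT mxE /kap_entry Eb_pi -/x mulrA.
rewrite -mulr_suml.
have -> : \sum_(i < n) Q`_i * Nb (pi_n t) x i =
    (Q.[x] + x * (deriv Q).[x]) * (es t).[x] - x * Q.[x] * (deriv (es t)).[x].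
  rewrite -(sum_coef_weighted x sQ) (horner_coef_wide _ sQ) -big_split /= !mulr_suml mulr_sumr mulr_suml -sumrB.
  by apply: eq_bigr => i _; rewrite Nb_pi -natr1; ring.
(* The derivative of E = (1 + t_k X) Q, which reduces the combination above to Q(x)^2. *)
have dE : (deriv (es t)).[x] = tnth t k * Q.[x] + (1 + tnth t k * x) * (deriv Q).[x].
  rewrite tQ derivM derivD derivC derivZ derivX add0r !hornerE; ring.
have EE : (es t).[x] = (1 + tnth t k * x) * Q.[x].
  by rewrite tQ hornerM hornerD hornerC hornerZ hornerX.
rewrite dE EE; move: E0; rewrite EE mulf_eq0 negb_or => /andP[d0 q0].
by field; rewrite d0 q0.
Qed.

Lemma vdmE m (t : Cn m) : vdm t = \prod_(i < m) \prod_(j < m | (i < j)%N) (tnth t j - tnth t i).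
Proof.
elim: m t => [|m IH] t; first by rewrite big_ord0.
have [x [s ->]] := consP t; rewrite vdm_cons IH big_ord_recl; congr (_ * _).
  rewrite [RHS]big_mkcond [RHS]big_ord_recl /= mul1r; apply: eq_bigr => j _.
  by rewrite tnth_consS tnth_cons0.
apply: eq_bigr => i _; rewrite [RHS]big_mkcond [RHS]big_ord_recl /= mul1r [LHS]big_mkcond.
by apply: eq_bigr => j _; rewrite !tnth_consS.
Qed.

(** The constant s is the sign between the Vandermonde determinants in the -t_k and in the t_k. *)
Lemma det_kernel_kap : exists2 s : C, s != 0 & forall t : Cn n, polyd t ->
  \det (\matrix_(k, j) ((1 + tnth t k * tnth b j) ^+ 2)^-1) = s * (vdm t * kap (pi_n t)).
Proof.
exists (\prod_(i < n) \prod_(j < n | (i < j)%N) (-1)).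
  by apply/prodf_neq0 => i _; apply/prodf_neq0 => j _; rewrite oppr_eq0 oner_eq0.
move=> t pt; rewrite det_kernel_matrix // mulrA; congr (_ * _).
have -> : Wm t = (Vandermonde n (\row_k (- tnth t k)))^T.
  by apply/matrixP => k m; rewrite !mxE.
rewrite det_tr det_Vandermonde vdmE -big_split; apply: eq_bigr => i _ /=.
by rewrite -big_split; apply: eq_bigr => j _; rewrite !mxE /=; ring.
Qed.

End kappa.

(** * Permutations of the roots and the final orthogonality argument *)

Lemma vdm_neq0 n (t : Cn n) : injective (tnth t) -> vdm t != 0.
Proof.
move=> it; rewrite vdmE; apply/prodf_neq0 => i _; apply/prodf_neq0 => j ij.
by rewrite subr_eq0; apply/eqP => /it ji; move: ij; rewrite ji ltnn.
Qed.

Definition permt n (x : Cn n) (s : {perm 'I_n}) : Cn n := [tuple tnth x (s k) | k < n].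

Lemma pi_perm n (x : Cn n) s : pi_n (permt x s) = pi_n x.
Proof.
have E : es (permt x s) = es x.
  rewrite /es !big_tuple [RHS](reindex_inj (@perm_inj _ s)) /=.
  by apply: eq_bigr => j _; rewrite tnth_mktuple.
by apply: eq_from_tnth => k; rewrite !tnth_mktuple !esym_kE E.
Qed.

Lemma vdm_perm n (x : Cn n) (s : {perm 'I_n}) : vdm (permt x s) = (-1) ^+ s * vdm x.
Proof.
have E (t : Cn n) : vdm t = \det (Vandermonde n (\row_k tnth t k)).
  by rewrite vdmE det_Vandermonde; apply: eq_bigr => i _; apply: eq_bigr => j _; rewrite !mxE.
rewrite !E.
have -> : Vandermonde n (\row_k tnth (permt x s) k) = col_perm s (Vandermonde n (\row_k tnth x k)).
  by apply/matrixP => i j; rewrite !mxE tnth_mktuple.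
by rewrite col_permE det_mulmx det_perm odd_permV mulrC.
Qed.

Lemma mul_le_sqr (u v : Rr) : 0 <= u -> 0 <= v -> u * v <= u ^+ 2 + v ^+ 2.
Proof. by move=> u0 v0; have := sqr_ge0 (u - v); have := mulr_ge0 u0 v0; nra. Qed.

Section assembly.
Variables (n : nat) (f : Cn n -> C) (b w : Cn n).
Hypothesis fA : bergman_space (@Gn n) f.
Hypothesis pb : polyd b.
Hypothesis Gw : Gn w.
Hypothesis kw : kap b w = 0.
Hypothesis rep : forall k, bergman_space (@Gn n) k ->
      vint (restr (@Gn n) (fun z => complex.Re (k z * (f z)^*))) = (complex.Re (k w))%:E /\
      vint (restr (@Gn n) (fun z => complex.Im (k z * (f z)^*))) = (complex.Im (k w))%:E.

Let rst (F : Cn n -> C) z : C := if `[< Gn z >] then F z else 0.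
Let kG := rst (kap b).
Let fG := rst f.

Let sq0 : sqnorm 0 = 0. Proof. by rewrite sqnormE nc0 expr0n. Qed.

Let mkG : measurable_fun setT kG.
Proof. exact: measurable_holomorphic (@measurable_Gn n) (kap_holomorphic pb). Qed.

Let mfG : measurable_fun setT fG.
Proof. by apply: measurable_holomorphic (@measurable_Gn n) _; case: fA. Qed.

Let msq (F : Cn n -> C) : measurable_fun setT F -> measurable_fun setT (fun z => (sqnorm (F z))%:E).
Proof. by move=> mF; apply/measurable_EFinP; exact: measurable_sqnorm. Qed.

Let vint_sq (F : Cn n -> C) : measurable_fun setT (rst F) ->
  vint (restr (@Gn n) (fun z => sqnorm (F z))) = (\int[muN n]_z (sqnorm (rst F z))%:E)%E.
Proof.
move=> mF; rewrite -vintE_ge0; [|exact: msq|by move=> z; rewrite lee_fin sqnorm_ge0].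
congr vint; apply/funext => z; rewrite /restr /rst; case: asboolP => //; by rewrite sq0.
Qed.

Let int_sq (F : Cn n -> C) : measurable_fun setT F ->
  (\int[muN n]_z (sqnorm (F z))%:E < +oo)%E -> (muN n).-integrable setT (EFin \o (fun z => sqnorm (F z))).
Proof.
move=> mF fin; apply/integrableP; split; first exact: msq.
by under eq_integral do rewrite /= ger0_norm ?sqnorm_ge0 //.
Qed.

Let int_fG : (\int[muN n]_z (sqnorm (fG z))%:E < +oo)%E.
Proof. by rewrite -vint_sq //; case: fA. Qed.

Let int_kG : (muN n).-integrable setT (EFin \o (fun z => sqnorm (kG z))).
Proof.
have [K HK] := bdd_kap pb.
have [ir _] : cintegrable (muN n) (fun z => rc (sqnorm (kG z))).
  apply: (@cintegrable_bounded (#|{set 'I_n}|%:R) n _ (`|K| ^+ 2)).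
  - by apply: measurableC_rc; exact: measurable_sqnorm.
  - move=> z; rewrite nc_rc ger0_norm ?sqnorm_ge0 // sqnormE lerXn2r ?nnegrE ?nc_ge0 //.
    rewrite /kG /rst; case: asboolP => [/HK h|_]; last by rewrite nc0.
    by apply: le_trans h (ler_norm K).
  - move=> z; rewrite /kG /rst; case: asboolP => [Gz _|_]; first exact: Gn_bounded.
    by rewrite sq0 eqxx.
exact: ir.
Qed.

Let kapA : bergman_space (@Gn n) (kap b).
Proof.
split; first exact: kap_holomorphic.
rewrite vint_sq //; have /integrableP[_] := int_kG.
by under eq_integral do rewrite /= ger0_norm ?sqnorm_ge0 //.
Qed.

(** The integrand of the pairing of [kap b] with f, extended by 0; it is integrable since both
    factors are square integrable. *)
Let h z := kG z * cj (fG z).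

Let ih : cintegrable (muN n) h.
Proof.
have ig := integrableD measurableT int_kG (int_sq mfG int_fG).
apply: (cintegrable_le (g := fun z => sqnorm (kG z) + sqnorm (fG z))).
- by apply: measurableC_mul => //; exact: measurableC_cj.
- by apply: eq_integrable ig => // z _.
- move=> z; rewrite /h ncM nc_cj !sqnormE.
  by apply: mul_le_sqr; exact: nc_ge0.
Qed.

(** The reproducing property of f applied to [kap b], which vanishes at w. *)
Let CIh : CI (muN n) h = 0.
Proof.
have [hr hi] := rep kapA; have [ir ii] := ih.
apply: complexP; rewrite /= /Rintegral.
- rewrite -[X in fine X](vintE ir) (_ : vint _ = 0%E) //.
  rewrite -[RHS]/(0%:E) -[0 in RHS]/(Re 0) -kw -hr; congr vint; apply/funext => z.
  by rewrite /restr /h /kG /fG /rst /=; case: asboolP => // _; rewrite mul0r.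
- rewrite -[X in fine X](vintE ii) (_ : vint _ = 0%E) //.
  rewrite -[RHS]/(0%:E) -[0 in RHS]/(Im 0) -kw -hi; congr vint; apply/funext => z.
  by rewrite /restr /h /kG /fG /rst /=; case: asboolP => // _; rewrite mul0r.
Qed.

Let g t : C := if `[< polyd t >] then f (pi_n t) * vdm t else 0.

Let gE t : g t = fG (pi_n t) * vdm t.
Proof.
rewrite /g /fG /rst; case: asboolP => [/polyd_Gn Gt|pt]; first by rewrite asboolT.
by rewrite asboolF ?mul0r // => /Gn_rootP.
Qed.

Let mg : measurable_fun setT g.
Proof.
rewrite (_ : g = fun t => fG (pi_n t) * vdm t); last by apply/funext.
by apply: measurableC_mul; [exact: (measurableT_comp mfG (@measurable_pi n))|exact: measurable_vdm].
Qed.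

(** g is square integrable by [integral_pi]; on the polydisc, of finite volume, |g| <= 1 + |g|^2
    gives integrability. *)
Let ig : cintegrable (muN n) g.
Proof.
have [c c0 cov] := integral_pi n.
have fin : (\int[muN n]_t (sqnorm (g t))%:E < +oo)%E.
  have -> : (\int[muN n]_t (sqnorm (g t))%:E = c%:E * \int[muN n]_z (sqnorm (fG z))%:E)%E.
    rewrite -cov; [|exact: msq|by move=> z; rewrite lee_fin sqnorm_ge0].
    by apply: eq_integral => t _; rewrite gE sqnormM EFinM.
  by apply: lte_mul_pinfty.
have i1 := integrableD measurableT (@integrable_bxf 1 n) (int_sq mg fin).
apply: (cintegrable_le (g := fun t => bxf 1 t + sqnorm (g t)) mg).
  by apply: eq_integrable i1 => // z _.
move=> t; have [pt|pt] := pselect (polyd t); last first.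
  by rewrite /g asboolF // nc0 addr_ge0 ?bxf_ge0 ?sqnorm_ge0.
rewrite bxf1; last by move=> j; exact: ltW.
by rewrite sqnormE -[leLHS]mul1r -[X in X + _](expr1n _ 2) mul_le_sqr ?nc_ge0.
Qed.

Let D t : C := \det (\matrix_(k, j) ((1 + tnth t k * tnth b j) ^+ 2)^-1).

(** [CIh] transported to the polydisc and conjugated: |V|^2 = V conj(V), one factor V turning
    [kap b] into D and the other turning f(pi_n) into g. *)
Let CIgD : cintegrable (muN n) (fun t => g t * cj (D t)) /\ CI (muN n) (fun t => g t * cj (D t)) = 0.
Proof.
have [c c0 cov] := integral_pi n; have [s s0 Hs] := det_kernel_kap pb.
have mw : measurable_fun setT (fun t : Cn n => sqnorm (vdm t) : mR).
  by apply: measurable_sqnorm; exact: measurable_vdm.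
have [i1 E1] := cov_CI c0 (fun t => sqnorm_ge0 (vdm t)) (@measurable_pi n) mw cov ih.
have E t : cj (s * (h (pi_n t) * rc (sqnorm (vdm t)))) = g t * cj (D t).
  have [pt|pt] := pselect (polyd t); last first.
    rewrite /g asboolF // mul0r /h /kG /rst asboolF; last by move=> /Gn_rootP.
    by rewrite !mul0r mulr0 conjc0.
  rewrite gE /D Hs // /h /kG {1}/rst asboolT; last exact: polyd_Gn.
  by rewrite -mul_cj !cjM !conjcK; ring.
split.
  have := cintegrableZ s i1 => -[r i].
  apply: eq_cintegrable (_ : cintegrable _ (fun t => cj (s * (h (pi_n t) * rc (sqnorm (vdm t)))))) => //.
  split; first by apply: eq_integrable r => // t _ /=; case: (s * _).
  by apply: eq_integrable (integrableN i) => // t _ /=; case: (s * _).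
rewrite -(eq_CI (muN n) E) CI_cj; last exact: cintegrableZ.
by rewrite CIZ // E1 CIh !mulr0 conjc0.
Qed.

(** The conjugate of D is the alternating sum of the polydisc kernels at the permutations of x. The
    reproducing formula turns the vanishing integral into an alternating sum of values of g, and
    since g is alternating all its terms are equal. *)
Lemma kernel_zero (x : Cn n) : polyd x -> injective (tnth x) ->
  (forall j, tnth b j = - cj (tnth x j)) -> f (pi_n x) = 0.
Proof.
move=> px ix bx.
have pxs s : polyd (permt x s) by move=> j; rewrite tnth_mktuple.
have hg : sephol g by apply: sephol_pullback; case: fA.
have g0 t : ~ polyd t -> g t = 0 by move=> pt; rewrite /g asboolF.
have B s := bergman_polydisc ig hg g0 (pxs s).
have DE t : cj (D t) = \sum_(s : {perm 'I_n}) (-1) ^+ s * kbn (permt x s) t.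
  rewrite /D /determinant rmorph_sum; apply: eq_bigr => s _.
  rewrite rmorphM rmorph_sign; congr (_ * _); rewrite rmorph_prod /kbn; apply: eq_bigr => k _.
  by rewrite mxE tnth_mktuple bx /kb fmorphV rmorphXn rmorphD rmorph1 rmorphM rmorphN /= conjcK mulrN.
have [_ E0] := CIgD.
have : CI (muN n) (fun t => \sum_(s : {perm 'I_n}) (-1) ^+ s * (g t * kbn (permt x s) t)) = 0.
  transitivity (CI (muN n) (fun t => g t * cj (D t))); last exact: E0.
  apply: eq_CI => t; rewrite DE mulr_sumr; apply: eq_bigr => s _.
  by rewrite mulrCA.
rewrite CI_sum; last by move=> s; apply: cintegrableZ; have [] := B s.
have gs (s : {perm 'I_n}) : g (permt x s) = (-1) ^+ s * (f (pi_n x) * vdm x).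
  by rewrite /g asboolT // pi_perm vdm_perm mulrCA.
have T (s : {perm 'I_n}) : CI (muN n) (fun t => (-1) ^+ s * (g t * kbn (permt x s) t)) = rc c0 ^+ n * (f (pi_n x) * vdm x).
  by have [_ Es] := B s; rewrite CIZ ?Es ?gs; [rewrite mulrCA signrMK|have [] := B s].
(* n! equal terms sum to 0, and n!, [c0] and the Vandermonde product of x are nonzero. *)
under eq_bigr do rewrite T; rewrite sumr_const => /eqP; rewrite mulrn_eq0 => /orP[/eqP c|].
  have : (0 < #|{perm 'I_n}|)%N by apply/card_gt0P; exists 1%g.
  by rewrite c.
rewrite !mulf_eq0 expf_eq0 (negbTE (vdm_neq0 ix)) orbF => /orP[/andP[_]|/eqP //].
by rewrite -nc_eq0 nc_rc normr_eq0 gt_eqF // c0_gt0.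
Qed.

End assembly.

Theorem mainTheorem1 (n : nat) (K : Cn n -> Cn n -> C) :
  (3 <= n)%N -> is_bergman_kernel (@Gn n) K ->
  exists z w : Cn n, Gn z /\ Gn w /\ K z w = 0.
Proof.
move=> n3 HK; have [a [y [pa py ia iy Dy]]] := det_kernel_zero n3.
(* With x = conj(a) and b = -a the factors 1 + t_k b_j are the 1 - t_k conj(x_j) of the disc kernel
   at x. *)
pose b : Cn n := [tuple - tnth a j | j < n]; pose x : Cn n := [tuple cj (tnth a j) | j < n].
have px : polyd x by move=> j; rewrite tnth_mktuple nc_cj.
have pb : polyd b by move=> j; rewrite tnth_mktuple ncN.
have ix : injective (tnth x) by move=> i j; rewrite !tnth_mktuple => /(can_inj (@conjcK _))/ia.
have bx j : tnth b j = - cj (tnth x j) by rewrite !tnth_mktuple conjcK.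
exists (pi_n x), (pi_n y); have Gw := polyd_Gn py; split; first exact: polyd_Gn.
split => //; have [fA rep] := HK _ Gw.
apply: (kernel_zero fA pb _ rep px ix bx).
(* The determinant vanishes at y while the sign and the Vandermonde product of y do not, so [kap b]
   vanishes at [pi_n y]. *)
have [s s0 Hs] := det_kernel_kap pb; have := Hs y py.
have -> : \matrix_(k, j) ((1 + tnth y k * tnth b j) ^+ 2)^-1 =
    \matrix_(k, j) ((1 - tnth y k * tnth a j) ^+ 2)^-1.
  by apply/matrixP => k j; rewrite !mxE tnth_mktuple mulrN.
rewrite Dy => /esym/eqP; rewrite !mulf_eq0 (negbTE s0) (negbTE (vdm_neq0 iy)) /=.
by move/eqP.
Qed.
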